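(* Let $q\in\mathcal{GC}^\infty([t_1,t_2],\widetilde{\mathbb R}^d)$ be a weak extremal of the functional $J$, i.e. $\delta J(q;h)=0$ for all $h\in\mathcal{GC}^\infty_0(m)$. Then $q$ satisfies the higher-order Euler–Lagrange equations $$\sum_{i=0}^{m}(-1)^i\frac{d^i}{dt^i}\,\partial_{i+2}L[q]^m(t)=0\qquad\forall t\in[t_1,t_2].$$
   Context: Ring of scalars. Fix a net $\rho=(\rho_\varepsilon)_{\varepsilon\in(0,1]}$ in $(0,1]$ with $\rho_\varepsilon\to0$ as $\varepsilon\to0^+$. ''For $\varepsilon$ small'' means: for all $\varepsilon\in(0,\varepsilon_0]$, for some $\varepsilon_0\in(0,1]$. A net $(x_\varepsilon)\in\mathbb R^{(0,1]}$ is moderate if there is $N\in\mathbb N$ with $|x_\varepsilon|\le\rho_\varepsilon^{-N}$ for $\varepsilon$ small; $(x_\varepsilon)\sim(y_\varepsilon)$ if for all $n\in\mathbb N$, $|x_\varepsilon-y_\varepsilon|\le\rho_\varepsilon^n$ for $\varepsilon$ small. $\widetilde{\mathbb R}$ is the ring of moderate nets modulo $\sim$ with pointwise operations; classes are written $[x_\varepsilon]$, similarly for $\widetilde{\mathbb R}^n$. Order: $x\le y$ iff there are representatives $x=[x_\varepsilon]$, $y=[y_\varepsilon]$ with $x_\varepsilon\le y_\varepsilon$ for all $\varepsilon$; $x<y$ means $x\le y$ and $y-x$ is invertible; $\widetilde{\mathbb R}_{>0}=\{x: x>0\}$. $[a,b]=\{x\in\widetilde{\mathbb R}: a\le x\le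 b\}$, $(a,b)=\{x: a<x<b\}$, $|[x_\varepsilon]|=[|x_\varepsilon|]$, $B_r(c)=\{x\in\widetilde{\mathbb R}^n:|x-c|<r\}$ for $r\in\widetilde{\mathbb R}_{>0}$. The sharp topology on $\widetilde{\mathbb R}^n$ has these balls as a base; all topological notions refer to it. Generalized smooth functions (GSF). For $\Omega_\varepsilon\subseteq\mathbb R^n$, $\langle\Omega_\varepsilon\rangle$ is the set of $[x_\varepsilon]\in\widetilde{\mathbb R}^n$ such that for every representative $(x'_\varepsilon)$ one has $x'_\varepsilon\in\Omega_\varepsilon$ for $\varepsilon$ small. For $X\subseteq\widetilde{\mathbb R}^n$, $Y\subseteq\widetilde{\mathbb R}^k$, a map $f:X\to Y$ is a GSF, $f\in\mathcal{GC}^\infty(X,Y)$, if there is a net $f_\varepsilon\in C^\infty(\Omega_\varepsilon,\mathbb R^k)$, $\Omega_\varepsilon\subseteq\mathbb R^n$ open, with $X\subseteq\langle\Omega_\varepsilon\rangle$, $f([x_\varepsilon])=[f_\varepsilon(x_\varepsilon)]\in Y$ and $(\partial^\alpha f_\varepsilon(x_\varepsilon))$ moderate for all $[x_\varepsilon]\in X$ and all multi-indices $\alpha$ (one may always choose $\Omega_\varepsilon=\mathbb R^n$). Derivatives at sharply interior points are $\partial^\alpha f([x_\varepsilon])=[\partial^\alpha f_\varepsilon(x_\varepsilon)]$ (independent of choices), and at endpoints of intervals they are the sharp limits from interior points. For $f\in\mathcal{GC}^\infty([a,b],\widetilde{\mathbb R})$ and $c=[c_\varepsilon],e=[e_\varepsilon]\in[a,b]$,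 $\int_c^e f(t)\,dt=[\int_{c_\varepsilon}^{e_\varepsilon}f_\varepsilon(t)\,dt]$ for any $f_\varepsilon\in C^\infty(\mathbb R,\mathbb R)$ defining $f$. Variational setting. Let $t_1<t_2$ in $\widetilde{\mathbb R}$, $d,m\in\mathbb N_{>0}$, $L\in\mathcal{GC}^\infty([t_1,t_2]\times\widetilde{\mathbb R}^{d(m+1)},\widetilde{\mathbb R})$. For $q\in\mathcal{GC}^\infty([t_1,t_2],\widetilde{\mathbb R}^d)$ set $[q]^m(t)=(t,q(t),\dot q(t),\ldots,q^{(m)}(t))$, $L[q]^m(t)=L(t,q(t),\ldots,q^{(m)}(t))$, $J[q]=J(q)=\int_{t_1}^{t_2}L[q]^m(t)\,dt$. $\partial_1L$ is the partial derivative in $t$, and $\partial_{i+2}L$ ($0\le i\le m$) is the gradient with respect to the $\widetilde{\mathbb R}^d$-argument into which $q^{(i)}$ is inserted; $\partial_jL[q]^m(t)$ is $\partial_jL$ evaluated at $[q]^m(t)$. $\mathcal{GC}^\infty_0(m)$ is the set of $h\in\mathcal{GC}^\infty([t_1,t_2],\widetilde{\mathbb R}^d)$ with $h^{(i)}(t_1)=h^{(i)}(t_2)=0$ for $i=0,\ldots,m-1$. First variation: $\delta J(q;h)=\frac{d}{ds}J(q+sh)|_{s=0}$. *)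

(* Defs.v *)
From HB Require Import structures.
From mathcomp Require Import all_boot all_order all_algebra.
From mathcomp Require Import all_classical all_reals all_analysis.

Set Implicit Arguments.
Unset Strict Implicit.
Unset Printing Implicit Defensive.

Import Order.TTheory GRing.Theory Num.Theory.
Import numFieldNormedType.Exports.

Local Open Scope classical_set_scope.
Local Open Scope ring_scope.

(* Nets indexed by (0,1] are functions R -> T, of which only the values on
   (0,1] matter; "for e small" is the filter [0^'+].                         *)
Record gauge (R : realType) := Gauge {
  gauge_fun :> R -> R;
  gauge_gt0 : forall e, 0 < e <= 1 -> 0 < gauge_fun e;
  gauge_le1 : forall e, 0 < e <= 1 -> gauge_fun e <= 1;
  gauge_cvg0 : gauge_fun e @[e --> 0^'+] --> 0 }.

Section ScalarRing.
Context {R : realType}.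
Variable rho : gauge R.

Definition moderate_net (u : R -> R) : Prop :=
  exists N : nat, \forall e \near 0^'+, `|u e| <= (rho e) ^- N.

Definition moderate : {pred R -> R} := fun u => `[< moderate_net u >].

Definition negligible_net (u : R -> R) : Prop :=
  forall n : nat, \forall e \near 0^'+, `|u e| <= (rho e) ^+ n.

Lemma near_gauge : \forall e \near 0^'+, 0 < rho e <= 2^-1.
Proof.
have e01 : \forall e \near (0:R)^'+, 0 < e <= 1.
  near=> e; apply/andP; split; near: e; first exact: nbhs_right_gt.
  exact: nbhs_right_le.
have r2 : \forall e \near (0:R)^'+, rho e <= 2^-1.
  have h : (0 : R) < 2^-1 by rewrite invr_gt0.
  have /cvgrPdist_le /(_ _ h) H := gauge_cvg0 rho.
  near=> e; apply: le_trans (ler_norm _) _.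
  by rewrite -normrN -[- rho e]sub0r; near: e.
near=> e; apply/andP; split; last by near: e.
by apply: gauge_gt0; near: e.
Unshelve. all: by end_near. Qed.

Lemma near_2gauge (N : nat) :
  \forall e \near 0^'+, [/\ 0 < rho e, 2 * (rho e) ^+ N.+1 <= (rho e) ^+ N,
    (forall k, rho e ^+ k > 0)
    & forall k l, (k <= l)%N -> rho e ^+ l <= rho e ^+ k].
Proof.
near=> e.
have /andP[r0 r2] : 0 < rho e <= 2^-1 by near: e; exact: near_gauge.
have r1 : rho e <= 1 by apply: le_trans r2 _; rewrite invf_le1 // ler1n.
split => //.
- rewrite exprS mulrA; apply: ler_piMl; first by rewrite exprn_ge0 ?ltW.
  by rewrite -ler_pdivlMl // mulr1.
- by move=> k; exact: exprn_gt0.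
- by move=> k l kl; apply: ler_wiXn2l => //; exact: ltW.
Unshelve. all: by end_near. Qed.

Lemma moderate_subring_closed : subring_closed moderate.
Proof.
split.
- by apply/asboolP; exists 0%N; near=> e; rewrite expr0 invr1 normr1.
- move=> u v /asboolP[N uN] /asboolP[M vM]; apply/asboolP; exists (N + M).+1.
  near=> e.
  have [r0 r2 rk rle] : [/\ 0 < rho e,
    2 * (rho e) ^+ (N + M).+1 <= (rho e) ^+ (N + M),
    (forall k, rho e ^+ k > 0)
    & forall k l, (k <= l)%N -> rho e ^+ l <= rho e ^+ k].
    by near: e; exact: near_2gauge.
  have ue : `|u e| <= (rho e) ^- N by near: e.
  have ve : `|v e| <= (rho e) ^- M by near: e.
  apply: le_trans (ler_normB _ _) _.
  apply: (@le_trans _ _ (2 * (rho e) ^- (N + M))).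
    rewrite mulr_natl mulr2n; apply: lerD.
      apply: le_trans ue _; rewrite lef_pV2 ?posrE //.
      by apply: rle; exact: leq_addr.
    apply: le_trans ve _; rewrite lef_pV2 ?posrE //.
      by apply: rle; exact: leq_addl.
  by rewrite ler_pdivrMr // mulrC ler_pdivlMr // mulrC.
- move=> u v /asboolP[N uN] /asboolP[M vM]; apply/asboolP; exists (N + M)%N.
  near=> e.
  have ue : `|u e| <= (rho e) ^- N by near: e.
  have ve : `|v e| <= (rho e) ^- M by near: e.
  by rewrite normrM exprD invfM; apply: ler_pM.
Unshelve. all: by end_near. Qed.

HB.instance Definition _ :=
  GRing.isSubringClosed.Build (R -> R) moderate moderate_subring_closed.

Record mnet := MNet { mnet_fun :> R -> R; mnetP : mnet_fun \in moderate }.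

HB.instance Definition _ := [isSub for mnet_fun].
HB.instance Definition _ := [Choice of mnet by <:].
HB.instance Definition _ := [SubChoice_isSubComNzRing of mnet by <:].

Definition negligible_mnet : {pred mnet} := fun u => `[< negligible_net u >].

Lemma negligible_idealr_closed : idealr_closed negligible_mnet.
Proof.
split.
- apply/asboolP => n; near=> e; rewrite /= normr0.
  by have /andP[r0 _] : 0 < rho e <= 2^-1; [near: e; exact: near_gauge |
    rewrite exprn_ge0 ?ltW].
- apply/negP => /asboolP /(_ 1%N) h.
  have : \forall e \near (0:R)^'+, False.
    near=> e.
    have : `|(1 : R)| <= rho e ^+ 1 by near: e.
    have /andP[_ r2] : 0 < rho e <= 2^-1 by near: e; exact: near_gauge.
    by rewrite normr1 expr1 => /le_trans /(_ r2); rewrite invf_ge1 // lern1.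
  by move=> /filter_ex[].
- move=> a u v /asboolP hu /asboolP hv; apply/asboolP => n.
  have /asboolP[N aN] := mnetP a.
  have uN := hu (n.+1 + N)%N; have vn := hv n.+1.
  near=> e.
  have [r0 r2 rk rle] : [/\ 0 < rho e, 2 * (rho e) ^+ n.+1 <= (rho e) ^+ n,
    (forall k, rho e ^+ k > 0)
    & forall k l, (k <= l)%N -> rho e ^+ l <= rho e ^+ k].
    by near: e; exact: near_2gauge.
  have ae : `|a e| <= (rho e) ^- N by near: e.
  have ue : `|u e| <= (rho e) ^+ (n.+1 + N) by near: e.
  have ve : `|v e| <= (rho e) ^+ n.+1 by near: e.
  apply: le_trans r2; rewrite mulr_natl mulr2n.
  apply: le_trans (ler_normD _ _) _; apply: lerD => //.
  have -> : rho e ^+ n.+1 = (rho e) ^- N * (rho e) ^+ (n.+1 + N).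
    by rewrite exprD mulrCA mulVf ?mulr1 // gt_eqF.
  by rewrite normrM; apply: ler_pM.
Unshelve. all: by end_near. Qed.

HB.instance Definition _ :=
  isIdealr.Build mnet negligible_mnet negligible_idealr_closed.

Definition Rt := {ideal_quot negligible_mnet}.
HB.instance Definition _ := GRing.ComNzRing.on Rt.

(* [u_e], with the junk value 0 when the net u is not moderate *)
Definition cls (u : R -> R) : Rt :=
  if insub u is Some v then (\pi_Rt)%qT v else 0.

Definition rep (u : R -> R) (x : Rt) : Prop := moderate_net u /\ x = cls u.

Definition gle (x y : Rt) : Prop :=
  exists u v, [/\ rep u x, rep v y & forall e, 0 < e <= 1 -> u e <= v e].

Definition glt (x y : Rt) : Prop := gle x y /\ exists z, (y - x) * z = 1.

Definition gitv (a b : Rt) : set Rt := [set x | gle a x /\ gle x b].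

End ScalarRing.

Section GeneralizedSmoothFunctions.
Context {R : realType}.
Variable rho : gauge R.
Local Notation Rt := (Rt rho).

(* Generalized points of dimension n are row vectors over Rt; moderateness,
   equivalence and classes of nets in R^n are read coordinatewise.           *)
Definition vmoderate n (u : R -> 'rV[R]_n) : Prop :=
  forall i, moderate_net rho (fun e => u e 0 i).

Definition vcls n (u : R -> 'rV[R]_n) : 'rV[Rt]_n :=
  \row_i cls rho (fun e => u e 0 i).

Definition vrep n (u : R -> 'rV[R]_n) (x : 'rV[Rt]_n) : Prop :=
  vmoderate u /\ x = vcls u.

Definition enorm n (x : 'rV[R]_n) : R := Num.sqrt (\sum_i x 0 i ^+ 2).

(* |[x_e]| = [|x_e|], computed on the representative chosen by [repr] *)
Definition gnorm n (x : 'rV[Rt]_n) : Rt :=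
  cls rho (fun e => enorm (\row_i mnet_fun (repr (x 0 i)) e)).

Definition gball n (c : 'rV[Rt]_n) (r : Rt) : set 'rV[Rt]_n :=
  [set x | glt (gnorm (x - c)) r].

Definition sharp_interior n (X : set 'rV[Rt]_n) : set 'rV[Rt]_n :=
  [set x | exists2 r, glt 0 r & gball x r `<=` X].

Definition sharp_limit n k (A : set 'rV[Rt]_n) (g : 'rV[Rt]_n -> 'rV[Rt]_k)
    (x : 'rV[Rt]_n) (l : 'rV[Rt]_k) : Prop :=
  forall r, glt 0 r -> exists2 s, glt 0 s &
    forall y, A y -> gball x s y -> gball l r (g y).

(* Iterated partial derivatives; a multi-index is encoded by a word listing
   the coordinates of differentiation, so that all orders are covered.       *)
Definition pd n k (w : seq 'I_n) (f : 'rV[R]_n -> 'rV[R]_k) :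
    'rV[R]_n -> 'rV[R]_k :=
  foldr (fun i g => 'D_(delta_mx 0 i) g) f w.

Definition smooth_on n k (Om : set 'rV[R]_n) (f : 'rV[R]_n -> 'rV[R]_k) :
    Prop :=
  forall w x, Om x -> differentiable (pd w f) x.

(* the set written <Om_e> for a net of sets Om_e *)
Definition internal n (Om : R -> set 'rV[R]_n) : set 'rV[Rt]_n :=
  [set x | forall u, vrep u x -> \forall e \near 0^'+, Om e (u e)].

Definition gsf_net n k (X : set 'rV[Rt]_n) (f : 'rV[Rt]_n -> 'rV[Rt]_k)
    (Om : R -> set 'rV[R]_n) (fe : R -> 'rV[R]_n -> 'rV[R]_k) : Prop :=
  [/\ forall e, 0 < e <= 1 -> open (Om e) /\ smooth_on (Om e) (fe e),
      X `<=` internal Om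
    & forall x u, X x -> vrep u x ->
        (forall w, vmoderate (fun e => pd w (fe e) (u e))) /\
        f x = vcls (fun e => fe e (u e))].

(* GC^oo(X, Y); a map X -> Y is a total function whose values outside X are
   irrelevant.                                                               *)
Definition gsf n k (X : set 'rV[Rt]_n) (Y : set 'rV[Rt]_k)
    (f : 'rV[Rt]_n -> 'rV[Rt]_k) : Prop :=
  (forall x, X x -> Y (f x)) /\ exists Om fe, gsf_net X f Om fe.

Definition gpartial_int n k (X : set 'rV[Rt]_n) (f : 'rV[Rt]_n -> 'rV[Rt]_k)
    (w : seq 'I_n) (x : 'rV[Rt]_n) : 'rV[Rt]_k :=
  xget 0 [set y | exists Om fe u, [/\ gsf_net X f Om fe, vrep u x
                   & y = vcls (fun e => pd w (fe e) (u e))]].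

(* Partial derivatives of a generalized smooth function on X: given by the
   nets at sharply interior points, and extended to the other points of X as
   sharp limits from the interior (xget picks the unique such value).        *)
Definition gpartial n k (X : set 'rV[Rt]_n) (f : 'rV[Rt]_n -> 'rV[Rt]_k)
    (w : seq 'I_n) (x : 'rV[Rt]_n) : 'rV[Rt]_k :=
  if w is [::] then f x
  else if `[< sharp_interior X x >] then gpartial_int X f w x
  else xget 0 [set l | sharp_limit (sharp_interior X) (gpartial_int X f w) x l].

(* Functions of one generalized variable, R^1 being identified with R *)
Definition curve k (f : Rt -> 'rV[Rt]_k) : 'rV[Rt]_1 -> 'rV[Rt]_k :=
  fun x => f (x 0 0).

Definition scalarf n (f : 'rV[Rt]_n -> Rt) : 'rV[Rt]_n -> 'rV[Rt]_1 :=
  fun x => const_mx (f x).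

Definition scalarc (f : Rt -> Rt) : Rt -> 'rV[Rt]_1 := fun t => const_mx (f t).

Definition line (X : set Rt) : set 'rV[Rt]_1 := [set x | X (x 0 0)].

Definition cderiv k (X : set Rt) (i : nat) (f : Rt -> 'rV[Rt]_k) (t : Rt) :
    'rV[Rt]_k :=
  gpartial (line X) (curve f) (nseq i 0) (const_mx t).

(* oriented integral over [a,b] or [b,a] *)
Definition oint (f : R -> R) (a b : R) : R :=
  if a <= b then \int[lebesgue_measure]_(t in `[a, b]) f t
  else - \int[lebesgue_measure]_(t in `[b, a]) f t.

(* The integral from c to e of f in GC^oo([a,b], Rt), computed with a net of
   functions smooth on the whole real line (the value does not depend on the
   net).                                                                     *)
Definition gint (a b : Rt) (f : Rt -> Rt) (c e : Rt) : Rt :=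
  xget 0 [set v | exists (fe : R -> 'rV[R]_1 -> 'rV[R]_1) uc ue,
    [/\ gsf_net (line (gitv a b)) (curve (scalarc f))
          (fun=> setT) fe,
        rep uc c, rep ue e
      & v = cls rho (fun eps =>
              oint (fun t => fe eps (const_mx t) 0 0) (uc eps) (ue eps))]].

End GeneralizedSmoothFunctions.

Section Variational.
Context {R : realType}.
Variable rho : gauge R.
Local Notation Rt := (Rt rho).
Variables (t1 t2 : Rt) (d m : nat).

(* [t1,t2] x Rt^(d(m+1)): coordinate 0 is the time, and the other coordinates
   are the entries of an (m+1) x d matrix whose i-th row is the argument into
   which the i-th derivative of the curve is inserted.                       *)
Definition lag_dom : set 'rV[Rt]_(1 + m.+1 * d) :=
  [set x | gitv t1 t2 (lsubmx x 0 0)].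

Definition jet (q : Rt -> 'rV[Rt]_d) (t : Rt) : 'rV[Rt]_(1 + m.+1 * d) :=
  row_mx (const_mx t)
    (mxvec (\matrix_(i < m.+1) cderiv (gitv t1 t2) i q t)).

Variable L : 'rV[Rt]_(1 + m.+1 * d) -> Rt.

Definition grad_lag (i : 'I_m.+1) (x : 'rV[Rt]_(1 + m.+1 * d)) : 'rV[Rt]_d :=
  \row_j gpartial lag_dom (scalarf L) [:: rshift 1 (mxvec_index i j)] x 0 0.

Definition action (q : Rt -> 'rV[Rt]_d) : Rt :=
  gint t1 t2 (fun t => L (jet q t)) t1 t2.

Definition first_variation (q h : Rt -> 'rV[Rt]_d) : Rt :=
  cderiv setT 1 (scalarc (fun s => action (fun t => q t + s *: h t))) 0 0 0.

Definition gsf_curve (q : Rt -> 'rV[Rt]_d) : Prop :=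
  gsf (line (gitv t1 t2)) setT (curve q).

Definition gsf_curve0 (h : Rt -> 'rV[Rt]_d) : Prop :=
  gsf_curve h /\ forall i, (i < m)%N ->
    cderiv (gitv t1 t2) i h t1 = 0 /\ cderiv (gitv t1 t2) i h t2 = 0.

Definition weak_extremal (q : Rt -> 'rV[Rt]_d) : Prop :=
  forall h, gsf_curve0 h -> first_variation q h = 0.

End Variational.

Arguments lag_dom {R rho} t1 t2 d m.

(* Main.v *)
Require Import Defs.
From HB Require Import structures.
From mathcomp Require Import all_boot all_order all_algebra.
From mathcomp Require Import all_classical all_reals all_analysis.
From mathcomp Require Import ring lra zify.

(** The proof is the classical one, carried out on representatives. The first
    variation of the action in the direction [h] is the integral of the sum over
    [i] of the products of the gradient of the Lagrangian in the [i]-th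
    derivative, along the jet of [q], with the [i]-th derivative of [h]. After
    integration by parts it is the integral of [E * h], where [E] is the
    Euler-Lagrange expression. The test curve is
    [((t - t1) * (t2 - t)) ^+ m * E_j] in the direction of the [j]-th
    coordinate; its derivatives of order less than [m] vanish at both
    endpoints because the weight has zeros of order [m] there ([dn_flat],
    [test_curve]). So the integral of [((t - t1) * (t2 - t)) ^+ m * E_j ^+ 2] is
    zero. This forces [E_j] to be zero ([fundamental_lemma]): a representative
    has a Lipschitz constant of the form [rho ^- K], hence if a nonnegative net
    takes a value [rho ^+ n], its integral is at least some power of [rho], which
    is not negligible; the weight is bounded below by a power of [rho] at distance
    [rho ^+ P] from the endpoints, and the Lipschitz bound reaches the endpoints
    when [P] is large.

    The passage between generalized objects and nets rests on [diagonal_net]: a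
    property that holds along every representative of every point holds uniformly
    for small parameters, as otherwise the failures could be collected in one
    representative. It yields local bounds and Lipschitz constants that are powers
    of the gauge ([local_bound], [local_lipschitz]), a margin around the interval
    on which the nets are defined ([slab_margin]), and uniform bounds on the
    interval ([real_selection]). Derivatives do not depend on the net, since a
    function that is negligible near a point has negligible derivatives there
    ([ngl_derivatives]); at boundary points they are the limits from the interior,
    which are again given by the derivatives of the net ([gpartialE]).

    The generalized integral is computed with functions that are smooth on the
    whole line; precomposition with a smooth clamp provides them ([gsf_extend]).
    The number of nodes of a Riemann sum may grow faster than every negative power
    of the gauge, so that an integral is the class of a net of Riemann sums
    ([riemann_net], [gintE]). Being finite sums, these depend smoothly on a
    parameter and are differentiated term by term ([riemann_param]); this
    replaces differentiation under the integral sign, and gives the first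
    variation ([first_variationE]). Integration by parts becomes the statement that
    the Riemann sum of a derivative is the increment of the function, up to a
    negligible error, applied to the boundary form of repeated integration by
    parts ([derive_bform], [parts_net]). *)

Set Implicit Arguments.
Unset Strict Implicit.
Unset Printing Implicit Defensive.

Import Order.TTheory GRing.Theory Num.Theory.
Import numFieldNormedType.Exports.

Local Open Scope classical_set_scope.
Local Open Scope ring_scope.

(** * Nets and their classes *)

Section Nets.
Context {R : realType}.
Variable rho : gauge R.
Implicit Types (u v : R -> R).

Local Notation mod := (moderate_net rho).
Local Notation ngl := (negligible_net rho).
Local Notation cls := (cls rho).

Lemma near_unit : \forall e \near (0 : R)^'+, 0 < e <= 1.
Proof.
near=> e; apply/andP; split; near: e; first exact: nbhs_right_gt.
exact: nbhs_right_le.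
Unshelve. all: by end_near. Qed.

Lemma near_gaugeM (C : R) : \forall e \near 0^'+, C * rho e <= 1.
Proof.
pose C' := Num.max C 1.
have C0 : 0 < C' by rewrite lt_max ltr01 orbT.
have h : (0 : R) < C'^-1 by rewrite invr_gt0.
have /cvgrPdist_le /(_ _ h) H := gauge_cvg0 rho.
near=> e.
have re : rho e <= C'^-1.
  by apply: le_trans (ler_norm _) _; rewrite -normrN -[- rho e]sub0r; near: e.
have r0 : 0 < rho e by apply: gauge_gt0; near: e; exact: near_unit.
apply: (@le_trans _ _ (C' * rho e)).
  by rewrite ler_wpM2r ?(ltW r0)// le_max lexx.
by rewrite mulrC -ler_pdivlMr// mul1r.
Unshelve. all: by end_near. Qed.

Lemma near_gauge_mono : \forall e \near 0^'+, [/\ 0 < rho e, rho e <= 1,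
  (forall k, 0 < rho e ^+ k)
  & forall k l, (k <= l)%N -> rho e ^+ l <= rho e ^+ k].
Proof.
near=> e.
have [r0 _ rk rl] : [/\ 0 < rho e, 2 * (rho e) ^+ 1 <= (rho e) ^+ 0,
    (forall k, rho e ^+ k > 0)
    & forall k l, (k <= l)%N -> rho e ^+ l <= rho e ^+ k].
  by near: e; exact: near_2gauge.
by split=> //; have := rl 0%N 1%N isT; rewrite expr0 expr1.
Unshelve. all: by end_near. Qed.

Lemma near_gaugeMX (C : R) N :
  \forall e \near 0^'+, C * rho e ^+ N.+1 <= rho e ^+ N.
Proof.
apply: filterS2 near_gauge_mono (near_gaugeM C) => e [r0 _ rk _] Cr.
by rewrite exprS mulrA ler_piMl ?(ltW (rk _)).
Qed.

Lemma mod_le u v : (\forall e \near 0^'+, `|u e| <= `|v e|) -> mod v -> mod u.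
Proof.
by move=> uv [N vN]; exists N; near=> e; apply: (@le_trans _ _ `|v e|);
  near: e.
Unshelve. all: by end_near. Qed.

Lemma mod_ev u v : (\forall e \near 0^'+, u e = v e) -> mod u -> mod v.
Proof.
by move=> uv; apply: mod_le; near=> e; rewrite (near uv e).
Unshelve. all: by end_near. Qed.

Lemma modB u v : mod u -> mod v -> mod (fun e => u e - v e).
Proof.
move=> mu mv; have [_ /(_ u v) H _] := moderate_subring_closed rho.
by have /asboolP := H (asboolT mu) (asboolT mv).
Qed.

Lemma modM u v : mod u -> mod v -> mod (fun e => u e * v e).
Proof.
move=> mu mv; have [_ _ /(_ u v) H] := moderate_subring_closed rho.
by have /asboolP := H (asboolT mu) (asboolT mv).
Qed.

Lemma mod_cst (c : R) : mod (fun=> c).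
Proof.
exists 1%N; apply: filterS2 near_gauge_mono (near_gaugeM `|c|) => e [r0 _ _ _].
by rewrite -ler_pdivlMr// mul1r expr1.
Qed.

Lemma modN u : mod u -> mod (fun e => - u e).
Proof. by apply: mod_le; near=> e; rewrite normrN.
Unshelve. all: by end_near. Qed.

Lemma modD u v : mod u -> mod v -> mod (fun e => u e + v e).
Proof.
move=> mu /modN mv; have := modB mu mv.
by apply: mod_ev; near=> e; rewrite opprK.
Unshelve. all: by end_near. Qed.

Lemma mod_sum (I : Type) (r : seq I) (P : pred I) (F : I -> R -> R) :
  (forall i, P i -> mod (F i)) -> mod (fun e => \sum_(i <- r | P i) F i e).
Proof.
move=> H; elim: r => [|i r IH].
  by apply: mod_ev (mod_cst 0); near=> e; rewrite big_nil.
have [Pi|Pi] := boolP (P i).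
  by apply: mod_ev (modD (H i Pi) IH); near=> e; rewrite big_cons Pi.
by apply: mod_ev IH; near=> e; rewrite big_cons (negbTE Pi).
Unshelve. all: by end_near. Qed.

Lemma mod_gauge N : mod (fun e => rho e ^+ N).
Proof.
apply: mod_le (mod_cst 1); apply: filterS near_gauge_mono => e [r0 _ rk rl].
by rewrite normr1 ger0_norm ?(ltW (rk _))//; exact: (rl 0%N).
Qed.

Lemma mod_gaugeV N : mod (fun e => rho e ^- N).
Proof.
exists N; apply: filterS near_gauge_mono => e [r0 _ rk rl].
by rewrite ger0_norm// invr_ge0 ltW.
Qed.

Lemma modX u k : mod u -> mod (fun e => u e ^+ k).
Proof.
move=> mu; elim: k => [|k IH].
  by apply: mod_ev (mod_cst 1); near=> e; rewrite expr0.
by apply: mod_ev (modM mu IH); near=> e; rewrite exprS.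
Unshelve. all: by end_near. Qed.

Lemma ngl_le u v : (\forall e \near 0^'+, `|u e| <= `|v e|) -> ngl v -> ngl u.
Proof.
move=> uv vn n; have vn' := vn n; near=> e.
by apply: (@le_trans _ _ `|v e|); near: e.
Unshelve. all: by end_near. Qed.

Lemma ngl_ev u v : (\forall e \near 0^'+, u e = v e) -> ngl u -> ngl v.
Proof.
by move=> uv; apply: ngl_le; near=> e; rewrite (near uv e).
Unshelve. all: by end_near. Qed.

Lemma ngl_mod u : ngl u -> mod u.
Proof.
move=> /(_ 0%N) un; exists 0%N; near=> e.
by rewrite expr0 invr1 -[leRHS](expr0 (rho e)); near: e.
Unshelve. all: by end_near. Qed.

Lemma nglN u : ngl u -> ngl (fun e => - u e).
Proof. by apply: ngl_le; near=> e; rewrite normrN.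
Unshelve. all: by end_near. Qed.

Lemma ngl0 : ngl (fun=> 0).
Proof.
move=> n; apply: filterS near_gauge_mono => e [r0 _ rk rl].
by rewrite normr0 ltW.
Qed.

Lemma nglD u v : ngl u -> ngl v -> ngl (fun e => u e + v e).
Proof.
move=> nu nv n; apply: filterS3 (near_gaugeMX 2 n) (nu n.+1) (nv n.+1) => e.
move=> r2 ue ve; apply: le_trans r2.
by rewrite mulr_natl mulr2n (le_trans (ler_normD _ _))// lerD.
Qed.

Lemma nglB u v : ngl u -> ngl v -> ngl (fun e => u e - v e).
Proof. by move=> nu /nglN nv; exact: nglD. Qed.

Lemma nglMl u v : mod u -> ngl v -> ngl (fun e => u e * v e).
Proof.
move=> [N uN] nv n.
apply: filterS3 near_gauge_mono uN (nv (n + N)%N) => e [r0 _ rk _] ue ve.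
have -> : rho e ^+ n = rho e ^- N * rho e ^+ (n + N).
  by rewrite exprD mulrCA mulVf ?mulr1// gt_eqF.
by rewrite normrM; apply: ler_pM.
Qed.

Lemma clsE u (mu : u \in moderate rho) :
  cls u = (\pi_(Rt rho))%qT (MNet mu).
Proof.
rewrite /Defs.cls; case: insubP => [w _ wu|]; last by rewrite mu.
congr (_ _); exact: val_inj.
Qed.

Lemma cls_out u : ~ mod u -> cls u = 0.
Proof.
by move=> nu; rewrite /Defs.cls insubN//; apply/negP => /asboolP.
Qed.

Lemma pi_eqP (x y : mnet rho) :
  (\pi_(Rt rho) x = \pi_(Rt rho) y)%qT <-> ngl (fun e => x e - y e).
Proof.
split=> [/eqP|h].
  by rewrite -Quotient.idealrBE => /asboolP.
by apply/eqP; rewrite -Quotient.idealrBE; apply/asboolP.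
Qed.

(** If one of two nets with negligible difference is not moderate, then neither is
    the other and both classes are the junk value. *)
Lemma cls_eq u v : ngl (fun e => u e - v e) -> cls u = cls v.
Proof.
move=> uv; have [mu|mu] := pselect (mod u).
  have mv : mod v.
    by apply: mod_ev (modB mu (ngl_mod uv)); near=> e; rewrite opprB addrC subrK.
  by rewrite (clsE (asboolT mu)) (clsE (asboolT mv)); apply/pi_eqP.
rewrite !cls_out// => mv; apply: mu.
by apply: mod_ev (modD mv (ngl_mod uv)); near=> e; rewrite addrC subrK.
Unshelve. all: by end_near. Qed.

Lemma cls_inj u v : mod u -> mod v -> cls u = cls v -> ngl (fun e => u e - v e).
Proof.
by move=> mu mv; rewrite (clsE (asboolT mu)) (clsE (asboolT mv)) => /pi_eqP.
Qed.

Lemma cls_ev u v : (\forall e \near 0^'+, u e = v e) -> cls u = cls v.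
Proof.
move=> uv; apply: cls_eq; apply: ngl_ev ngl0.
by near=> e; rewrite (near uv e)// subrr.
Unshelve. all: by end_near. Qed.

Lemma cls_repr (x : Rt rho) : cls (mnet_fun (repr x)) = x.
Proof.
rewrite (clsE (mnetP _)).
by rewrite -[RHS]reprK; congr (_ _); exact: val_inj.
Qed.

Lemma cls_surj (x : Rt rho) : exists2 u, mod u & x = cls u.
Proof.
have /asboolP mr := mnetP (repr x).
by exists (repr x) => //; rewrite cls_repr.
Qed.

Lemma clsD u v : mod u -> mod v -> cls (fun e => u e + v e) = cls u + cls v.
Proof.
move=> mu mv; rewrite (clsE (asboolT mu)) (clsE (asboolT mv)).
rewrite (clsE (asboolT (modD mu mv))) -[RHS]rmorphD/=.
by congr (_ _); exact: val_inj.
Qed.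

Lemma clsM u v : mod u -> mod v -> cls (fun e => u e * v e) = cls u * cls v.
Proof.
move=> mu mv; rewrite (clsE (asboolT mu)) (clsE (asboolT mv)).
rewrite (clsE (asboolT (modM mu mv))) -[RHS]rmorphM/=.
by congr (_ _); exact: val_inj.
Qed.

Lemma cls0 : cls (fun=> 0) = 0.
Proof.
rewrite (clsE (asboolT (mod_cst 0))) -(rmorph0 (\pi_(Rt rho))%qT).
by congr (_ _); exact: val_inj.
Qed.

Lemma cls1 : cls (fun=> 1) = 1.
Proof.
rewrite (clsE (asboolT (mod_cst 1))) -(rmorph1 (\pi_(Rt rho))%qT).
by congr (_ _); exact: val_inj.
Qed.

Lemma clsN u : cls (fun e => - u e) = - cls u.
Proof.
have [mu|mu] := pselect (mod u).
  apply/eqP; rewrite -addr_eq0 -clsD//; last exact: modN.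
  by apply/eqP; rewrite -cls0; apply: cls_ev; near=> e; rewrite addNr.
rewrite !cls_out ?oppr0//; contradict mu.
by apply: mod_ev (modN mu); near=> e; rewrite opprK.
Unshelve. all: by end_near. Qed.

Lemma clsB u v : mod u -> mod v -> cls (fun e => u e - v e) = cls u - cls v.
Proof. by move=> mu mv; rewrite clsD ?clsN//; exact: modN. Qed.

Lemma cls_sum (I : Type) (r : seq I) (P : pred I) (F : I -> R -> R) :
  (forall i, P i -> mod (F i)) ->
  cls (fun e => \sum_(i <- r | P i) F i e) = \sum_(i <- r | P i) cls (F i).
Proof.
move=> H; elim: r => [|i r IH].
  by rewrite big_nil -cls0; apply: cls_ev; near=> e; rewrite big_nil.
rewrite big_cons; have [Pi|Pi] := boolP (P i).
  rewrite -IH -clsD//; [|exact: H|exact: mod_sum].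
  by apply: cls_ev; near=> e; rewrite big_cons Pi.
by rewrite -IH; apply: cls_ev; near=> e; rewrite big_cons (negbTE Pi).
Unshelve. all: by end_near. Qed.

Lemma cls_eq0 u : mod u -> (cls u = 0 <-> ngl u).
Proof.
move=> mu; rewrite -cls0; split=> [/cls_inj h|nu].
  by apply: ngl_ev (h mu (mod_cst 0)); near=> e; rewrite subr0.
by apply: cls_eq; apply: ngl_ev nu; near=> e; rewrite subr0.
Unshelve. all: by end_near. Qed.

End Nets.

Section Order.
Context {R : realType}.
Variable rho : gauge R.
Implicit Types (u v a b : R -> R).

Local Notation mod := (moderate_net rho).
Local Notation ngl := (negligible_net rho).
Local Notation cls := (cls rho).

Lemma gle_near u v : mod u -> mod v -> (\forall e \near 0^'+, u e <= v e) ->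
  gle (cls u) (cls v).
Proof.
move=> mu mv uv.
have uE : \forall e \near 0^'+, Num.min (u e) (v e) = u e.
  by apply: filterS uv => e; exact: min_l.
exists (fun e => Num.min (u e) (v e)), v; split=> [||e _].
- split; last by apply: cls_ev; apply: filterS uE.
  by apply: mod_ev mu; apply: filterS uE.
- by split.
- by rewrite ge_min lexx orbT.
Qed.

(** Order relations between classes hold for the given representatives only up
    to an error that is an arbitrary power of the gauge. *)
Lemma gle_cls u v n : mod u -> mod v -> gle (cls u) (cls v) ->
  \forall e \near 0^'+, u e <= v e + rho e ^+ n.
Proof.
move=> mu mv [u' [v' [[mu' uu'] [mv' vv'] le]]].
have := nglB (cls_inj mu mu' uu') (cls_inj mv mv' vv').
move=> /(_ n); apply: filterS2 (near_unit) => e e01 h.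
have := le e e01; move: h; rewrite ler_norml => /andP[_]; lra.
Qed.

Lemma glt_near u v N : mod u -> mod v ->
  (\forall e \near 0^'+, u e + rho e ^+ N <= v e) -> glt (cls u) (cls v).
Proof.
move=> mu mv uv; split.
  apply: gle_near => //; apply: filterS2 uv (near_gauge_mono rho).
  by move=> e uv [_ _ /(_ N) r _]; lra.
have mw : mod (fun e => (v e - u e)^-1).
  exists N; apply: filterS2 uv (near_gauge_mono rho) => e uv [_ _ /(_ N) r _].
  have r1 : rho e ^+ N <= v e - u e by lra.
  by rewrite normfV lef_pV2 ?posrE ?normr_gt0 ?ger0_norm; lra.
exists (cls (fun e => (v e - u e)^-1)).
rewrite -clsB// -clsM//; last exact: modB.
rewrite -(cls1 rho); apply: cls_ev.
apply: filterS2 uv (near_gauge_mono rho) => e uv [_ _ /(_ N) r _].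
by rewrite divff//; lra.
Qed.

(** Invertibility of a difference bounds its absolute value below by a power of
    the gauge, and the order then determines its sign. *)
Lemma glt_cls u v : mod u -> mod v -> glt (cls u) (cls v) ->
  exists N, \forall e \near 0^'+, u e + rho e ^+ N <= v e.
Proof.
move=> mu mv [uv [z]]; have [w mw ->] := cls_surj z; case: (mw) => N wN.
rewrite -clsB// -clsM//; last exact: modB.
rewrite -(cls1 rho) => /cls_inj; move=> /(_ (modM (modB mv mu) mw)).
move=> /(_ (mod_cst rho 1)) /(_ 1%N) h; exists N.+1.
have le := gle_cls N.+2 mu mv uv.
apply: filterS2 (filterI h (filterI wN le)) (filterI (near_gaugeM rho 2)
  (near_gauge_mono rho)) => e [{}h [{}wN {}le]] [r2 [r0 r1 rk _]].
have vw : 2^-1 <= `|v e - u e| * `|w e|.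
  by rewrite -normrM; move: h; rewrite expr1 ler_norml => /andP[h1 h2];
  apply: le_trans (ler_norm _); lra.
have vu : 2^-1 * rho e ^+ N <= `|v e - u e|.
  rewrite -ler_pdivlMr//; apply: le_trans vw _.
  exact: ler_wpM2l.
have rN := rk N.
have d : rho e ^+ N.+1 <= `|v e - u e|.
  by apply: le_trans vu; rewrite exprS; nra.
have rN1 := rk N.+1; move: le; rewrite [rho e ^+ N.+2]exprS => le.
have le' : - (v e - u e) <= 2^-1 * rho e ^+ N.+1 by nra.
by move: d; have [|] := ler0P (v e - u e); lra.
Qed.

Lemma glt0_cls u : mod u -> glt 0 (cls u) ->
  exists N, \forall e \near 0^'+, rho e ^+ N <= u e.
Proof.
move=> mu; rewrite -(cls0 rho) => /(glt_cls (mod_cst rho 0) mu)[N h].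
by exists N; apply: filterS h => e; rewrite add0r.
Qed.

Lemma glt0_gauge N : glt 0 (cls (fun e => rho e ^+ N)).
Proof.
rewrite -(cls0 rho); apply: (@glt_near _ _ N).
- exact: mod_cst.
- exact: mod_gauge.
- by apply: nearW => e; rewrite add0r.
Qed.

Lemma gitv_near a b u : mod a -> mod b -> mod u ->
  (\forall e \near 0^'+, a e <= u e <= b e) -> gitv (cls a) (cls b) (cls u).
Proof.
by move=> ma mb mu h; split; apply: gle_near => //;
  apply: filterS h => e /andP[].
Qed.

Lemma gitv_mod a b u : mod a -> mod b ->
  (\forall e \near 0^'+, a e <= u e <= b e) -> mod u.
Proof.
move=> ma mb h.
have mn w : mod w -> mod (fun e => `|w e|).
  by apply: mod_le; apply: nearW => e; rewrite normr_id.
apply: mod_le (modD (mn _ ma) (mn _ mb)); apply: filterS h => e /andP[ha hb].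
rewrite [leRHS]ger0_norm ?addr_ge0//.
by have := ler_norm (b e); have := ler_norm (- a e); rewrite normrN => h1 h2;
  rewrite ler_norml; have := normr_ge0 (a e); have := normr_ge0 (b e); lra.
Qed.

Definition clamp (a b x : R) := Num.min (Num.max a x) b.

Lemma clamp_itv (a b x : R) : a <= b -> a <= clamp a b x <= b.
Proof.
move=> ab; rewrite /clamp; case: (leP a x) => ax.
  by case: (leP x b) => xb; rewrite ?ax ?ab /= ?lexx.
by rewrite min_l// lexx.
Qed.

Lemma clamp_id (a b x : R) : a <= x <= b -> clamp a b x = x.
Proof. by move=> /andP[ax xb]; rewrite /clamp max_r// min_l. Qed.

Lemma clamp_dist (a b x r : R) : 0 <= r -> a <= b -> a <= x + r -> x <= b + r ->
  `|x - clamp a b x| <= r.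
Proof.
move=> r0 ab ax xb; rewrite /clamp; case: (leP a x) => ax'.
  by case: (leP x b) => xb'; rewrite ?subrr ?normr0// ger0_norm; lra.
by rewrite min_l// ler0_norm; lra.
Qed.

(** Hence every point of a generalized interval has a representative whose values
    lie in the representing intervals. *)
Lemma gitv_clamp a b u : mod a -> mod b -> mod u ->
  (\forall e \near 0^'+, a e <= b e) -> gitv (cls a) (cls b) (cls u) ->
  ngl (fun e => u e - clamp (a e) (b e) (u e)).
Proof.
move=> ma mb mu ab [au ub] n.
apply: filterS3 ab (near_gauge_mono rho)
  (filterI (gle_cls n ma mu au) (gle_cls n mu mb ub)).
move=> e ab' [_ _ rk _] [h1 h2].
by apply: clamp_dist => //; exact: ltW.
Qed.

End Order.

Section Vectors.
Context {R : realType}.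
Variable rho : gauge R.

Local Notation mod := (moderate_net rho).
Local Notation ngl := (negligible_net rho).

Lemma coord_norm n (x : 'rV[R]_n) i : `|x 0 i| <= `|x|.
Proof.
rewrite [leRHS]/Num.Def.normr/= mx_normrE.
exact: (le_bigmax _ (fun ij => `|x ij.1 ij.2|) (ord0, i)).
Qed.

Lemma norm_coord n (x : 'rV[R]_n) (C : R) : 0 <= C -> (forall i, `|x 0 i| <= C) ->
  `|x| <= C.
Proof.
move=> C0 h; rewrite [leLHS]/Num.Def.normr/= mx_normrE.
by apply: bigmax_le => // -[i j] _ /=; rewrite (ord1 i).
Qed.

Lemma vcls_eq n (u v : R -> 'rV[R]_n) : ngl (fun e => `|u e - v e|) ->
  vcls rho u = vcls rho v.
Proof.
move=> h; apply/rowP => i; rewrite !mxE; apply: cls_eq; apply: ngl_le h.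
apply: nearW => e; rewrite normr_id; apply: le_trans (coord_norm _ i).
by rewrite !mxE.
Qed.

Lemma vcls_inj n (u v : R -> 'rV[R]_n) : vmoderate rho u -> vmoderate rho v ->
  vcls rho u = vcls rho v -> ngl (fun e => `|u e - v e|).
Proof.
move=> mu mv /rowP uv k.
have h i : \forall e \near 0^'+, `|u e 0 i - v e 0 i| <= rho e ^+ k.
  by apply: cls_inj k => //; have := uv i; rewrite !mxE.
have H : \forall e \near 0^'+, forall i, `|u e 0 i - v e 0 i| <= rho e ^+ k.
  exact: filter_forall.
apply: filterS2 (near_gauge_mono rho) H => e [_ _ rk _] {}H.
rewrite normr_id; apply: norm_coord => [|i]; first exact: ltW.
by rewrite !mxE.
Qed.

Lemma vmod_norm n (u : R -> 'rV[R]_n) : vmoderate rho u <-> mod (fun e => `|u e|).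
Proof.
split=> [mu|mu i]; last first.
  by apply: mod_le mu; apply: nearW => e; rewrite normr_id coord_norm.
apply: (@mod_le _ _ _ (fun e => \sum_i `|u e 0 i|)).
  apply: nearW => e; rewrite normr_id [leRHS]ger0_norm; last exact: sumr_ge0.
  apply: norm_coord => [|i]; first exact: sumr_ge0.
  by rewrite (bigD1 i)//= lerDl sumr_ge0.
apply: mod_sum => i _.
by apply: mod_le (mu i); apply: nearW => e; rewrite normr_id.
Qed.

Lemma vmod_near n (u v : R -> 'rV[R]_n) : vmoderate rho u ->
  mod (fun e => `|u e - v e|) -> vmoderate rho v.
Proof.
move=> mu /vmod_norm mv i; apply: mod_ev (modB (mu i) (mv i)).
by apply: nearW => e; rewrite !mxE opprB addrC subrK.
Qed.

Lemma vcls_surj n (x : 'rV[Rt rho]_n) : exists2 u, vmoderate rho u & x = vcls rho u.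
Proof.
have h i : {u | mod u /\ x 0 i = cls rho u}.
  by apply: cid; have [u mu xu] := cls_surj (x 0 i); exists u.
exists (fun e => \row_i (sval (h i)) e).
  move=> i; have [mi _] := svalP (h i).
  by apply: mod_ev mi; apply: nearW => e; rewrite mxE.
apply/rowP => i; rewrite mxE; have [_ ->] := svalP (h i).
by apply: cls_ev; apply: nearW => e; rewrite mxE.
Qed.

Lemma enorm_coord n (x : 'rV[R]_n) i : `|x 0 i| <= enorm x.
Proof.
rewrite -sqrtr_sqr ler_sqrt; last by rewrite sumr_ge0// => j _; exact: sqr_ge0.
by rewrite (bigD1 i)//= lerDl sumr_ge0// => j _; exact: sqr_ge0.
Qed.

Lemma enorm_le n (x : 'rV[R]_n) (C : R) : (forall i, `|x 0 i| <= C) ->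
  enorm x <= n%:R * C.
Proof.
move=> h; case: n x h => [x _|n x h].
  by rewrite /enorm big_ord0 sqrtr0 mul0r.
have C0 : 0 <= C by apply: le_trans (h ord0).
rewrite /enorm -[leRHS]ger0_norm ?mulr_ge0//  -sqrtr_sqr ler_sqrt ?sqr_ge0//.
apply: (@le_trans _ _ (\sum_(i < n.+1) C ^+ 2)).
    apply: ler_sum => i _; rewrite -[leLHS]ger0_norm ?sqr_ge0// normrX.
  by rewrite !expr2 ler_pM.
rewrite sumr_const card_ord exprMn -[leLHS]mulr_natl ler_wpM2r ?sqr_ge0//.
by rewrite expr2 ler_peMl// ler1n.
Qed.

Lemma mod_enorm n (z : R -> 'rV[R]_n) : vmoderate rho z ->
  mod (fun e => enorm (z e)).
Proof.
move=> /vmod_norm mz; apply: (@mod_le _ _ _ (fun e => n%:R * `|z e|)).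
  apply: nearW => e; rewrite ger0_norm ?sqrtr_ge0// [leRHS]ger0_norm ?mulr_ge0//.
  by apply: enorm_le => i; exact: coord_norm.
by apply: modM => //; exact: mod_cst.
Qed.

Lemma vcls_repr n (u : R -> 'rV[R]_n) : vmoderate rho u ->
  let z := fun e => \row_i mnet_fun (repr (vcls rho u 0 i)) e in
  ngl (fun e => `|u e - z e|) /\ vmoderate rho z.
Proof.
move=> mu z.
have mz : vmoderate rho z.
  move=> i; have /asboolP := mnetP (repr (vcls rho u 0 i)).
  by move=> h; apply: mod_ev h; apply: nearW => e; rewrite /z mxE.
split=> //; apply: vcls_inj => //.
apply/rowP => i; rewrite [RHS]mxE -[LHS]cls_repr.
by apply: cls_ev; apply: nearW => e; rewrite /z mxE.
Qed.

Lemma vclsB n (u v : R -> 'rV[R]_n) : vmoderate rho u -> vmoderate rho v ->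
  vcls rho u - vcls rho v = vcls rho (fun e => u e - v e).
Proof.
move=> mu mv; apply/rowP => i; rewrite !mxE -clsB//.
by apply: cls_ev; apply: nearW => e; rewrite !mxE.
Qed.

Lemma vmodB n (u v : R -> 'rV[R]_n) : vmoderate rho u -> vmoderate rho v ->
  vmoderate rho (fun e => u e - v e).
Proof.
move=> mu mv i; apply: mod_ev (modB (mu i) (mv i)).
by apply: nearW => e; rewrite !mxE.
Qed.

(** Sharp balls of positive radius and the sup-norm balls of radius a power of
    the gauge are cofinal in each other: this is how the sharp topology is
    accessed below. *)
Lemma gball_near n (c x : R -> 'rV[R]_n) r N : vmoderate rho c ->
  vmoderate rho x -> mod r -> (\forall e \near 0^'+, rho e ^+ N <= r e) ->
  (\forall e \near 0^'+, `|x e - c e| <= rho e ^+ N.+2) ->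
  gball (vcls rho c) (cls rho r) (vcls rho x).
Proof.
move=> mc mx mr rN h; rewrite /gball/= vclsB// /gnorm.
have [zn mz] := vcls_repr (vmodB mx mc).
set z := fun e => \row_i _ in zn mz.
have H : \forall e \near 0^'+, enorm (z e) + rho e ^+ N.+1 <= r e.
  have hn := near_gaugeM rho (2 * n%:R + 1).
  apply: filterS3 (filterI rN h) (filterI (zn N.+2) hn) (near_gauge_mono rho).
  move=> e [{}rN {}h] [{}zn {}hn] [r0 r1 rk rl].
  apply: le_trans rN; have rN := rk N.
  have : enorm (z e) <= n%:R * (2 * rho e ^+ N.+2).
    apply: enorm_le => i; rewrite normr_id in zn.
    have := le_trans (coord_norm _ i) zn; have := le_trans (coord_norm _ i) h.
    rewrite !mxE => h1 h2.
    by move: h1 h2; rewrite !ler_norml => /andP[h1 h2] /andP[h3 h4];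
      apply/andP; split; lra.
  have h1 : (2 * n%:R + 1) * rho e * rho e ^+ N <= rho e ^+ N.
    by rewrite ler_piMl// ltW.
  have h2 : n%:R * (2 * rho e ^+ N.+2) <= n%:R * (2 * rho e ^+ N.+1).
    by rewrite ler_wpM2l// ler_wpM2l// rl.
  by rewrite [rho e ^+ N.+1]exprS in h2 *; lra.
have mE := mod_enorm mz.
by apply: (glt_near (N := N.+1)).
Qed.

Lemma gball_cls n (c x : R -> 'rV[R]_n) N : vmoderate rho c ->
  vmoderate rho x -> 
  gball (vcls rho c) (cls rho (fun e => rho e ^+ N)) (vcls rho x) ->
  \forall e \near 0^'+, `|x e - c e| <= 2 * rho e ^+ N.
Proof.
move=> mc mx; rewrite /gball/= vclsB// /gnorm.
have [zn mz] := vcls_repr (vmodB mx mc).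
set z := fun e => \row_i _ in zn mz *.
have mE := mod_enorm mz.
move=> /(glt_cls mE (mod_gauge rho N))[M h].
apply: filterS3 h (zn N) (near_gauge_mono rho) => e h {}zn [_ _ rk _].
apply: norm_coord => [|i]; first by rewrite mulr_ge0// ltW.
rewrite normr_id in zn; have h1 := le_trans (coord_norm _ i) zn.
have h2 := enorm_coord (z e) i; have := rk M.
by move: h1 h2; rewrite !mxE !ler_norml => /andP[h1 h2] /andP[h3 h4] hM;
   apply/andP; split; lra.
Qed.

End Vectors.

Section Selection.
Context {R : realType}.

(** If a property of nets indexed by a level K fails frequently at every level,
    then one net witnesses all the failures: away from a null sequence of
    parameters it takes a default value, and along it the level of failure goes
    to infinity. *)
Lemma diagonal_net (T : Type) (B : R -> nat -> T -> Prop) (x0 : R -> T) :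
  (forall K, ~ \forall e \near 0^'+, forall y, ~ B e K y) ->
  exists y : R -> T,
    (forall n, \forall e \near 0^'+,
       y e = x0 e \/ exists2 K, (n <= K)%N & B e K (y e)) /\
    (forall n, ~ \forall e \near 0^'+,
       ~ exists2 K, (n <= K)%N & B e K (y e)).
Proof.
move=> H.
have H1 K (d : R) : 0 < d -> exists e, 0 < e < d /\ exists y, B e K y.
  move=> d0; apply: contrapT => h; apply: (H K).
  have hd : \forall e \near (0 : R)^'+, 0 < e < d.
    near=> e; apply/andP; split; near: e; first exact: nbhs_right_gt.
    exact: nbhs_right_lt.
  by apply: filterS hd => e ed y By; apply: h; exists e; split=> //; exists y.
have /choice[s sP] : forall K, exists e, 0 < e < K.+1%:R^-1 /\ exists y, B e K y.
  by move=> K; exact: H1.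
have w e : {y | (exists K, s K = e) -> exists K, s K = e /\ B e K y} .
  apply: cid; have [[K sK]|nK] := pselect (exists K, s K = e).
    have [_ [y By]] := sP K; exists y => _; exists K; split=> //.
    by rewrite -sK.
  by exists (x0 e) => /nK.
pose y e := if `[< exists K, s K = e >] then sval (w e) else x0 e.
(* the levels below n occur at finitely many parameters only *)
have small n : \forall e \near (0 : R)^'+, forall K, s K = e -> (n <= K)%N.
  elim: n => [|n IH]; first by apply: nearW.
  have [/andP[sn0 _] _] := sP n.
  have hn : \forall e \near (0 : R)^'+, e < s n by exact: nbhs_right_lt.
  apply: filterS2 IH hn => e IH en K sK.
  have := IH K sK; rewrite leq_eqVlt => /predU1P[nK|//].
  by move: en; rewrite nK sK ltxx.
exists y; split=> n.
  apply: filterS (small n) => e h; rewrite /y; case: asboolP => [eK|_].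
    right; have [K [sK BK]] := svalP (w e) eK; exists K => //.
    exact: h.
  by left.
move=> h; have [d /= d0 hd] : \forall e \near (0 : R)^'+,
    (forall K, s K = e -> (n <= K)%N) /\ ~ exists2 K, (n <= K)%N & B e K (y e).
  by apply: filterI => //; exact: small.
have [k kd] : exists k, k.+1%:R^-1 < d.
  exists (Num.truncn d^-1); rewrite invf_plt ?posrE//.
  by rewrite truncnS_gt.
have [/andP[s0 sk] _] := sP k.
have [||hk]// := hd (s k).
- rewrite /= sub0r normrN gtr0_norm//; exact: lt_trans kd.
- apply; have ek : exists K, s K = s k by exists k.
  have [K [sK BK]] := svalP (w (s k)) ek.
  by exists K; [exact: hk | rewrite /y asboolT].
Unshelve. all: by end_near. Qed.

End Selection.

(** * Calculus of nets of smooth functions *)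

Section Differentiability.
Context {R : realType}.

Lemma near_eq_differentiable (V W : normedModType R) (f g : V -> W) (x : V) :
  (\near x, f x = g x) -> differentiable f x -> differentiable g x.
Proof.
move=> fg df; pose z : V -> W := g - f.
have z0 : z \o shift x = cst (z x) + (\0 : V -> W) +o_ 0 id.
  apply/eqaddoP => e e0.
  have zx : z x = 0 by rewrite /z !fctE (nbhs_singleton fg) subrr.
  have h := fg; rewrite (near_shift 0 x (fun x => f x = g x)) subr0 in h.
  apply: filterS h => h /= fgh.
  rewrite !fctE /= zx add0r subr0 /z !fctE fgh subrr normr0.
  by rewrite mulr_ge0// ltW.
have c0 : continuous (\0 : {linear V -> W}) by exact: cst_continuous.
have dz : differentiable z x.
  by apply/diff_locallyP; rewrite (diff_unique c0 z0).
have -> : g = z + f by rewrite /z subrK.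
exact: differentiableD.
Qed.

Lemma differentiable_row (V : normedModType R) n (f : V -> 'rV[R]_n) x :
  (forall j, differentiable (fun y => f y 0 j) x) -> differentiable f x.
Proof.
move=> h.
have -> : f = \sum_(j < n) (fun y => f y 0 j *: (delta_mx 0 j : 'rV[R]_n)).
  apply/funext => y; rewrite fct_sumE.
  exact: row_sum_delta.
by apply: differentiable_sum => j; exact: differentiableZl.
Qed.

Lemma differentiable_coordf (V : normedModType R) n (f : V -> 'rV[R]_n) x j :
  differentiable f x -> differentiable (fun y => f y 0 j) x.
Proof.
move=> df; apply: (@differentiable_comp _ _ _ _ f (fun M : 'rV[R]_n => M 0 j)) => //.
exact: differentiable_coord.
Qed.

Lemma derive_coordf (V : normedModType R) n (f : V -> 'rV[R]_n) x v j :
  differentiable f x -> 'D_v f x 0 j = 'D_v (fun y => f y 0 j) x.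
Proof. by move=> df; rewrite derive_mx ?mxE//; exact: diff_derivable. Qed.

Lemma derive_partial n (f : 'rV[R]_n -> R) x v : differentiable f x ->
  'D_v f x = \sum_j v 0 j * 'D_(delta_mx 0 j) f x.
Proof.
move=> df; rewrite deriveE// [in LHS](row_sum_delta v) linear_sum.
by apply: eq_bigr => j _; rewrite linearZ/= -deriveE.
Qed.

Lemma derive_comp_row n p (f : 'rV[R]_p -> R) (g : 'rV[R]_n -> 'rV[R]_p) x v :
  differentiable g x -> differentiable f (g x) ->
  'D_v (fun y => f (g y)) x =
  \sum_j 'D_v (fun y => g y 0 j) x * 'D_(delta_mx 0 j) f (g x).
Proof.
move=> dg df; rewrite deriveE; last exact: differentiable_comp.
rewrite (diff_comp dg df)/= -!deriveE// derive_partial//.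
by apply: eq_bigr => j _; rewrite derive_coordf.
Qed.

Lemma is_derive_line n (f : 'rV[R]_n -> R) (x v : 'rV[R]_n) (s : R) :
  differentiable f (x + s *: v) ->
  is_derive s 1 (fun s => f (x + s *: v)) ('D_v f (x + s *: v)).
Proof.
move=> df.
have E : (fun h : R => h^-1 *: (((fun s : R => f (x + s *: v)) \o shift s)
      (h *: (1 : R)) - f (x + s *: v))) =
    (fun h : R => h^-1 *: ((f \o shift (x + s *: v)) (h *: v)
      - f (x + s *: v))).
  apply/funext => h /=; congr (_ *: (f _ - _)).
  by rewrite [h *: 1]mulr1 scalerDl addrCA.
have dv : derivable f (x + s *: v) v by exact: diff_derivable.
by apply: DeriveDef; rewrite /derivable/derive E.
Qed.

Lemma continuous_line n (f : 'rV[R]_n -> R) (x v : 'rV[R]_n) (s : R) :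
  differentiable f (x + s *: v) -> {for s, continuous (fun r : R => f (x + r *: v))}.
Proof.
move=> /is_derive_line h; apply: differentiable_continuous.
by apply/derivable1_diffP; case: h.
Qed.

Lemma MVT_line n (f : 'rV[R]_n -> R) (x v : 'rV[R]_n) :
  (forall s, 0 <= s <= 1 -> differentiable f (x + s *: v)) ->
  exists2 s, 0 <= s <= 1 & f (x + v) - f x = 'D_v f (x + s *: v).
Proof.
move=> df.
have d1 (s : R) : s \in `]0, 1[%R ->
    is_derive s 1 (fun s : R => f (x + s *: v)) ('D_v f (x + s *: v)).
  rewrite in_itv/= => /andP[s0 s1].
  by apply: is_derive_line; apply: df; rewrite !ltW.
have c1 : {within `[0, 1], continuous (fun s : R => f (x + s *: v))}.
  apply: continuous_in_subspaceT => s; rewrite inE/= in_itv/= => s01.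
  by apply: continuous_line; exact: df.
have [s s01] := MVT_segment ler01 d1 c1.
rewrite scale1r scale0r addr0 subr0 mulr1 => Es.
by exists s => //; move: s01; rewrite in_itv.
Qed.

End Differentiability.

Section Smooth.
Context {R : realType}.
Variable rho : gauge R.

Local Notation mod := (moderate_net rho).

(** The class of nets of points along which moderateness is required is kept apart
    from the open sets: in most cases it consists of the representatives of the
    points of a generalized set, but it is empty when only smoothness for fixed
    parameters is at stake. *)
Record ndom n := NDom {
  nset :> R -> set 'rV[R]_n;
  npts : (R -> 'rV[R]_n) -> Prop;
  nset_open : forall e, 0 < e <= 1 -> open (nset e);
  npts_in : forall u, npts u -> \forall e \near 0^'+, nset e (u e) }.

(** Differentiability and moderateness of the derivatives of order at most [k],
    as a recursion on [k] so that the closure properties are simple inductions. *)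
Fixpoint gCk (k : nat) n (D : ndom n) (f : R -> 'rV[R]_n -> R) : Prop :=
  [/\ forall e x, 0 < e <= 1 -> D e x -> differentiable (f e) x,
      forall u, npts D u -> mod (fun e => f e (u e))
    & if k is k'.+1 then forall i, gCk k' D (fun e => 'D_(delta_mx 0 i) (f e))
      else True].

Definition gsmooth n (D : ndom n) f := forall k, gCk k D f.

Lemma gCk_diff k n (D : ndom n) f : gCk k D f ->
  forall e x, 0 < e <= 1 -> D e x -> differentiable (f e) x.
Proof. by case: k => [|k] []. Qed.

Lemma gCk_mod k n (D : ndom n) f u : gCk k D f -> npts D u ->
  mod (fun e => f e (u e)).
Proof. by case: k => [|k] [] _ h _; exact: h. Qed.

Lemma gCkS k n (D : ndom n) f : gCk k.+1 D f -> gCk k D f.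
Proof.
elim: k f => [|k IH] f [df mf ddf]; first by split.
by split=> // i; apply: IH.
Qed.

Lemma gsmooth_diff n (D : ndom n) f e x : gsmooth D f -> 0 < e <= 1 -> D e x ->
  differentiable (f e) x.
Proof. by move=> h; exact: gCk_diff (h 0%N) _ _. Qed.

Lemma gsmooth_mod n (D : ndom n) f u : gsmooth D f -> npts D u ->
  mod (fun e => f e (u e)).
Proof. by move=> h; exact: gCk_mod (h 0%N). Qed.

Lemma gsmoothD n (D : ndom n) f i : gsmooth D f ->
  gsmooth D (fun e => 'D_(delta_mx 0 i) (f e)).
Proof. by move=> h k; case: (h k.+1) => _ _; exact. Qed.

Lemma near_dom n (D : ndom n) e x : 0 < e <= 1 -> D e x -> \near x, D e x.
Proof. by move=> e01 Dx; apply: open_nbhs_nbhs; split => //; exact: nset_open. Qed.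

Lemma gCk_ext k n (D : ndom n) f g :
  (forall e x, 0 < e <= 1 -> D e x -> f e x = g e x) -> gCk k D f -> gCk k D g.
Proof.
elim: k f g => [|k IH] f g fg.
  case=> df mf _; split => //.
    move=> e x e01 Dx; apply: near_eq_differentiable (df e x e01 Dx).
    by apply: filterS (near_dom e01 Dx) => y; exact: fg.
  move=> u Du; apply: mod_ev (mf u Du).
  by apply: filterS2 (near_unit) (npts_in Du) => e e01; exact: fg.
case=> df mf ddf; split.
- move=> e x e01 Dx; apply: near_eq_differentiable (df e x e01 Dx).
  by apply: filterS (near_dom e01 Dx) => y; exact: fg.
- move=> u Du; apply: mod_ev (mf u Du).
  by apply: filterS2 (near_unit) (npts_in Du) => e e01; exact: fg.
- move=> i; apply: IH (ddf i) => e x e01 Dx; apply: near_eq_derive.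
  by apply: filterS (near_dom e01 Dx) => y; exact: fg.
Qed.

Lemma gsmooth_ext n (D : ndom n) f g :
  (forall e x, 0 < e <= 1 -> D e x -> f e x = g e x) ->
  gsmooth D f -> gsmooth D g.
Proof. by move=> fg h k; apply: gCk_ext fg (h k). Qed.

Lemma gCk_add k n (D : ndom n) f g : gCk k D f -> gCk k D g ->
  gCk k D (fun e x => f e x + g e x).
Proof.
elim: k f g => [|k IH] f g [df mf ddf] [dg mg ddg].
  split=> [e x e01 Dx|u Du|//]; first exact: differentiableD (df _ _ _ _) (dg _ _ _ _).
  by apply: modD; [exact: mf | exact: mg].
split=> [e x e01 Dx|u Du|i]; first exact: differentiableD (df _ _ _ _) (dg _ _ _ _).
  by apply: modD; [exact: mf | exact: mg].
apply: gCk_ext (IH _ _ (ddf i) (ddg i)) => e x e01 Dx.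
by apply/esym/deriveD; apply: diff_derivable; [exact: df|exact: dg].
Qed.

Lemma gCk_mul k n (D : ndom n) f g : gCk k D f -> gCk k D g ->
  gCk k D (fun e x => f e x * g e x).
Proof.
elim: k f g => [|k IH] f g.
  move=> [df mf ddf] [dg mg ddg].
  split=> [e x e01 Dx|u Du|//]; first exact: differentiableM (df _ _ _ _) (dg _ _ _ _).
  by apply: modM; [exact: mf | exact: mg].
move=> hf hg; move: (hf) (hg) => [df mf ddf] [dg mg ddg].
split=> [e x e01 Dx|u Du|i]; first exact: differentiableM (df _ _ _ _) (dg _ _ _ _).
  by apply: modM; [exact: mf | exact: mg].
apply: gCk_ext (gCk_add (IH _ _ (gCkS hf) (ddg i)) (IH _ _ (gCkS hg) (ddf i))).
move=> e x e01 Dx.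
by apply/esym/deriveM; apply: diff_derivable; [exact: df|exact: dg].
Qed.

Lemma gCk_cst k n (D : ndom n) (c : R -> R) :
  (forall u, npts D u -> mod c) -> gCk k D (fun e _ => c e).
Proof.
elim: k c => [|k IH] c mc.
  by split=> // e x _ _; exact: differentiable_cst.
split=> // i.
apply: gCk_ext (IH (fun=> 0) _) => [e x _ _|u _]; last exact: mod_cst.
by rewrite derive_cst.
Qed.

Lemma gCk_sum k n (D : ndom n) (I : Type) (r : seq I) (P : pred I)
    (f : I -> R -> 'rV[R]_n -> R) :
  (forall i, P i -> gCk k D (f i)) ->
  gCk k D (fun e x => \sum_(i <- r | P i) f i e x).
Proof.
move=> h; elim: r => [|i r IH].
  apply: gCk_ext (gCk_cst k (D := D) (c := fun=> 0) _) => [e x _ _|u _].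
    by rewrite big_nil.
  exact: mod_cst.
have [Pi|Pi] := boolP (P i).
  by apply: gCk_ext (gCk_add (h i Pi) IH) => e x _ _; rewrite big_cons Pi.
by apply: gCk_ext IH => e x _ _; rewrite big_cons (negbTE Pi).
Qed.

(** Moderateness of the inverse is assumed at the given points only, where it
    need not follow from that of the function. *)
Lemma gCk_inv k n (D : ndom n) f :
  (forall e x, 0 < e <= 1 -> D e x -> f e x != 0) ->
  (forall u, npts D u -> mod (fun e => (f e (u e))^-1)) ->
  gCk k D f -> gCk k D (fun e x => (f e x)^-1).
Proof.
move=> f0 mV; elim: k => [|k IH].
  move=> [df mf _]; split=> // e x e01 Dx.
  by apply: differentiableV; [exact: df|exact: f0].
move=> hf; have [df mf ddf] := hf; split=> // [e x e01 Dx|i].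
  by apply: differentiableV; [exact: df|exact: f0].
have hV := IH (gCkS hf).
have m1 : forall u, npts D u -> mod (fun=> -1) by move=> *; exact: mod_cst.
apply: gCk_ext (gCk_mul (gCk_mul (gCk_cst k m1) (gCk_mul hV hV)) (ddf i)).
move=> e x e01 Dx; rewrite deriveV.
- by rewrite mulN1r -invfM -expr2.
- exact: f0.
- by apply: diff_derivable; exact: df.
Qed.

Lemma gCk_comp k n p (D : ndom n) (D' : ndom p) f
    (g : R -> 'rV[R]_n -> 'rV[R]_p) :
  (forall e x, 0 < e <= 1 -> D e x -> D' e (g e x)) ->
  (forall u, npts D u -> npts D' (fun e => g e (u e))) ->
  gCk k D' f -> (forall j, gCk k D (fun e x => g e x 0 j)) ->
  gCk k D (fun e x => f e (g e x)).
Proof.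
move=> gD gU; elim: k f => [|k IH] f hf hg.
  have [df mf _] := hf; split=> // [e x e01 Dx|u Du].
    apply: (@differentiable_comp _ _ _ _ (g e) (f e)).
      by apply: differentiable_row => j; apply: (gCk_diff (hg j)).
    by apply: df => //; exact: gD.
  by apply: mf; exact: gU.
have [df mf ddf] := hf.
have dg e x : 0 < e <= 1 -> D e x -> differentiable (g e) x.
  by move=> e01 Dx; apply: differentiable_row => j; apply: (gCk_diff (hg j)).
split=> // [e x e01 Dx|u Du|i].
- apply: (@differentiable_comp _ _ _ _ (g e) (f e)); first exact: dg.
  by apply: df => //; exact: gD.
- by apply: mf; exact: gU.
have H j : gCk k D (fun e x => 'D_(delta_mx 0 i) (fun y => g e y 0 j) x *
                              'D_(delta_mx 0 j) (f e) (g e x)).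
  apply: gCk_mul; first by case: (hg j) => _ _; exact.
  apply: (IH (fun e => 'D_(delta_mx 0 j) (f e))) => [|j']; first exact: ddf.
  exact: gCkS.
apply: gCk_ext (gCk_sum (index_enum 'I_p) (P := predT) (fun j _ => H j)).
move=> e x e01 Dx; apply/esym/derive_comp_row; first exact: dg.
by apply: df => //; exact: gD.
Qed.

Lemma gCk_coord k n (D : ndom n) j :
  (forall u, npts D u -> vmoderate rho u) -> gCk k D (fun _ x => x 0 j).
Proof.
move=> mu; case: k => [|k].
  split=> // [e x _ _|u Du]; last exact: mu.
  exact: differentiable_coord.
split=> // [e x _ _|u Du|i]; first exact: differentiable_coord.
  exact: mu.
apply: gCk_ext (gCk_cst k (D := D) (c := fun=> ((delta_mx 0 i : 'rV[R]_n) 0 j)) _).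
  move=> e x _ _; apply/esym; rewrite deriveE; last exact: differentiable_coord.
  have @f : {linear 'rV[R]_n -> R}.
    by exists (fun N : 'rV[R]_n => N 0 j); do 2![eexists]; do ?[constructor];
     rewrite ?mxE// => ? *; rewrite ?mxE//; move=> ?; rewrite !mxE.
  by rewrite (@diff_lin _ _ _ f)//; exact: coord_continuous.
by move=> u _; exact: mod_cst.
Qed.

End Smooth.

(** * Generalized smooth functions through nets *)

Section GeneralizedSmooth.
Context {R : realType}.
Variable rho : gauge R.

Local Notation Rt := (Rt rho).
Local Notation mod := (moderate_net rho).
Local Notation ngl := (negligible_net rho).
Local Notation ndom := (@ndom R).
Local Notation gsmooth := (gsmooth rho).

Definition spd n (w : seq 'I_n) (f : 'rV[R]_n -> R) : 'rV[R]_n -> R :=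
  foldr (fun i g => 'D_(delta_mx 0 i) g) f w.

Definition pts n (X : set 'rV[Rt]_n) (u : R -> 'rV[R]_n) : Prop :=
  vmoderate rho u /\ X (vcls rho u).

Lemma gsmooth_spd n (D : ndom n) f w : gsmooth D f ->
  gsmooth D (fun e => spd w (f e)).
Proof. by elim: w f => [|i w IH] f //= hf; exact: gsmoothD (IH _ hf). Qed.

Lemma gsmooth_words n (D : ndom n) f :
  (forall w e x, 0 < e <= 1 -> D e x -> differentiable (spd w (f e)) x) ->
  (forall w u, npts D u -> mod (fun e => spd w (f e) (u e))) -> gsmooth D f.
Proof.
move=> df mf; suff H : forall m w, gCk rho m D (fun e => spd w (f e)).
  by move=> m; exact: (H m [::]).
elim=> [|m IH] w; split=> //; [exact: df|exact: mf|exact: df|exact: mf|].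
by move=> i; exact: (IH (i :: w)).
Qed.

Lemma gsmooth_sub n (D E : ndom n) f : npts E = npts D ->
  (forall e x, E e x -> D e x) -> gsmooth D f -> gsmooth E f.
Proof.
move=> ED sub sf; apply: gsmooth_words => [w e x e01 Ex|w u Eu].
  by apply: (gsmooth_diff (gsmooth_spd w sf)) => //; exact: sub.
by apply: (gsmooth_mod (gsmooth_spd w sf)); rewrite -ED.
Qed.

Lemma spd_near n w (f g : 'rV[R]_n -> R) (x : 'rV[R]_n) :
  (\near x, f x = g x) -> \near x, spd w f x = spd w g x.
Proof.
move=> fg; elim: w => [//|i w IH] /=.
have : nbhs x [set y | spd w f y = spd w g y]° by apply: nbhs_interior; exact: IH.
by apply: filterS => y yA; exact: near_eq_derive.
Qed.

Lemma pd_coord n k (Om : set 'rV[R]_n) (f : 'rV[R]_n -> 'rV[R]_k) w j x :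
  open Om -> smooth_on Om f -> Om x ->
  pd w f x 0 j = spd w (fun y => f y 0 j) x.
Proof.
move=> oO sf; elim: w x => [//|i w IH] x Ox /=.
rewrite derive_coordf; last exact: sf.
apply: near_eq_derive; apply: filterS IH _.
exact: open_nbhs_nbhs.
Qed.

Lemma pd_smooth n k (D : ndom n) (fe : R -> 'rV[R]_n -> 'rV[R]_k) :
  (forall j, gsmooth D (fun e x => fe e x 0 j)) ->
  forall e, 0 < e <= 1 -> smooth_on (D e) (fe e).
Proof.
move=> h e e01 w.
suff : forall x, D e x -> differentiable (pd w (fe e)) x /\
    forall j, pd w (fe e) x 0 j = spd w (fun y => fe e y 0 j) x.
  by move=> H x /H[].
elim: w => [|i w IH] x Dx /=.
  by split=> //; apply: differentiable_row => j; exact: (gsmooth_diff (h j)).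
have H y j : D e y -> 'D_(delta_mx 0 i) (pd w (fe e)) y 0 j =
    'D_(delta_mx 0 i) (spd w (fun y => fe e y 0 j)) y.
  move=> Dy; have [dy _] := IH y Dy; rewrite derive_coordf//.
  apply: near_eq_derive; apply: filterS (near_dom e01 Dy) => z Dz.
  by have [_ ->] := IH z Dz.
split=> [|j]; last exact: H.
apply: differentiable_row => j.
apply: (@near_eq_differentiable _ _ _
  ('D_(delta_mx 0 i) (spd w (fun y => fe e y 0 j)))).
  by apply: filterS (near_dom e01 Dx) => y Dy; rewrite H.
exact: (gsmooth_diff (gsmooth_spd (i :: w) (h j))).
Qed.

Lemma pd_spd n k (D : ndom n) (fe : R -> 'rV[R]_n -> 'rV[R]_k) w j e x :
  (forall j, gsmooth D (fun e x => fe e x 0 j)) -> 0 < e <= 1 -> D e x ->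
  pd w (fe e) x 0 j = spd w (fun y => fe e y 0 j) x.
Proof.
move=> sf e01 Dx.
apply: (@pd_coord n k (D e) (fe e) w j x) => //; first exact: nset_open.
exact: pd_smooth.
Qed.

(** The bridge from vector-valued nets to the calculus of scalar nets. *)
Lemma gsf_netP n k (X : set 'rV[Rt]_n) (f : 'rV[Rt]_n -> 'rV[Rt]_k) Om fe :
  gsf_net X f Om fe <->
  exists D : ndom n, [/\ nset D = Om, npts D = pts X,
    forall j, gsmooth D (fun e x => fe e x 0 j)
    & forall u, pts X u -> f (vcls rho u) = vcls rho (fun e => fe e (u e))].
Proof.
split=> [[oO XO fP]|[D [<- DX sf fP]]]; last first.
  split.
  - by move=> e e01; split; [exact: nset_open | exact: pd_smooth].
  - move=> x Xx u [mu xu]; apply: npts_in; rewrite DX; split=> //.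
    by rewrite -xu.
  - move=> x u Xx [mu xu]; rewrite xu in Xx *.
    have Pu : pts X u by [].
    split=> [w j|]; last exact: fP.
    have := gsmooth_mod (gsmooth_spd w (sf j)); move=> /(_ u).
    rewrite DX => /(_ Pu) h; apply: mod_ev h.
    have hD : \forall e \near 0^'+, D e (u e) by apply: npts_in; rewrite DX.
    apply: filterS2 near_unit hD => e e01 Du.
    exact/esym/(pd_spd w j sf e01 Du).
have oO' e : 0 < e <= 1 -> open (Om e) by move=> /oO[].
have Xin u : pts X u -> \forall e \near 0^'+, Om e (u e).
  by move=> [mu Xu]; apply: (XO _ Xu).
exists (NDom oO' Xin); split=> // [j|u [mu Xu]]; last first.
  by have [_ ->] := fP _ u Xu (conj mu erefl).
have E w e x : 0 < e <= 1 -> Om e x -> 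
    pd w (fe e) x 0 j = spd w (fun y => fe e y 0 j) x.
  by move=> e01 Ox; apply: (@pd_coord _ _ (Om e)) => //; have [] := oO e e01.
have dE w e x : 0 < e <= 1 -> Om e x ->
    differentiable (spd w (fun y => fe e y 0 j)) x.
  move=> e01 Ox; apply: (@near_eq_differentiable _ _ _
    (fun y => pd w (fe e) y 0 j)).
    have : \near x, Om e x by apply: open_nbhs_nbhs; split=> //; exact: oO'.
    by apply: filterS => y; exact: E.
  by apply: differentiable_coordf; have [_] := oO e e01; exact.
apply: gsmooth_words => [|w u Xu]; first exact: dE.
have [mu Xx] := Xu; have [/(_ w) m1 _] := fP _ u Xx (conj mu erefl).
by apply: mod_ev (m1 j); apply: filterS2 near_unit (Xin u Xu) => e; exact: E.
Qed.

(** A function that is moderate at all representatives of a generalized point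
    is bounded by a power of the gauge on a ball around it whose radius is a
    power of the gauge, as otherwise some representative would witness
    the contrary. *)
Lemma local_bound n (D : ndom n) X (f : R -> 'rV[R]_n -> R) u :
  npts D = pts X -> (forall v, pts X v -> mod (fun e => f e (v e))) ->
  pts X u ->
  exists K, \forall e \near 0^'+, forall y, `|y - u e| <= rho e ^+ K ->
    D e y /\ `|f e y| <= rho e ^- K.
Proof.
move=> DX mf Xu; apply: contrapT => h.
pose B e K y := `|y - u e| <= rho e ^+ K /\
  ~ (D e y /\ `|f e y| <= rho e ^- K).
have HB K : ~ \forall e \near 0^'+, forall y, ~ B e K y.
  move=> hK; apply: h; exists K; apply: filterS hK => e hK y yu.
  by apply: contrapT => nD; apply: (hK y).
have [y [y1 y2]] := diagonal_net u HB.
have yu : ngl (fun e => `|u e - y e|).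
  move=> k; apply: filterS2 (y1 k) (near_gauge_mono rho) => e.
  move=> [->|[K kK [yK _]]] [_ _ rk rl].
    by rewrite subrr normr0 normr0 ltW.
  by rewrite normr_id distrC; apply: le_trans yK _; exact: rl.
have Xy : pts X y.
  case: Xu => mu Xu; split; last by rewrite -(vcls_eq yu).
  by apply: vmod_near mu _; exact: ngl_mod.
have [N fN] := mf y Xy.
have Dy : \forall e \near 0^'+, D e (y e) by apply: npts_in; rewrite DX.
apply: (y2 N); apply: filterS3 fN Dy (near_gauge_mono rho).
move=> e fe Dey [_ _ rk rl] [K NK [_]]; apply; split=> //.
by apply: le_trans fe _; rewrite lef_pV2 ?posrE// rl.
Qed.

(** The mean value theorem and the local bounds on the gradient. The constant and
    the radius are governed by the same exponent. *)
Lemma local_lipschitz n (D : ndom n) X (f : R -> 'rV[R]_n -> R) u :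
  npts D = pts X -> gsmooth D f -> pts X u ->
  exists K, \forall e \near 0^'+, forall y z, `|y - u e| <= rho e ^+ K ->
    `|z - u e| <= rho e ^+ K -> D e y /\
    `|f e y - f e z| <= rho e ^- K * `|y - z|.
Proof.
move=> DX sf Xu.
pose g e y := \sum_i `|'D_(delta_mx 0 i) (f e) y|.
have mg v : pts X v -> mod (fun e => g e (v e)).
  move=> Xv; apply: mod_sum => i _; have sfi := gsmoothD i sf.
  have : npts D v by rewrite DX.
  move=> /(gsmooth_mod sfi); apply: mod_le; apply: nearW => e.
  by rewrite normr_id.
have [K hK] := local_bound DX mg Xu; exists K.
apply: filterS3 near_unit hK (near_gauge_mono rho) => e e01 {}hK [r0 r1 rk rl].
move=> y z yu zu; split; first by have [] := hK y yu.
have seg s : 0 <= s <= 1 -> `|z + s *: (y - z) - u e| <= rho e ^+ K.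
  move=> /andP[s0 s1].
  have -> : z + s *: (y - z) - u e = s *: (y - u e) + (1 - s) *: (z - u e).
    apply/rowP => i; rewrite !mxE; ring.
  rewrite (le_trans (ler_normD _ _))// !normrZ ger0_norm//.
  rewrite (@ger0_norm _ (1 - s)) ?subr_ge0//.
  have := ler_wpM2l s0 yu; have s1' : 0 <= 1 - s by rewrite subr_ge0.
  have := ler_wpM2l s1' zu; lra.
have [|s s01] := @MVT_line _ _ (f e) z (y - z).
  by move=> s s01; apply: (gsmooth_diff sf) => //; have [] := hK _ (seg s s01).
rewrite [z + (y - z)]addrC subrK => ->; have [Ds gs] := hK _ (seg s s01).
rewrite derive_partial; last exact: (gsmooth_diff sf).
apply: le_trans (ler_norm_sum _ _ _) _.
rewrite mulrC; apply: (@le_trans _ _ (`|y - z| * g e (z + s *: (y - z)))).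
  rewrite /g mulr_sumr; apply: ler_sum => i _; rewrite normrM ler_wpM2r//.
  exact: coord_norm.
rewrite ler_wpM2l//; apply: le_trans gs; exact: ler_norm.
Qed.

Lemma npts_ngl n (X : set 'rV[Rt]_n) (u v : R -> 'rV[R]_n) : pts X u ->
  ngl (fun e => `|u e - v e|) -> pts X v.
Proof.
case=> mu Xu uv; split; last by rewrite -(vcls_eq uv).
by apply: vmod_near mu _; exact: ngl_mod.
Qed.

Lemma gsmooth_welldef n (D : ndom n) X (f : R -> 'rV[R]_n -> R) u v :
  npts D = pts X -> gsmooth D f -> pts X u -> ngl (fun e => `|u e - v e|) ->
  ngl (fun e => f e (u e) - f e (v e)).
Proof.
move=> DX sf Xu uv; have [K hK] := local_lipschitz DX sf Xu.
apply: (@ngl_le _ _ _ (fun e => rho e ^- K * `|u e - v e|)); last first.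
  by apply: nglMl => //; exact: mod_gaugeV.
apply: filterS3 hK (uv K) (near_gauge_mono rho) => e hK uve [_ _ rk _].
rewrite normr_id in uve.
have [||_ h] := hK (u e) (v e).
- by rewrite subrr normr0 ltW.
- by rewrite distrC.
by apply: le_trans h (ler_norm _).
Qed.

Lemma vcls_welldef n k (D : ndom n) X (f : R -> 'rV[R]_n -> 'rV[R]_k) u v :
  npts D = pts X -> (forall j, gsmooth D (fun e x => f e x 0 j)) -> pts X u ->
  ngl (fun e => `|u e - v e|) ->
  vcls rho (fun e => f e (u e)) = vcls rho (fun e => f e (v e)).
Proof.
move=> DX sf Xu uv; apply/rowP => j; rewrite !mxE; apply: cls_eq.
exact: (gsmooth_welldef DX (sf j)).
Qed.

(** By [vcls_welldef] the values do not depend on the chosen representatives. *)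
Lemma gsf_of_net n k (D : ndom n) X (fe : R -> 'rV[R]_n -> 'rV[R]_k) :
  npts D = pts X -> (forall j, gsmooth D (fun e x => fe e x 0 j)) ->
  exists f : 'rV[Rt]_n -> 'rV[Rt]_k, gsf_net X f D fe.
Proof.
move=> DX sf.
pose r (x : 'rV[Rt]_n) := sval (cid2 (vcls_surj x)).
exists (fun x => vcls rho (fun e => fe e (r x e))).
apply/gsf_netP; exists D; split=> // u Xu; have [mu Xx] := Xu.
rewrite /r; case: cid2 => v mv /= uv; apply/esym.
by apply: (vcls_welldef DX sf Xu); exact: vcls_inj.
Qed.

Lemma spdB n (D : ndom n) f g w e x : gsmooth D f -> gsmooth D g ->
  0 < e <= 1 -> D e x ->
  spd w (fun y => f e y - g e y) x = spd w (f e) x - spd w (g e) x.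
Proof.
move=> sf sg e01; elim: w x => [//|i w IH] x Dx /=.
rewrite (@near_eq_derive _ _ _ _ (fun y => spd w (f e) y - spd w (g e) y)).
  rewrite deriveB//; apply: diff_derivable.
    exact: (gsmooth_diff (gsmooth_spd w sf)).
  exact: (gsmooth_diff (gsmooth_spd w sg)).
by apply: filterS (near_dom e01 Dx) => y; exact: IH.
Qed.

Lemma gsmoothB n (D : ndom n) f g : gsmooth D f -> gsmooth D g ->
  gsmooth D (fun e y => f e y - g e y).
Proof.
move=> sf sg k; have m1 : forall u, npts D u -> mod (fun=> -1).
  by move=> *; exact: mod_cst.
apply: gCk_ext (gCk_add (sf k) (gCk_mul (gCk_cst k m1) (sg k))).
by move=> e x _ _; rewrite mulN1r.
Qed.

(** A net of functions that is negligible on a sharp neighbourhood of a point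
    has negligible derivatives there: a difference quotient with a step
    [rho ^+ M] is negligible, and by the moderateness of the second derivative
    it is close to the derivative when [M] is large. *)
Lemma ngl_derivatives n (D : ndom n) X (g : R -> 'rV[R]_n -> R) u N w :
  npts D = pts X -> gsmooth D g -> (forall v, pts X v -> ngl (fun e => g e (v e))) ->
  (forall v, (\forall e \near 0^'+, `|v e - u e| <= rho e ^+ N) -> pts X v) ->
  forall v, (\forall e \near 0^'+, `|v e - u e| <= rho e ^+ (N + size w)) ->
  ngl (fun e => spd w (g e) (v e)).
Proof.
move=> DX sg ng uX; elim: w => [|i w IH] v.
  by rewrite addn0 => /uX /ng.
rewrite /= addnS => vu.
pose G e := spd w (g e); have sG : gsmooth D G by exact: gsmooth_spd.
have sGi := gsmoothD i sG.
have vN : \forall e \near 0^'+, `|v e - u e| <= rho e ^+ (N + size w).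
  apply: filterS2 vu (near_gauge_mono rho) => e h [_ _ _ rl].
  exact: le_trans h (rl _ _ _).
have Xv : pts X v.
  apply: uX; apply: filterS2 vN (near_gauge_mono rho) => e h [_ _ _ rl].
  by apply: le_trans h (rl _ _ _); exact: leq_addr.
have [K hK] := local_lipschitz DX sGi Xv => k.
have [M ME] : exists M, M = (N + size w + K + k).+2 by eexists.
have ME' : M = (K + (k + (N + size w).+2))%N by rewrite ME; lia.
pose z e : 'rV[R]_n := v e + rho e ^+ M *: delta_mx 0 i.
have nd : `|delta_mx 0 i : 'rV[R]_n| <= 1.
  by apply: norm_coord => // j; rewrite mxE eqxx /=;
    case: (j == i); rewrite ?normr1 ?normr0.
have zu : \forall e \near 0^'+, `|z e - u e| <= rho e ^+ (N + size w).
  apply: filterS3 vu (near_gaugeMX rho 2 (N + size w)) (near_gauge_mono rho).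
  move=> e vu' r2 [_ _ rk rl]; apply: le_trans r2.
  rewrite /z addrAC mulr_natl mulr2n (le_trans (ler_normD _ _))// lerD//.
  rewrite normrZ gtr0_norm// -[leRHS]mulr1 ler_pM//; first exact: ltW.
  by apply: rl; lia.
have nz := IH z zu (M + k).+2; have nv := IH v vN (M + k).+2.
apply: filterS3 (filterI hK near_unit) (filterI nz nv) (filterI
  (near_gauge_mono rho) (near_gaugeM rho 4)).
move=> e [{}hK e01] [{}nz {}nv] [[r0 r1 rk rl] r4].
have small (s : R) : 0 <= s <= 1 ->
    `|(v e + s *: (rho e ^+ M *: delta_mx 0 i)) - v e| <= rho e ^+ M.
  move=> /andP[s0 s1]; have rM := rk M.
  rewrite addrC addKr normrZ normrZ (ger0_norm s0) (gtr0_norm rM).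
  rewrite mulrA -[leRHS]mulr1 ler_pM//; first by rewrite mulr_ge0// ltW.
  by rewrite ler_piMl// ltW.
have MK : rho e ^+ M <= rho e ^+ K by apply: rl; lia.
have vv : `|v e - v e| <= rho e ^+ K by rewrite subrr normr0 ltW.
have [|s s01] := @MVT_line _ _ (G e) (v e) (rho e ^+ M *: delta_mx 0 i).
  move=> s s01; apply: (gsmooth_diff sG) => //.
  by have [] := hK _ _ (le_trans (small s s01) MK) vv.
have [Ds Ls] := hK _ _ (le_trans (small s s01) MK) vv.
rewrite deriveE; last exact: (gsmooth_diff sG).
rewrite linearZ/= -deriveE; last exact: (gsmooth_diff sG).
set xi := v e + _ in Ds Ls *; set d := 'D_ _ (G e) xi in Ls *.
rewrite -[rho e ^+ M *: d]/(rho e ^+ M * d) => Ed.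
have h1 : `|d - 'D_(delta_mx 0 i) (G e) (v e)| <= 2^-1 * rho e ^+ k.
  apply: le_trans Ls _; have := small s s01; rewrite -/xi => h.
  apply: (@le_trans _ _ (rho e ^- K * rho e ^+ M)).
    by rewrite ler_wpM2l// invr_ge0 ltW.
  rewrite ME' exprD mulKf ?gt_eqF// exprD mulrC ler_wpM2r ?(ltW (rk _))//.
  by rewrite exprS; have := rl 0%N (N + size w).+1 isT; rewrite expr0;
    have := rk (N + size w).+1; nra.
have h2 : `|d| <= 2^-1 * rho e ^+ k.
  rewrite -(ler_pM2l (rk M)) -{1}(gtr0_norm (rk M)) -normrM -Ed.
  rewrite (le_trans (ler_normB _ _))//.
  apply: (@le_trans _ _ (2 * rho e ^+ (M + k).+2)).
    by rewrite mulr_natl mulr2n lerD.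
  rewrite [leRHS]mulrCA -exprD 2!exprS.
  have := rk (M + k)%N; set q := _ ^+ (M + k).
  have rr : 4 * (rho e * rho e) <= 1 by nra.
  by move=> q0; have := ler_wpM2r (ltW q0) rr; lra.
rewrite -/(G e).
have -> : 'D_(delta_mx 0 i) (G e) (v e) =
    d - (d - 'D_(delta_mx 0 i) (G e) (v e)).
  by rewrite opprB addrC subrK.
rewrite (le_trans (ler_normB _ _))//; lra.
Qed.

End GeneralizedSmooth.

(** * Partial derivatives *)

Section Partial.
Context {R : realType}.
Variable rho : gauge R.

Local Notation Rt := (Rt rho).
Local Notation mod := (moderate_net rho).
Local Notation ndom := (@ndom R).
Local Notation gsmooth := (gsmooth rho).

Lemma sharp_interiorP n (X : set 'rV[Rt]_n) (u : R -> 'rV[R]_n) :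
  vmoderate rho u -> sharp_interior X (vcls rho u) ->
  exists N, forall v, (\forall e \near 0^'+, `|v e - u e| <= rho e ^+ N) ->
    pts X v.
Proof.
move=> mu [r r0 rX]; have [r' mr Er] := cls_surj r.
move: r0 rX; rewrite Er => /(glt0_cls mr)[N rN] rX.
exists N.+2 => v vu.
have mv : vmoderate rho v.
  apply: vmod_near mu _; apply: mod_le (mod_gauge rho N.+2).
  apply: filterS2 vu (near_gauge_mono rho) => e h [_ _ rk _].
  by rewrite normr_id distrC gtr0_norm.
by split=> //; apply: rX; exact: (gball_near (N := N)).
Qed.

(** Two nets that define the same function are compared where both are defined. *)
Lemma ndom_inter n (D D' : ndom n) (X : set 'rV[Rt]_n) :
  npts D = pts X -> npts D' = pts X ->
  exists E : ndom n, npts E = pts X /\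
    forall f, (gsmooth D f -> gsmooth E f) /\ (gsmooth D' f -> gsmooth E f).
Proof.
move=> DX DX'.
have oE e : 0 < e <= 1 -> open (D e `&` D' e).
  by move=> e01; apply: openI; exact: nset_open.
have iE u : pts X u -> \forall e \near 0^'+, (D e `&` D' e) (u e).
  move=> Xu; apply: (filterI (F := 0^'+)); first by apply: npts_in; rewrite DX.
  by apply: npts_in; rewrite DX'.
pose E := NDom oE iE; exists E; split=> // f.
by split; apply: gsmooth_sub => // e x [].
Qed.

(** The difference of two nets of the same function is negligible, and so are its
    derivatives by [ngl_derivatives]. *)
Lemma gpartial_intE n k (X : set 'rV[Rt]_n) (f : 'rV[Rt]_n -> 'rV[Rt]_k) Om fe
    w u : gsf_net X f Om fe -> pts X u -> sharp_interior X (vcls rho u) ->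
  gpartial_int X f w (vcls rho u) = vcls rho (fun e => pd w (fe e) (u e)).
Proof.
move=> fN [mu Xu] Iu; rewrite /gpartial_int.
set A := [set y | _].
have : A (vcls rho (fun e => pd w (fe e) (u e))) by exists Om, fe, u.
move=> A0; case: xgetP => [y _ [Om' [fe' [u' [fN' [mu' uu'] ->]]]]|/(_ _ A0)//].
move: fN fN'; rewrite !gsf_netP => -[D [DO DX sf fP]] [D' [DO' DX' sf' fP']].
have Pu : pts X u by [].
have Pu' : pts X u' by split=> //; rewrite -uu'.
have uun := vcls_inj mu mu' uu'.
apply/rowP => j; rewrite !mxE.
have pdE (B : ndom n) (g : R -> 'rV[R]_n -> 'rV[R]_k) v : npts B = pts X ->
    (forall j, gsmooth B (fun e x => g e x 0 j)) -> pts X v ->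
    cls rho (fun e => pd w (g e) (v e) 0 j) =
    cls rho (fun e => spd w (fun y => g e y 0 j) (v e)).
  move=> BX sg Pv; apply: cls_ev.
  have Bv : \forall e \near 0^'+, B e (v e) by apply: npts_in; rewrite BX.
  apply: filterS2 near_unit Bv => e e01 {}Bv.
  exact: (pd_spd w j sg e01 Bv).
rewrite (pdE D' fe' u')// (pdE D fe u)//.
transitivity (cls rho (fun e => spd w (fun y => fe' e y 0 j) (u e))).
  apply/esym/cls_eq.
  exact: (gsmooth_welldef DX' (gsmooth_spd w (sf' j)) Pu uun).
have [E [EX sE]] := ndom_inter DX DX'.
have sEf := (sE _).1 (sf j); have sEf' := (sE _).2 (sf' j).
have [N hN] := sharp_interiorP mu Iu.
apply: cls_eq; have := @ngl_derivatives _ rho _ E X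
  (fun e y => fe' e y 0 j - fe e y 0 j) u N w EX (gsmoothB sEf' sEf).
have uE : \forall e \near 0^'+, E e (u e) by apply: npts_in; rewrite EX.
move=> H; apply: ngl_ev (H _ hN u _).
- by apply: filterS2 near_unit uE => e e01 {}uE; exact: (spdB _ sEf' sEf).
- move=> v Pv; apply: cls_inj.
  + by apply: (gsmooth_mod (sf' j)); rewrite DX'.
  + by apply: (gsmooth_mod (sf j)); rewrite DX.
  + have := fP' v Pv; rewrite fP// => /rowP/(_ j).
    by rewrite !mxE.
- apply: filterS (near_gauge_mono rho) => e [_ _ rk _].
  by rewrite subrr normr0 ltW.
Qed.

(** Serves to choose one exponent for the finitely many coordinates. *)
Lemma exists_uniform (I : finType) (P : I -> nat -> Prop) :
  (forall i K K', (K <= K')%N -> P i K -> P i K') ->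
  (forall i, exists K, P i K) -> exists K, forall i, P i K.
Proof.
move=> mono /choice[k kP]; exists (\max_i k i)%N => i.
by apply: mono (kP i); exact: leq_bigmax.
Qed.

(** Sharp limits from the interior are unique at points of such a set. *)
Definition interior_dense n (X : set 'rV[Rt]_n) : Prop :=
  forall u N, pts X u -> exists v, [/\ vmoderate rho v,
    sharp_interior X (vcls rho v)
    & \forall e \near 0^'+, `|v e - u e| <= rho e ^+ N].

(** At points that are not sharply interior the derivative is a sharp limit: the
    net of derivatives is locally Lipschitz, hence gives a limit, and the limit
    is unique by density of the interior. *)
Lemma gpartialE n k (X : set 'rV[Rt]_n) (f : 'rV[Rt]_n -> 'rV[Rt]_k) Om fe
    w u : interior_dense X -> gsf_net X f Om fe -> pts X u ->
  gpartial X f w (vcls rho u) = vcls rho (fun e => pd w (fe e) (u e)).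
Proof.
move=> dX fN Pu; have [mu Xu] := Pu.
case: w => [|i0 w0]; first by have [_ _] := fN; case/(_ _ u Xu (conj mu erefl)).
rewrite /gpartial; move: (i0 :: w0) => w.
case: asboolP => [Iu|nIu]; first exact: gpartial_intE fN Pu Iu.
have /gsf_netP[D [DO DX sf fP]] := fN.
have mpd v : pts X v -> vmoderate rho (fun e => pd w (fe e) (v e)).
  by move=> [mv Xv]; have [_ _] := fN; case/(_ _ v Xv (conj mv erefl)).
set l0 := vcls rho (fun e => pd w (fe e) (u e)).
set A := [set l | _].
have Al0 : A l0.
  move=> r; have [r' mr ->] := cls_surj r; move=> /(glt0_cls mr)[N rN].
  have [K hK] : exists K, forall j, \forall e \near 0^'+, forall y,
      `|y - u e| <= rho e ^+ K -> D e y /\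
      `|spd w (fun x => fe e x 0 j) y - spd w (fun x => fe e x 0 j) (u e)|
      <= rho e ^- K * `|y - u e|.
    apply: exists_uniform => [j K K' KK'|j].
      move=> h; apply: filterS2 h (near_gauge_mono rho) => e h [_ _ rk rl] y yu.
      have [Dy hy] := h y (le_trans yu (rl _ _ KK')); split=> //.
      apply: le_trans hy _; rewrite ler_wpM2r// lef_pV2 ?posrE//.
      exact: rl.
    have [K hK] := local_lipschitz DX (gsmooth_spd w (sf j)) Pu.
    exists K; apply: filterS2 hK (near_gauge_mono rho) => e hK [_ _ rk _] y yu.
    by apply: hK => //; rewrite subrr normr0 ltW.
  have {}hK : \forall e \near 0^'+, forall j y,
      `|y - u e| <= rho e ^+ K -> D e y /\
      `|spd w (fun x => fe e x 0 j) y - spd w (fun x => fe e x 0 j) (u e)|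
      <= rho e ^- K * `|y - u e|.
    exact: filter_forall hK.
  exists (cls rho (fun e => rho e ^+ (K + N).+3)); first exact: glt0_gauge.
  move=> y Iy; have [v mv Ey] := vcls_surj y; rewrite Ey in Iy *.
  move=> /(gball_cls mu mv) vu.
  have Pv : pts X v.
    have [M hM] := sharp_interiorP mv Iy; apply: hM.
    apply: filterS (near_gauge_mono rho) => e [_ _ rk _].
    by rewrite subrr normr0 ltW.
  rewrite (gpartial_intE w fN Pv Iy).
  apply: (gball_near (mpd _ Pu) (mpd _ Pv) mr rN).
  have Du : \forall e \near 0^'+, D e (u e) by apply: npts_in; rewrite DX.
  apply: filterS3 (filterI hK Du) (filterI vu near_unit) (filterI
    (near_gauge_mono rho) (near_gaugeMX rho 2 (K + N).+2)).
  move=> e [{}hK {}Du] [{}vu e01] [[_ _ rk rl] r2].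
  have vu' : `|v e - u e| <= rho e ^+ (K + N.+2) by rewrite 2!addnS (le_trans vu).
  apply: norm_coord => [|j]; first exact: ltW.
  have [Dv hv] := hK j (v e) (le_trans vu' (rl _ _ (leq_addr _ _))).
  have pE x : D e x -> pd w (fe e) x 0 j = spd w (fun x => fe e x 0 j) x.
    by move=> Dx; exact: (pd_spd w j sf e01 Dx).
  have -> : (pd w (fe e) (v e) - pd w (fe e) (u e)) 0 j =
      pd w (fe e) (v e) 0 j - pd w (fe e) (u e) 0 j by rewrite !mxE.
  rewrite (pE _ Dv) (pE _ Du); apply: le_trans hv _.
  rewrite exprD in vu'.
  by rewrite ler_pdivrMl.
suff uniq l l' : A l -> A l' -> l = l'.
  case: xgetP => [y _ Ay|/(_ l0)//]; exact: uniq.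
have [v mv ->] := vcls_surj l; have [v' mv' ->] := vcls_surj l' => Al Al'.
apply: vcls_eq => p; rewrite /A/= in Al Al'.
have [s s0 hs] := Al _ (glt0_gauge rho p.+3).
have [s' s0' hs'] := Al' _ (glt0_gauge rho p.+3).
move: s0 hs; have [t mt ->] := cls_surj s => /(glt0_cls mt)[a ta] hs.
move: s0' hs'; have [t' mt' ->] := cls_surj s' => /(glt0_cls mt')[b tb] hs'.
have [y [my Iy yu]] := dX u (a + b).+2 Pu.
have Py : pts X y.
  have [M hM] := sharp_interiorP my Iy; apply: hM.
  apply: filterS (near_gauge_mono rho) => e [_ _ rk _].
  by rewrite subrr normr0 ltW.
have {}hs := hs _ Iy; have {}hs' := hs' _ Iy.
rewrite (gpartial_intE w fN Py Iy) in hs hs'.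
have B1 : gball (vcls rho u) (cls rho t) (vcls rho y).
  apply: (gball_near mu my mt ta).
  apply: filterS2 yu (near_gauge_mono rho) => e h [_ _ _ rl].
  by apply: le_trans h _; apply: rl; lia.
have B2 : gball (vcls rho u) (cls rho t') (vcls rho y).
  apply: (gball_near mu my mt' tb).
  apply: filterS2 yu (near_gauge_mono rho) => e h [_ _ _ rl].
  by apply: le_trans h _; apply: rl; lia.
have C1 := gball_cls mv (mpd _ Py) (hs B1).
have C2 := gball_cls mv' (mpd _ Py) (hs' B2).
apply: filterS3 (filterI C1 C2) (near_gaugeMX rho 4 p.+2) (near_gauge_mono rho).
move=> e [{}C1 {}C2] r4 [_ _ rk rl]; rewrite normr_id.
have -> : v e - v' e = (pd w (fe e) (y e) - v' e) - (pd w (fe e) (y e) - v e).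
  by apply/rowP => i; rewrite !mxE; ring.
apply: le_trans (ler_normB _ _) _.
have := rl p p.+2 (ltac:(lia)); lra.
Qed.

Variables (a b : R -> R) (M : nat).
Hypotheses (ma : mod a) (mb : mod b).
Hypothesis (ab : \forall e \near 0^'+, a e + rho e ^+ M <= b e).

(** The domains of a curve, of a Lagrangian, and of a one-parameter family of
    curves all have one coordinate in an interval and the others free. *)
Definition slab n (i0 : 'I_n) : set 'rV[Rt]_n :=
  [set x | gitv (cls rho a) (cls rho b) (x 0 i0)].

Lemma slab_pts n (i0 : 'I_n) u : vmoderate rho u ->
  (\forall e \near 0^'+, a e <= u e 0 i0 <= b e) -> pts (slab i0) u.
Proof.
by move=> mu h; split=> //; rewrite /slab/= mxE; apply: gitv_near => //; exact: mu.
Qed.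

(** A point is moved into the interior by keeping its distinguished coordinate at
    distance [rho ^+ P] from the endpoints, for [P] large. *)
Lemma slab_dense n (i0 : 'I_n) : interior_dense (slab i0).
Proof.
move=> u N [mu]; rewrite /slab/= mxE => -[au ub].
pose P := (N + M)%N.+3.
pose c e := clamp (a e + rho e ^+ P) (b e - rho e ^+ P) (u e 0 i0).
pose v e : 'rV[R]_n := \row_j (if j == i0 then c e else u e 0 j).
have le1 := gle_cls P ma (mu i0) au.
have le2 := gle_cls P (mu i0) mb ub.
have ab' : \forall e \near 0^'+, a e + rho e ^+ P <= b e - rho e ^+ P.
  apply: filterS3 ab (near_gaugeMX rho 2 P.-1) (near_gauge_mono rho).
  move=> e h r2 [_ _ rk rl].
  have : rho e ^+ P.-1 <= rho e ^+ M by apply: rl; rewrite /P; lia.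
  by move: r2; rewrite (_ : P.-1.+1 = P) => [|//]; lra.
have vu : \forall e \near 0^'+, `|v e - u e| <= rho e ^+ N.
  apply: filterS3 (filterI le1 le2) ab' (filterI (near_gauge_mono rho)
     (near_gaugeMX rho 2 P.-1)) => e [h1 h2] {}ab' [[_ _ rk rl] r2].
  have rP := rk P.
  apply: norm_coord => [|j]; first exact: ltW.
  rewrite !mxE; case: eqP => [->|_]; last by rewrite subrr normr0 ltW.
  rewrite distrC; apply: (@le_trans _ _ (2 * rho e ^+ P)).
    apply: clamp_dist => //; [by rewrite mulr_ge0// ltW|lra|lra].
  by apply: le_trans r2 _; apply: rl; rewrite /P; lia.
have mv : vmoderate rho v.
  apply: vmod_near mu _; apply: mod_le (mod_gauge rho N).
  apply: filterS2 vu (near_gauge_mono rho) => e h [_ _ rk _].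
  by rewrite normr_id distrC gtr0_norm.
exists v; split=> //; exists (cls rho (fun e => rho e ^+ P.+1)).
  exact: glt0_gauge.
move=> x; have [y my ->] := vcls_surj x => /(gball_cls mv my) yv.
suff : pts (slab i0) y by case.
apply: slab_pts => //.
apply: filterS3 yv ab' (near_gaugeMX rho 2 P) => e {}yv {}ab' r2.
have := le_trans (coord_norm _ i0) (le_trans yv r2).
rewrite !mxE eqxx; have /andP[c1 c2] := clamp_itv (u e 0 i0) ab'.
by rewrite -/(c e) in c1 c2 *; rewrite ler_norml; lra.
Qed.

End Partial.

(** * Smooth cut-offs *)

Section Bump.
Context {R : realType}.

(** The functions [y ^- k * exp (- 1 / y)] for positive [y]: up to linear
    combinations, this family is closed under differentiation. *)
Definition flat_exp (k : nat) (y : R) : R :=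
  if 0 < y then y^-1 ^+ k * expR (- y^-1) else 0.

(** One term of the exponential series: [z ^+ k.+2 <= k.+2`! * exp z] at
    [z = 1 / y]. *)
Lemma flat_exp_bound k y : `|flat_exp k y| <= k.+2`!%:R * y ^+ 2.
Proof.
rewrite /flat_exp; case: ltP => y0; last first.
  by rewrite normr0 mulr_ge0// sqr_ge0.
have z0 : 0 < y^-1 by rewrite invr_gt0.
rewrite ger0_norm; last by rewrite mulr_ge0 ?expR_ge0// exprn_ge0 ?ltW.
rewrite expRN ler_pdivrMr ?expR_gt0//.
have := expR_ge1Dxn k.+1 (ltW z0); set E := expR _ => hE.
have f0 : (0 : R) < k.+2`!%:R by rewrite ltr0n fact_gt0.
have h : y^-1 ^+ k.+2 <= k.+2`!%:R * E.
  rewrite -ler_pdivrMl// mulrC; apply: le_trans hE; lra.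
have -> : y^-1 ^+ k = y ^+ 2 * y^-1 ^+ k.+2.
  have e2 : y ^+ 2 * y^-1 ^+ 2 = 1 by rewrite -exprMn divff ?gt_eqF// expr1n.
  by rewrite -(addn2 k) exprD [RHS]mulrCA e2 mulr1.
rewrite [leRHS](_ : _ = y ^+ 2 * (k.+2`!%:R * E)); last by ring.
by apply: ler_wpM2l => //; exact: sqr_ge0.
Qed.

Lemma is_derive_flat0 (f : R -> R) (C : R) :
  (forall y, `|f y| <= C * y ^+ 2) -> is_derive (0 : R) (1 : R) f 0.
Proof.
move=> h; have f0 : f 0 = 0.
  by apply/normr0_eq0/le_anti; rewrite normr_ge0 (le_trans (h 0))// expr0n mulr0.
have C0 : 0 <= C by have := le_trans (normr_ge0 _) (h 1); rewrite expr1n mulr1.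
suff H : (fun t : R => t^-1 *: ((f \o shift 0) (t *: (1 : R)) - f 0)) @ 0^' --> (0 : R).
  by apply: DeriveDef; [apply/cvg_ex; exists 0 | exact: cvg_lim H].
apply/cvgrPdist_le => d d0.
have d1 : 0 < d / (C + 1) by rewrite divr_gt0//; lra.
near=> t.
have t0 : t != 0 by near: t; exact: nbhs_dnbhs_neq.
have td : `|t| <= d / (C + 1).
  by apply: ltW; near: t; exact: dnbhs0_lt.
rewrite f0 subr0 sub0r normrN /= addr0 [t *: 1]mulr1 normrZ normfV.
rewrite ler_pdivrMl ?normr_gt0//; apply: le_trans (h t) _.
rewrite -[t ^+ 2]ger0_norm ?sqr_ge0// normrX expr2 mulrCA ler_wpM2l//.
move: td; rewrite ler_pdivlMr; last by lra.
by have := normr_ge0 t; nra.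
Unshelve. all: by end_near. Qed.

Lemma is_derive_flat_exp k (y : R) :
  is_derive y 1 (flat_exp k) (- k%:R * flat_exp k.+1 y + flat_exp k.+2 y).
Proof.
have [y0|y0|->] := ltgtP y 0.
- have -> : - k%:R * flat_exp k.+1 y + flat_exp k.+2 y = 0.
    by rewrite /flat_exp ltNge (ltW y0) /= mulr0 addr0.
  apply: (@near_eq_is_derive _ _ _ (cst (0 : R))).
  have : \near y, y < 0 by exact: lt_nbhsl.
  by apply: filterS => z z0; rewrite /flat_exp ltNge (ltW z0).
- apply: (@near_eq_is_derive _ _ _ (fun y : R => y^-1 ^+ k * expR (- y^-1))).
    have : \near y, 0 < y by exact: lt_nbhsr.
    by apply: filterS => z z0; rewrite /flat_exp z0.
  have yn0 : y != 0 by rewrite gt_eqF.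
  have dV : is_derive y (1 : R) (fun y : R => y^-1) (- y ^- 2).
    apply: DeriveDef.
      by apply: (derivableV (f := id)) => //; exact: derivable_id.
    by rewrite (deriveV (f := id))// ?derive_id [_ *: 1]mulr1.
  have dE : is_derive y (1 : R) (fun y : R => expR (- y^-1))
      (expR (- y^-1) * y ^- 2).
    have := @is_derive1_comp _ expR (fun y : R => - y^-1) y _ _
      (is_derive_expR _) (is_deriveN dV).
    by rewrite opprK.
  have dX := is_deriveX k dV.
  have := is_deriveM dX dE; rewrite exprfctE => h.
  apply: (is_derive_eq h); rewrite /flat_exp y0.
  rewrite -![_ *: _]/(_ * _) /=.
  have -> : y ^- 2 = y^-1 ^+ 2 by rewrite exprVn.
  case: (k) => [|k'].
    by rewrite !mul0r mulr0 addr0 oppr0 mul0r add0r !expr0 mul1r; ring.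
  rewrite [k'.+1.-1]/=; move: (expR (- y^-1)) => E; move: (y^-1) => z.
  rewrite [z ^+ k'.+3]exprS [z ^+ k'.+2]exprS [z ^+ k'.+1]exprS mulNr.
  by move: (k'.+1%:R : R) (z ^+ k') => c Z; ring.
- rewrite /flat_exp ltxx mulr0 addr0.
  exact: (is_derive_flat0 (flat_exp_bound k)).
Qed.

(** With an empty class of points the moderateness clauses of [gCk] are vacuous,
    and what remains is smoothness. *)
Definition real_smooth (f : R -> R) : Prop :=
  forall rho k (D : ndom 1), (forall u, ~ npts D u) ->
    gCk rho k D (fun _ x => f (x 0 0)).

Lemma derive_coord1 (f : R -> R) df (x : 'rV[R]_1) i :
  is_derive (x 0 0) (1 : R) f df ->
  differentiable (fun x : 'rV[R]_1 => f (x 0 0)) x /\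
  'D_(delta_mx 0 i) (fun x : 'rV[R]_1 => f (x 0 0)) x = df.
Proof.
move=> h; have df' : differentiable f (x 0 0).
  by apply/derivable1_diffP; case: h.
have dc : differentiable (fun x : 'rV[R]_1 => x 0 0) x.
  exact: differentiable_coord.
split.
  exact: (@differentiable_comp _ _ _ _ (fun x : 'rV[R]_1 => x 0 0) f).
have E : (fun h : R => h^-1 *: (((fun x : 'rV[R]_1 => f (x 0 0)) \o shift x)
      (h *: delta_mx 0 i) - f (x 0 0))) =
    (fun h : R => h^-1 *: ((f \o shift (x 0 0)) (h *: (1 : R)) - f (x 0 0))).
  apply/funext => t /=; congr (_ *: (f _ - _)).
  by rewrite !mxE (ord1 i) eqxx.
by rewrite /derive E -[RHS](@derive_val _ _ _ _ _ _ _ h).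
Qed.

Lemma flat_exp_smooth k : real_smooth (flat_exp k).
Proof.
move=> rho m D D0; elim: m k => [|m IH] k; split=> //.
- by move=> e x _ _; have [] := derive_coord1 0 (is_derive_flat_exp k (x 0 0)).
- by move=> u /D0.
- by move=> e x _ _; have [] := derive_coord1 0 (is_derive_flat_exp k (x 0 0)).
- by move=> u /D0.
move=> i.
have mc (c : R) u : npts D u -> moderate_net rho (fun=> c) by move=> /D0.
apply: gCk_ext (gCk_add (gCk_mul (gCk_cst m (mc (- k%:R))) (IH k.+1)) (IH k.+2)).
move=> e x _ _; have [_ ->//] := derive_coord1 i (is_derive_flat_exp k (x 0 0)).
Qed.

Lemma real_smooth_comp n (rho : gauge R) k (D : ndom n) (f : R -> R)
    (g : R -> 'rV[R]_n -> R) : real_smooth f -> (forall u, ~ npts D u) ->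
  gCk rho k D g -> gCk rho k D (fun e x => f (g e x)).
Proof.
move=> sf D0 sg.
have oT (e : R) : 0 < e <= 1 -> open [set: 'rV[R]_1] by move=> _; exact: openT.
have iT u : (fun _ : R -> 'rV[R]_1 => False) u ->
    \forall e \near (0 : R)^'+, [set: 'rV[R]_1] (u e) by [].
pose T := NDom oT iT; have sT := sf rho k T (fun u h => h).
pose g' e x : 'rV[R]_1 := const_mx (g e x).
have H : gCk rho k D (fun e x => f (g' e x 0 0)).
  apply: (gCk_comp (f := fun _ y => f (y 0 0)) (D' := T)) => //.
  by move=> j; apply: gCk_ext sg => e x _ _; rewrite mxE.
by apply: gCk_ext H => e x _ _; rewrite mxE.
Qed.

Definition smooth_step (y : R) : R :=
  flat_exp 0 y / (flat_exp 0 y + flat_exp 0 (1 - y)).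

Lemma flat_exp_ge0 y : 0 <= flat_exp 0 y.
Proof. by rewrite /flat_exp; case: ifP => // _; rewrite expr0 mul1r expR_ge0. Qed.

Lemma flat_exp_gt0 y : 0 < y -> 0 < flat_exp 0 y.
Proof. by rewrite /flat_exp => ->; rewrite expr0 mul1r expR_gt0. Qed.

Lemma flat_exp_sum_gt0 y : 0 < flat_exp 0 y + flat_exp 0 (1 - y).
Proof.
have [y0|y0] := ltP 0 y.
  by apply: ltr_wpDr; [exact: flat_exp_ge0 | exact: flat_exp_gt0].
by apply: ltr_wpDl; [exact: flat_exp_ge0 | apply: flat_exp_gt0; lra].
Qed.

Lemma smooth_step_itv y : 0 <= smooth_step y <= 1.
Proof.
have s0 := flat_exp_sum_gt0 y; rewrite /smooth_step; apply/andP; split.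
  by rewrite divr_ge0 ?flat_exp_ge0// ltW.
by rewrite ler_pdivrMr// mul1r lerDl flat_exp_ge0.
Qed.

Lemma smooth_step0 y : y <= 0 -> smooth_step y = 0.
Proof. by move=> y0; rewrite /smooth_step /flat_exp ltNge y0 mul0r. Qed.

Lemma smooth_step1 y : 1 <= y -> smooth_step y = 1.
Proof.
move=> y1; have s0 := flat_exp_sum_gt0 y; move: s0; rewrite /smooth_step.
have -> : flat_exp 0 (1 - y) = 0 by rewrite /flat_exp ltNge subr_le0 y1.
by rewrite addr0 => s0; rewrite divff// gt_eqF.
Qed.

Lemma smooth_step_smooth : real_smooth smooth_step.
Proof.
move=> rho k D D0.
have mc (c : R) u : npts D u -> moderate_net rho (fun=> c) by move=> /D0.
have cc : gCk rho k D (fun _ x => x 0 0).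
  by apply: gCk_coord => u /D0.
have s1 := flat_exp_smooth 0 rho k D0.
have s2 : gCk rho k D (fun _ x => flat_exp 0 (1 - x 0 0)).
  apply: (real_smooth_comp (f := flat_exp 0)) => //; first exact: flat_exp_smooth.
  apply: gCk_ext (gCk_add (gCk_cst k (mc 1)) (gCk_mul (gCk_cst k (mc (-1))) cc)).
  by move=> e x _ _; rewrite mulN1r.
apply: gCk_mul; first exact: s1.
apply: gCk_inv; last exact: gCk_add.
  by move=> e x _ _; rewrite gt_eqF// flat_exp_sum_gt0.
by move=> u /D0.
Qed.

(** A smooth map of the line that is the identity near [[a, b]] and takes its
    values in the interval with a margin [d] around it. *)
Definition smooth_clamp (a b d x : R) : R :=
  (a + b) / 2 + (x - (a + b) / 2) *
    (smooth_step (2 * (x - (a - d)) / d) * smooth_step (2 * (b + d - x) / d)).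

Lemma smooth_clamp_id a b d x : 0 < d -> a - d / 2 <= x <= b + d / 2 ->
  smooth_clamp a b d x = x.
Proof.
move=> d0 /andP[ax xb]; rewrite /smooth_clamp !smooth_step1.
- by rewrite mulr1 mulr1 addrC subrK.
- by rewrite ler_pdivlMr//; lra.
- by rewrite ler_pdivlMr//; lra.
Qed.

Lemma smooth_clamp_itv a b d x : 0 < d -> a <= b ->
  a - d <= smooth_clamp a b d x <= b + d.
Proof.
move=> d0 ab; rewrite /smooth_clamp.
have [xa|ax] := leP x (a - d).
  rewrite (@smooth_step0 (_ / d)) ?mul0r ?mulr0 ?addr0; first lra.
  by rewrite ler_pdivrMr// mul0r; lra.
have [bx|xb] := leP (b + d) x.
  rewrite (@smooth_step0 (2 * (b + d - x) / d)) ?mulr0 ?addr0; first lra.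
  by rewrite ler_pdivrMr// mul0r; lra.
set s := smooth_step _; set t := smooth_step _.
have /andP[s0 s1] : 0 <= s <= 1 by exact: smooth_step_itv.
have /andP[t0 t1] : 0 <= t <= 1 by exact: smooth_step_itv.
have st0 : 0 <= s * t by rewrite mulr_ge0.
have st1 : s * t <= 1 by rewrite mulr_ile1.
move: st0 st1; set r := s * t => r0 r1.
by apply/andP; split; nra.
Qed.

End Bump.

(** * Extension of nets to the whole line *)

Section Extension.
Context {R : realType}.
Variable rho : gauge R.

Local Notation Rt := (Rt rho).
Local Notation mod := (moderate_net rho).
Local Notation ngl := (negligible_net rho).
Local Notation ndom := (@ndom R).
Local Notation gsmooth := (gsmooth rho).

Lemma smooth_clamp_smooth k (D : ndom 1) (a b d : R -> R) :
  (forall u, ~ npts D u) ->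
  gCk rho k D (fun e x => smooth_clamp (a e) (b e) (d e) (x 0 0)).
Proof.
move=> D0; have mc (c : R -> R) : gCk rho k D (fun e _ => c e).
  by apply: gCk_cst => u /D0.
have cc : gCk rho k D (fun _ x => x 0 0) by apply: gCk_coord => u /D0.
have nc : gCk rho k D (fun _ x => - x 0 0).
  apply: gCk_ext (gCk_mul (mc (fun=> -1)) cc) => e x _ _; exact: mulN1r.
rewrite /smooth_clamp.
apply: gCk_add; first exact: (mc (fun e => (a e + b e) / 2)).
apply: gCk_mul.
  by apply: gCk_add => //; exact: (mc (fun e => - ((a e + b e) / 2))).
apply: gCk_mul; apply: (real_smooth_comp (f := smooth_step)) => //;
  try exact: smooth_step_smooth.
- apply: gCk_mul; last exact: (mc (fun e => (d e)^-1)).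
  apply: gCk_mul; first exact: (mc (fun=> 2)).
  by apply: gCk_add => //; exact: (mc (fun e => - (a e - d e))).
- apply: gCk_mul; last exact: (mc (fun e => (d e)^-1)).
  apply: gCk_mul; first exact: (mc (fun=> 2)).
  by apply: gCk_add => //; exact: (mc (fun e => b e + d e)).
Qed.

Variables (a b : R -> R) (M : nat).
Hypotheses (ma : mod a) (mb : mod b).
Hypothesis (ab : \forall e \near 0^'+, a e + rho e ^+ M <= b e).

Local Notation slab := (@slab R rho a b 1).

Lemma slab_le : \forall e \near 0^'+, a e <= b e.
Proof.
by apply: filterS2 ab (near_gauge_mono rho) => e h [_ _ /(_ M) r _]; lra.
Qed.

(** Such a net differs from one with values in the intervals by a negligible
    net. *)
Lemma slab_ngl (u : R -> 'rV[R]_1) :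
  (forall n, \forall e \near 0^'+,
     a e - rho e ^+ n <= u e 0 0 <= b e + rho e ^+ n) -> pts (slab 0) u.
Proof.
move=> h; pose c e := clamp (a e) (b e) (u e 0 0).
have cu : ngl (fun e => c e - u e 0 0).
  move=> n; apply: filterS3 (h n) slab_le (near_gauge_mono rho).
  move=> e /andP[h1 h2] ab' [_ _ rk _]; rewrite distrC.
  by apply: clamp_dist; [exact: ltW|exact: ab'|lra|lra].
have mc : mod c.
  apply: (gitv_mod ma mb); apply: filterS slab_le => e; exact: clamp_itv.
have P : pts (slab 0) (fun e => const_mx (c e)).
  apply: slab_pts => //.
    move=> i; apply: mod_ev mc; apply: nearW => e; by rewrite mxE.
  by apply: filterS slab_le => e ab'; rewrite mxE; exact: clamp_itv.
apply: npts_ngl P _; apply: ngl_le cu; apply: nearW => e; rewrite normr_id.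
by apply: norm_coord => // i; rewrite !mxE (ord1 i).
Qed.

(** Otherwise some points outside of the domains, whose distances to the intervals
    are bounded by powers of the gauge with exponents tending to infinity, would represent a
    point of the generalized interval. *)
Lemma slab_margin (D : ndom 1) : npts D = pts (slab 0) ->
  exists N, \forall e \near 0^'+, forall x : 'rV[R]_1,
    a e - rho e ^+ N <= x 0 0 <= b e + rho e ^+ N -> D e x.
Proof.
move=> DX; apply: contrapT => h.
pose B e K (y : 'rV[R]_1) :=
  a e - rho e ^+ K <= y 0 0 <= b e + rho e ^+ K /\ ~ D e y.
have HB K : ~ \forall e \near 0^'+, forall y, ~ B e K y.
  move=> hK; apply: h; exists K; apply: filterS hK => e hK y yu.
  by apply: contrapT => nD; apply: (hK y).
have [y [y1 y2]] := diagonal_net (fun e => const_mx (a e)) HB.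
have Py : pts (slab 0) y.
  apply: slab_ngl => n.
  apply: filterS3 (y1 n) (near_gauge_mono rho) slab_le.
  move=> e [->|[K nK [/andP[yK1 yK2] _]]] [_ _ rk rl] ab'.
    by rewrite mxE; have := rk n; lra.
  by have := rl _ _ nK; lra.
have Dy : \forall e \near 0^'+, D e (y e) by apply: npts_in; rewrite DX.
by apply: (y2 0%N); apply: filterS Dy => e Dy [K _ []].
Qed.

(** Precomposition with a smooth clamp. At the parameters for which the clamp
    leaves the domain of the net, the extension is zero. *)
Lemma gsf_extend k (f : 'rV[Rt]_1 -> 'rV[Rt]_k) Om fe :
  gsf_net (slab 0) f Om fe ->
  exists ge, gsf_net (slab 0) f (fun=> setT) ge.
Proof.
move=> /gsf_netP[D [DO DX sf fP]].
have [N hN] := slab_margin DX.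
pose phi e (x : 'rV[R]_1) : 'rV[R]_1 :=
  const_mx (smooth_clamp (a e) (b e) (rho e ^+ N) (x 0 0)).
pose good e := forall x, D e (phi e x).
pose ge e x := if `[< good e >] then fe e (phi e x) else 0.
have ev_good : \forall e \near 0^'+, good e.
  apply: filterS3 hN slab_le (near_gauge_mono rho) => e {}hN ab' [_ _ rk _] x.
  by apply: hN; rewrite mxE; exact: smooth_clamp_itv.
have oT (e : R) : 0 < e <= 1 -> open [set: 'rV[R]_1] by move=> _; exact: openT.
have iT u : pts (slab 0) u ->
    \forall e \near (0 : R)^'+, [set: 'rV[R]_1] (u e).
  by move=> _; exact: nearW.
pose T := NDom oT iT.
have oG (e : R) : 0 < e <= 1 -> open [set x : 'rV[R]_1 | good e].
  move=> _; have [g|g] := pselect (good e).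
    by rewrite (_ : mkset _ = setT); [exact: openT|apply/seteqP; split].
  by rewrite (_ : mkset _ = set0); [exact: open0|apply/seteqP; split].
have iG u : (fun _ : R -> 'rV[R]_1 => False) u ->
    \forall e \near (0 : R)^'+, [set x : 'rV[R]_1 | good e] (u e) by [].
pose G := NDom oG iG.
have sG j : gsmooth G (fun e x => fe e (phi e x) 0 j).
  move=> m; apply: (gCk_comp (f := fun e y => fe e y 0 j) (D' := D)) => //.
    exact: sf.
  move=> i; apply: gCk_ext (smooth_clamp_smooth m a b (fun e => rho e ^+ N)
    (D := G) (fun u h => h)).
  by move=> e x _ _; rewrite mxE.
have near_id u : pts (slab 0) u -> \forall e \near 0^'+,
    \forall x \near u e, ge e x = fe e x.
  move=> [mu]; rewrite /Defs.line/slab/= mxE => -[au ub].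
  have le1 := gle_cls N.+1 ma (mu 0) au.
  have le2 := gle_cls N.+1 (mu 0) mb ub.
  apply: filterS3 (filterI le1 le2) ev_good (filterI (near_gauge_mono rho)
     (near_gaugeMX rho 4 N)).
  move=> e [{}le1 {}le2] g [[_ _ rk _] r4].
  have d0 := rk N; have d4 : 0 < rho e ^+ N / 4 by rewrite divr_gt0.
  have := nbhsx_ballx (u e) _ d4; apply: filterS => x.
  rewrite -ball_normE/= => ux.
  rewrite /ge asboolT//; congr (fe e _); apply/rowP => i; rewrite mxE (ord1 i).
  have := le_lt_trans (coord_norm _ 0) ux; rewrite !mxE ltr_norml => /andP[h1 h2].
  by rewrite smooth_clamp_id//; apply/andP; split; lra.
exists ge; apply/gsf_netP; exists T; split=> //; last first.
  move=> u Pu; rewrite fP//; apply/rowP => j; rewrite !mxE; apply: cls_ev.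
  by apply: filterS (near_id u Pu) => e /nbhs_singleton ->.
move=> j; apply: gsmooth_words => [w e x e01 _|w u Pu].
  have [g|g] := pselect (good e).
    have := gsmooth_diff (gsmooth_spd w (sG j)) e01 (x := x) g.
    by rewrite /ge asboolT.
  rewrite /ge asboolF//.
  have mz : gsmooth T (fun e x => (0 : 'rV[R]_k) 0 j).
    by move=> m; apply: gCk_cst => v _; exact: mod_cst.
  exact: (gsmooth_diff (gsmooth_spd w mz) e01 (x := x)).
have m1 : mod (fun e => spd w (fun y => fe e y 0 j) (u e)).
  by apply: (gsmooth_mod (gsmooth_spd w (sf j))); rewrite DX.
apply: mod_ev m1; apply: filterS (near_id u Pu) => e h.
have h' : \forall x \near u e, fe e x 0 j = ge e x 0 j.
  by apply: filterS h => x ->.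
exact: (nbhs_singleton (spd_near w h')).
Qed.

End Extension.

(** * Riemann sums and primitives *)

Section RealIntegrals.
Context {R : realType}.
Local Notation mu := (@lebesgue_measure R).

(** The fundamental theorem of calculus for the oriented integral. *)
Lemma oint_primitive (f : R -> R) (A B : R) : A < B -> continuous f ->
  exists F : R -> R, (forall x, A < x < B -> is_derive x (1 : R) F (f x)) /\
    forall x y, A < x < B -> A < y < B -> oint f x y = F y - F x.
Proof.
move=> AB cf.
have fi : mu.-integrable `[A, B] (EFin \o f).
  apply: continuous_compact_integrable; first exact: segment_compact.
  exact: continuous_subspaceT.
pose F x := \int[mu]_(t in `[A, x]) f t.
have dF x : A < x < B -> is_derive x (1 : R) F (f x).
  move=> /andP[Ax xB].
  have [d e] := continuous_FTC1_closed xB fi Ax (cf x).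
  by apply: DeriveDef; [exact: d | rewrite -derive1E; exact: e].
have le x y : A < x < B -> A < y < B -> x <= y ->
    \int[mu]_(t in `[x, y]) f t = F y - F x.
  move=> xI yI; rewrite le_eqVlt => /predU1P[<-|xy].
    by rewrite set_itv1 Rintegral_set1 subrr.
  have cF z : A < z < B -> {for z, continuous F}.
    move=> zI; apply: differentiable_continuous; apply/derivable1_diffP.
    by have [] := dF z zI.
  rewrite /Rintegral (@continuous_FTC2 _ f F)//=.
  - exact: continuous_subspaceT.
  - split.
    + move=> z; rewrite in_itv/= => /andP[xz zy].
      have zI : A < z < B.
        by move: xI yI => /andP[Ax _] /andP[_ yB]; rewrite (lt_trans Ax)//= (lt_trans zy).
      by have [] := dF z zI.
    + by apply: cvg_at_right_filter; exact: cF.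
    + by apply: cvg_at_left_filter; exact: cF.
  - move=> z; rewrite in_itv/= => /andP[xz zy].
    have zI : A < z < B.
      by move: xI yI => /andP[Ax _] /andP[_ yB]; rewrite (lt_trans Ax)//= (lt_trans zy).
    by have [_] := dF z zI; rewrite -derive1E.
exists F; split=> // x y xI yI; rewrite /oint; case: leP => xy; first exact: le.
by rewrite le ?opprB// ltW.
Qed.

Lemma mvt_bound (F f : R -> R) (x y C : R) : 
  (forall z, Num.min x y <= z <= Num.max x y ->
     is_derive z (1 : R) F (f z) /\ `|f z| <= C) ->
  `|F y - F x| <= C * `|y - x|.
Proof.
wlog xy : x y / x <= y => [H h|h].
  have [xy|yx] := leP x y; first exact: H.
  rewrite distrC [`|y - x|]distrC; apply: H; first exact: ltW.
  by move=> z; rewrite minC maxC; exact: h.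
rewrite min_l// max_r// in h.
have [z zI ->] : exists2 c, c \in `[x, y]%R & F y - F x = f c * (y - x).
  apply: MVT_segment => // [z|].
    rewrite in_itv/= => /andP[xz zy].
    have zI : x <= z <= y by rewrite !ltW.
    by have [] := h z zI.
  apply: continuous_in_subspaceT => z; rewrite inE/= in_itv/= => zI.
  apply: differentiable_continuous; apply/derivable1_diffP.
  by have [[]] := h z zI.
rewrite normrM ler_wpM2r//; rewrite in_itv/= in zI.
by have [] := h z zI.
Qed.

Definition riemann (f : R -> R) (a b : R) (n : nat) : R :=
  \sum_(k < n) (b - a) / n%:R * f (a + k%:R * ((b - a) / n%:R)).

Lemma node_itv (a b : R) n (k : nat) : a <= b -> (0 < n)%N -> (k <= n)%N ->
  a <= a + k%:R * ((b - a) / n%:R) <= b.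
Proof.
move=> ab n0 kn; have n0' : (0 : R) < n%:R by rewrite ltr0n.
have kn' : (k%:R : R) <= n%:R by rewrite ler_nat.
have h : 0 <= (b - a) / n%:R by rewrite divr_ge0 ?subr_ge0// ltW.
have k0 : (0 : R) <= k%:R by [].
rewrite lerDl mulr_ge0//= -lerBrDl mulrA ler_pdivrMr// mulrC.
by rewrite ler_wpM2l// subr_ge0.
Qed.

Lemma riemann_le (f : R -> R) (a b C : R) n : a <= b -> (0 < n)%N ->
  (forall t, a <= t <= b -> `|f t| <= C) -> `|riemann f a b n| <= (b - a) * C.
Proof.
move=> ab n0 fC; have n0' : (0 : R) < n%:R by rewrite ltr0n.
apply: le_trans (ler_norm_sum _ _ _) _.
apply: (@le_trans _ _ (\sum_(k < n) (b - a) / n%:R * C)).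
  apply: ler_sum => k _; rewrite normrM ger0_norm; last first.
    by rewrite divr_ge0 ?subr_ge0// ltW.
  rewrite ler_wpM2l//; first by rewrite divr_ge0 ?subr_ge0// ltW.
  by apply: fC; apply: node_itv => //; exact: ltnW.
rewrite sumr_const card_ord -[leLHS]mulr_natl mulrA mulrCA divff ?mulr1//.
by rewrite gt_eqF.
Qed.

Lemma riemannB (f g : R -> R) a b n :
  riemann f a b n - riemann g a b n = riemann (fun t => f t - g t) a b n.
Proof. by rewrite /riemann -sumrB; apply: eq_bigr => k _; rewrite mulrBr. Qed.

Lemma eq_riemann (f g : R -> R) (a b : R) n : a <= b -> (0 < n)%N ->
  (forall t, a <= t <= b -> f t = g t) -> riemann f a b n = riemann g a b n.
Proof.
move=> ab n0 fg; apply: eq_bigr => k _; rewrite fg//.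
by apply: node_itv => //; exact: ltnW.
Qed.

(** On each subinterval the mean value theorem compares the increment of the
    primitive with the value of [f] at the left node. *)
Lemma riemann_primitive (F f : R -> R) (a b K : R) n : a <= b -> (0 < n)%N -> 0 <= K ->
  (forall t, a <= t <= b -> is_derive t (1 : R) F (f t)) ->
  (forall s t, a <= s <= b -> a <= t <= b -> `|f s - f t| <= K * `|s - t|) ->
  `|F b - F a - riemann f a b n| <= K * (b - a) ^+ 2 / n%:R.
Proof.
move=> ab n0 K0 dF lf; have n0' : (0 : R) < n%:R by rewrite ltr0n.
set h := (b - a) / n%:R; have h0 : 0 <= h by rewrite divr_ge0 ?subr_ge0// ltW.
pose t (k : nat) : R := a + k%:R * h.
have tI k : (k <= n)%N -> a <= t k <= b by move=> kn; exact: node_itv.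
have tS k : t k.+1 - t k = h by rewrite /t -natr1; ring.
have -> : F b - F a = \sum_(0 <= k < n) (F (t k.+1) - F (t k)).
  rewrite telescope_sumr// /t mul0r addr0; congr (F _ - _).
  rewrite /h [n%:R * _]mulrC divfK; last by rewrite gt_eqF.
  by rewrite addrC subrK.
rewrite big_mkord /riemann -sumrB; apply: le_trans (ler_norm_sum _ _ _) _.
apply: (@le_trans _ _ (\sum_(k < n) K * h ^+ 2)); last first.
  rewrite sumr_const card_ord -[leLHS]mulr_natl /h.
  rewrite le_eqVlt; apply/orP; left; apply/eqP; field; exact: lt0r_neq0.
apply: ler_sum => k _; rewrite -/h -/(t k).
have kn := ltn_ord k.
have tt : t k <= t k.+1 by rewrite -subr_ge0 tS.
have /andP[ta _] := tI _ (ltnW kn); have /andP[_ tb] := tI _ kn.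
have [z zI ->] : exists2 c, c \in `[t k, t k.+1]%R &
    F (t k.+1) - F (t k) = f c * (t k.+1 - t k).
  have sub z : t k <= z <= t k.+1 -> a <= z <= b.
    by move=> /andP[z1 z2]; rewrite (le_trans ta)//= (le_trans z2).
  apply: MVT_segment => // [z|].
    by rewrite in_itv/= => /andP[xz zy]; apply: dF; apply: sub; rewrite !ltW.
  apply: continuous_in_subspaceT => z; rewrite inE/= in_itv/= => zI.
  apply: differentiable_continuous; apply/derivable1_diffP.
  by have [] := dF z (sub z zI).
rewrite in_itv/= in zI; case/andP: zI => z1 z2.
rewrite tS [f z * h]mulrC -mulrBr normrM (ger0_norm h0).
have zI : a <= z <= b by rewrite (le_trans ta)//= (le_trans z2).
have zh : `|z - t k| <= h by rewrite ger0_norm ?subr_ge0//; have := tS k; lra.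
apply: (@le_trans _ _ (h * (K * h))); last by rewrite mulrCA -expr2.
rewrite ler_wpM2l//; apply: le_trans (lf _ _ zI (tI _ (ltnW kn))) _.
by rewrite ler_wpM2l.
Qed.

End RealIntegrals.

(** * The generalized integral as a Riemann sum *)

Section IntegralNets.
Context {R : realType}.
Variable rho : gauge R.

Local Notation Rt := (Rt rho).
Local Notation mod := (moderate_net rho).
Local Notation ngl := (negligible_net rho).
Local Notation ndom := (@ndom R).
Local Notation gsmooth := (gsmooth rho).

(** The exponent, the integral part of [1 / e], tends to infinity; this makes the
    mesh smaller than every power of the gauge. *)
Definition nodes (e : R) : nat := (Num.truncn (rho e ^- Num.truncn e^-1)).+1.

Lemma nodes_ngl : ngl (fun e => (nodes e)%:R^-1).
Proof.
move=> n; near=> e.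
have [r0 r1 rk rl] : [/\ 0 < rho e, rho e <= 1, (forall k, 0 < rho e ^+ k)
  & forall k l, (k <= l)%N -> rho e ^+ l <= rho e ^+ k].
  by near: e; exact: near_gauge_mono.
have e0 : 0 < e by near: e; exact: nbhs_right_gt.
have en : e <= n.+1%:R^-1.
  by near: e; apply: nbhs_right_le; rewrite invr_gt0.
have hn : (n <= Num.truncn e^-1)%N.
  rewrite truncn_ge_nat ?invr_ge0 ?(ltW e0)//.
  rewrite -[e^-1]mul1r ler_pdivlMr//.
  apply: (@le_trans _ _ (n.+1%:R * e)); first by rewrite ler_wpM2r ?(ltW e0)// ler_nat.
  by rewrite -ler_pdivlMl// mulr1.
rewrite ger0_norm ?invr_ge0//; apply: le_trans (rl _ _ hn).
rewrite -[leRHS]invrK lef_pV2 ?posrE ?invr_gt0//.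
exact/ltW/truncnS_gt.
Unshelve. all: by end_near. Qed.

(** Bounds along all nets of points of the intervals are uniform: a choice of bad
    points would be a net that violates them. *)
Lemma real_selection (a b : R -> R) (F : R -> R -> R) :
  (\forall e \near 0^'+, a e <= b e) ->
  (forall t, (\forall e \near 0^'+, a e <= t e <= b e) -> mod (fun e => F e (t e))) ->
  exists K, \forall e \near 0^'+, forall t, a e <= t <= b e -> `|F e t| <= rho e ^- K.
Proof.
move=> ab mF; apply: contrapT => h.
pose B e K (t : R) := a e <= t <= b e /\ ~ `|F e t| <= rho e ^- K.
have HB K : ~ \forall e \near 0^'+, forall y, ~ B e K y.
  move=> hK; apply: h; exists K; apply: filterS hK => e hK y yu.
  by apply: contrapT => nD; apply: (hK y).
have [t [t1 t2]] := diagonal_net a HB.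
have [|N FN] := mF t.
  apply: filterS2 (t1 0%N) ab => e [->|[K _ []//]]; by rewrite lexx.
apply: (t2 N); apply: filterS2 FN (near_gauge_mono rho) => e FN [_ _ rk rl].
move=> [K NK [_]]; apply; apply: le_trans FN _.
by rewrite lef_pV2 ?posrE// rl.
Qed.

Lemma real_selection_prop (a b : R -> R) (P : R -> R -> Prop) :
  (\forall e \near 0^'+, a e <= b e) ->
  (forall t, (\forall e \near 0^'+, a e <= t e <= b e) ->
     \forall e \near 0^'+, P e (t e)) ->
  \forall e \near 0^'+, forall t, a e <= t <= b e -> P e t.
Proof.
move=> ab nP; apply: contrapT => h.
pose B e (K : nat) (t : R) := a e <= t <= b e /\ ~ P e t.
have HB K : ~ \forall e \near 0^'+, forall y, ~ B e K y.
  move=> hK; apply: h; apply: filterS hK => e hK y yu.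
  by apply: contrapT => nD; apply: (hK y).
have [t [t1 t2]] := diagonal_net a HB.
have tI : \forall e \near 0^'+, a e <= t e <= b e.
  by apply: filterS2 (t1 0%N) ab => e [->|[K _ []//]]; rewrite lexx.
by apply: (t2 0%N); apply: filterS (nP t tI) => e Pe [K _ []].
Qed.

Lemma real_selection_ngl (a b : R -> R) (F : R -> R -> R) :
  (\forall e \near 0^'+, a e <= b e) ->
  (forall t, (\forall e \near 0^'+, a e <= t e <= b e) -> ngl (fun e => F e (t e))) ->
  forall n, \forall e \near 0^'+, forall t, a e <= t <= b e -> `|F e t| <= rho e ^+ n.
Proof.
move=> ab nF n; apply: (real_selection_prop (P := fun e t => `|F e t| <= rho e ^+ n)).
  exact: ab.
by move=> t tI; exact: nF t tI n.
Qed.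

Variables (a b : R -> R) (M : nat).
Hypotheses (ma : mod a) (mb : mod b).
Hypothesis (ab : \forall e \near 0^'+, a e + rho e ^+ M <= b e).

Local Notation slab := (@slab R rho a b 1).
Local Notation slab_le := (slab_le ab).

Lemma mod_len : mod (fun e => b e - a e).
Proof. exact: modB. Qed.

Lemma pts_const t : (\forall e \near 0^'+, a e <= t e <= b e) ->
  pts (slab 0) (fun e => const_mx (t e)).
Proof.
move=> h; apply: slab_pts => //.
  move=> i; apply: mod_ev (gitv_mod ma mb h).
  by apply: nearW => e; rewrite mxE.
by apply: filterS h => e; rewrite mxE.
Qed.

Lemma riemann_ngl (F : R -> R -> R) :
  (forall t, (\forall e \near 0^'+, a e <= t e <= b e) -> ngl (fun e => F e (t e))) ->
  ngl (fun e => riemann (F e) (a e) (b e) (nodes e)).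
Proof.
move=> nF; have h := real_selection_ngl slab_le nF.
suff H : forall n, \forall e \near 0^'+, `|riemann (F e) (a e) (b e) (nodes e)| <=
    (b e - a e) * rho e ^+ n.
  have [N hN] := mod_len => n.
  apply: filterS3 (H (n + N)%N) hN (near_gauge_mono rho) => e h1 h2 [_ _ rk _].
  apply: le_trans h1 _; rewrite exprD mulrCA -[leRHS]mulr1.
  rewrite ler_wpM2l ?(ltW (rk _))// -ler_pdivlMr// div1r.
  exact: le_trans (ler_norm _) h2.
move=> n; apply: filterS2 (h n) slab_le => e {}h ab'.
exact: riemann_le.
Qed.

Lemma riemann_mod (F : R -> R -> R) :
  (forall t, (\forall e \near 0^'+, a e <= t e <= b e) -> mod (fun e => F e (t e))) ->
  mod (fun e => riemann (F e) (a e) (b e) (nodes e)).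
Proof.
move=> mF; have [K h] := real_selection slab_le mF.
apply: mod_le (modM mod_len (mod_gaugeV rho K)).
apply: filterS3 h slab_le (near_gauge_mono rho) => e {}h ab' [_ _ rk _].
apply: le_trans (ler_norm _); rewrite -(subr0 (riemann _ _ _ _)) subr0.
exact: riemann_le.
Qed.

Lemma const_mx_line (x : R) : (const_mx x : 'rV[R]_1) = 0 + x *: delta_mx 0 0.
Proof. by apply/rowP => i; rewrite !mxE (ord1 i) eqxx mulr1 add0r. Qed.

Lemma is_derive_const (g : 'rV[R]_1 -> R) (t : R) :
  differentiable g (const_mx t) ->
  is_derive t (1 : R) (fun t : R => g (const_mx t)) ('D_(delta_mx 0 0) g (const_mx t)).
Proof.
move=> dg; have -> : (fun t : R => g (const_mx t)) = (fun t => g (0 + t *: delta_mx 0 0)).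
  by apply/funext => s; rewrite -const_mx_line.
by rewrite const_mx_line; apply: is_derive_line; rewrite -const_mx_line.
Qed.

(** On the whole interval, unlike in [local_lipschitz], one exponent serves for
    all points. *)
Lemma slab_lipschitz (D : ndom 1) g : npts D = pts (slab 0) -> gsmooth D g ->
  exists K, \forall e \near 0^'+, forall s t, a e <= s <= b e -> a e <= t <= b e ->
    `|g e (const_mx s) - g e (const_mx t)| <= rho e ^- K * `|s - t|.
Proof.
move=> DX sg; have [N hN] := slab_margin ma mb ab DX.
have [|K hK] := real_selection (F := fun e t => 'D_(delta_mx 0 0) (g e) (const_mx t))
  slab_le _.
  move=> t tI; apply: (gsmooth_mod (gsmoothD 0 sg)); rewrite DX.
  exact: pts_const.
exists K; apply: filterS3 (filterI hN hK) near_unit (near_gauge_mono rho).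
move=> e [{}hN {}hK] e01 [_ _ rk _] s t sI tI.
apply: (mvt_bound (F := fun t => g e (const_mx t))
  (f := fun t => 'D_(delta_mx 0 0) (g e) (const_mx t))) => z zI.
have zI' : a e <= z <= b e.
  move: zI sI tI => /andP[z1 z2] /andP[s1 s2] /andP[t1 t2].
  rewrite (le_trans _ z1) ?le_min ?t1 ?s1//= (le_trans z2)//.
  by rewrite ge_max t2 s2.
split; last exact: hK.
apply: is_derive_const; apply: (gsmooth_diff sg) => //; apply: hN.
rewrite mxE; have rN := rk N; move: zI' => /andP[z1 z2]; apply/andP; split; lra.
Qed.

(** The error of [riemann_primitive] is a moderate net times the inverse of the
    number of nodes. *)
Lemma riemann_net (D : ndom 1) g F : npts D = pts (slab 0) -> gsmooth D g ->
  (\forall e \near 0^'+, forall t, a e <= t <= b e ->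
     is_derive t (1 : R) (F e) (g e (const_mx t))) ->
  ngl (fun e => F e (b e) - F e (a e) -
    riemann (fun t => g e (const_mx t)) (a e) (b e) (nodes e)).
Proof.
move=> DX sg dF; have [K hK] := slab_lipschitz DX sg.
have H : ngl (fun e => (rho e ^- K * (b e - a e) ^+ 2) * (nodes e)%:R^-1).
  apply: nglMl; last exact: nodes_ngl.
  by apply: modM; [exact: mod_gaugeV|apply: modX; exact: mod_len].
apply: ngl_le H; apply: filterS3 (filterI hK dF) slab_le (near_gauge_mono rho).
move=> e [{}hK {}dF] ab' [_ _ rk _].
apply: le_trans (ler_norm _).
apply: riemann_primitive => //; rewrite invr_ge0; exact: ltW.
Qed.

(** The integral is defined with a net on the whole line and with arbitrary
    representatives of the endpoints. Such a net exists by [gsf_extend]; any other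
    choice gives the same Riemann sums up to a negligible error. *)
Lemma gintE (f : Rt -> Rt) Om (g : R -> 'rV[R]_1 -> 'rV[R]_1) :
  gsf_net (slab 0) (curve (scalarc f)) Om g ->
  gint (cls rho a) (cls rho b) f (cls rho a) (cls rho b) =
  cls rho (fun e => riemann (fun t => g e (const_mx t) 0 0) (a e) (b e) (nodes e)).
Proof.
move=> gN; rewrite /gint; set A := [set v | _].
have [D [_ DX sg fg]] := (gsf_netP _ _ _ _).1 gN.
have [ge geN] := gsf_extend ma mb ab gN.
set v0 := cls _ _.
suff uniq v : A v -> v = v0.
  have A1 : A (cls rho (fun e => oint (fun t => ge e (const_mx t) 0 0) (a e) (b e))).
    by exists ge, a, b; split.
  by case: xgetP => [v _ /uniq//|/(_ _ A1)].
move=> [fe [uc [ue [feN [muc Ec] [mue Ee] ->]]]].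
have {}feN : gsf_net (slab 0) (curve (scalarc f)) (fun=> setT) fe := feN.
have [T [TT TX sf ff]] := (gsf_netP _ _ _ _).1 feN.
pose F1 e t := fe e (const_mx t) 0 0.
have dF1 e t : 0 < e <= 1 -> differentiable (fun x => fe e x 0 0) (const_mx t).
  by move=> e01; apply: (gsmooth_diff (sf 0)) => //; rewrite TT.
have cF1 e : 0 < e <= 1 -> continuous (F1 e).
  move=> e01 t; apply: differentiable_continuous; apply/derivable1_diffP.
  by have [] := is_derive_const (dF1 e t e01).
have /choice[P PP] e : exists P : R -> R, 0 < e <= 1 -> exists A B : R,
    [/\ A < uc e < B, A < ue e < B, A < a e < B, A < b e < B
     & (forall x, A < x < B -> is_derive x (1 : R) P (F1 e x)) /\
    forall x y, A < x < B -> A < y < B -> oint (F1 e) x y = P y - P x].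
  have [e01|] := pselect (0 < e <= 1); last by exists id.
  pose S := `|uc e| + `|ue e| + `|a e| + `|b e| + 1.
  have Sb (x : R) : `|x| < S -> - S < x < S by rewrite ltr_norml.
  have S0 : 0 < S by rewrite /S ltr_wpDl// !addr_ge0.
  have SS : - S < S by rewrite (lt_trans _ S0)// oppr_lt0.
  have [P [P1 P2]] := oint_primitive SS (cF1 e e01).
  exists P => _; exists (- S), S; split=> //; apply: Sb; rewrite /S;
    have := normr_ge0 (uc e); have := normr_ge0 (ue e);
    have := normr_ge0 (a e); have := normr_ge0 (b e); lra.
(* moving an endpoint within its class changes the integral negligibly *)
have endpoint c c' : mod c -> mod c' -> cls rho c = cls rho c' ->
    (\forall e \near 0^'+, a e <= c e <= b e) ->
    (forall e, 0 < e <= 1 -> exists A B : R, [/\ A < c e < B, A < c' e < B &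
       forall x, A < x < B -> is_derive x (1 : R) (P e) (F1 e x)]) ->
    ngl (fun e => P e (c' e) - P e (c e)).
  move=> mc mc' Ecc cI cAB; have Pc := pts_const cI.
  have mf w : pts (slab 0) w -> mod (fun e => fe e (w e) 0 0).
    by move=> Pw; apply: (gsmooth_mod (sf 0)); rewrite TX.
  have [K hK] := local_bound (f := fun e x => fe e x 0 0) TX mf Pc.
  have ncc := cls_inj mc' mc (esym Ecc).
  apply: ngl_le (nglMl (mod_gaugeV rho K) ncc).
  apply: filterS3 (filterI hK near_unit) (ncc K) (near_gauge_mono rho).
  move=> e [{}hK e01] {}ncc [_ _ rk _].
  rewrite [leRHS]normrM [`|rho e ^- K|]ger0_norm; last by rewrite invr_ge0 ltW.
  have [A0 [B0 [cA cB dP]]] := cAB e e01.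
  apply: (mvt_bound (f := F1 e)) => z /andP[z1 z2].
  have zAB : A0 < z < B0.
    move: cA cB => /andP[p1 p2] /andP[p3 p4].
    rewrite (lt_le_trans _ z1) ?lt_min ?p1 ?p3//= (le_lt_trans z2)//.
    by rewrite gt_max p2 p4.
  split; first exact: dP.
  suff zc : `|const_mx z - const_mx (c e) : 'rV[R]_1| <= rho e ^+ K.
    by have [] := hK (const_mx z) zc.
  apply: norm_coord => [|i]; first exact: ltW.
  rewrite !mxE; apply: le_trans ncc.
  move: z1 z2; case: (leP (c e) (c' e)) => cc z1 z2.
    by rewrite !ger0_norm; lra.
  by rewrite !ler0_norm; lra.
have nA : ngl (fun e => P e (uc e) - P e (a e)).
  apply: endpoint => //.
    by apply: filterS slab_le => e ->; rewrite lexx.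
  by move=> e /PP[A0 [B0 [? ? ? ? []]]]; exists A0, B0.
have nB : ngl (fun e => P e (ue e) - P e (b e)).
  apply: endpoint => //.
    by apply: filterS slab_le => e ->; rewrite lexx.
  by move=> e /PP[A0 [B0 [? ? ? ? []]]]; exists A0, B0.
have nP : ngl (fun e => P e (b e) - P e (a e) -
    riemann (F1 e) (a e) (b e) (nodes e)).
  apply: (riemann_net TX (sf 0)); apply: filterS near_unit => e e01 t /andP[ta tb].
  have [A0 [B0 [_ _ /andP[aA _] /andP[_ bB] [dP _]]]] := PP e e01.
  by apply: dP; rewrite (lt_le_trans aA)//= (le_lt_trans tb).
have nR : ngl (fun e => riemann (fun t => F1 e t - g e (const_mx t) 0 0)
    (a e) (b e) (nodes e)).
  apply: (riemann_ngl (F := fun e t => F1 e t - g e (const_mx t) 0 0)) => t tI.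
  have Pt := pts_const tI.
  apply: cls_inj.
  - by apply: (gsmooth_mod (sf 0)); rewrite TX.
  - by apply: (gsmooth_mod (sg 0)); rewrite DX.
  - by have := ff _ Pt; rewrite (fg _ Pt) => /rowP/(_ 0); rewrite !mxE.
apply: cls_eq; apply: ngl_ev (nglD (nglB nB nA) (nglD nP nR)).
apply: filterS near_unit => e e01; have [A0 [B0 [ucI ueI _ _ [_ oP]]]] := PP e e01.
by rewrite -riemannB -/(F1 e) oP//; ring.
Qed.

End IntegralNets.

(** * Smooth dependence on a parameter *)

Section Composition.
Context {R : realType}.
Variable rho : gauge R.

Local Notation mod := (moderate_net rho).
Local Notation ndom := (@ndom R).
Local Notation gsmooth := (gsmooth rho).

(** Composition restricts the domains to the preimages, without loss of points. *)
Lemma comp_dom n p (D0 : ndom p) (D : ndom n) (g : R -> 'rV[R]_p -> 'rV[R]_n) :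
  (forall j, gsmooth D0 (fun e x => g e x 0 j)) ->
  (forall u, npts D0 u -> npts D (fun e => g e (u e))) ->
  exists D1 : ndom p, [/\ npts D1 = npts D0,
    forall e x, D1 e x <-> D0 e x /\ D e (g e x),
    forall f, gsmooth D f -> gsmooth D1 (fun e x => f e (g e x))
    & forall f, gsmooth D0 f -> gsmooth D1 f].
Proof.
move=> sg gU.
have o1 e : 0 < e <= 1 -> open [set x | D0 e x /\ D e (g e x)].
  move=> e01; rewrite openE => x [D0x Dgx].
  have cg : {for x, continuous (g e)}.
    apply: differentiable_continuous; apply: differentiable_row => j.
    exact: (gsmooth_diff (sg j)).
  have h1 := near_dom e01 D0x; have h2 := cg _ (near_dom e01 Dgx).
  by apply: filterS2 h1 h2 => y.
have i1 u : npts D0 u -> \forall e \near 0^'+, D0 e (u e) /\ D e (g e (u e)).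
  move=> Du; apply: filterS2 (npts_in Du) (npts_in (gU u Du)) => e.
  by split.
pose D1 := NDom o1 i1; exists D1.
have sub f : gsmooth D0 f -> gsmooth D1 f.
  by apply: gsmooth_sub => // e x [].
split; [by []|by []| |exact: sub].
move=> f sf k; apply: (gCk_comp (D := D1) (D' := D) (g := g) _ gU (sf k)).
- by move=> e x _ [].
- by move=> j; exact: (sub _ (sg j)).
Qed.

Lemma gsmooth_add n (D : ndom n) f g : gsmooth D f -> gsmooth D g ->
  gsmooth D (fun e x => f e x + g e x).
Proof. by move=> sf sg k; exact: gCk_add. Qed.

Lemma gsmooth_mul n (D : ndom n) f g : gsmooth D f -> gsmooth D g ->
  gsmooth D (fun e x => f e x * g e x).
Proof. by move=> sf sg k; exact: gCk_mul. Qed.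

Lemma gsmooth_cst n (D : ndom n) c : mod c -> gsmooth D (fun e _ => c e).
Proof. by move=> mc k; exact: gCk_cst. Qed.

Lemma gsmooth_sum n (D : ndom n) (I : Type) (r : seq I) (P : pred I) f :
  (forall i, P i -> gsmooth D (f i)) ->
  gsmooth D (fun e x => \sum_(i <- r | P i) f i e x).
Proof. by move=> h k; apply: gCk_sum => i Pi; exact: h. Qed.

Lemma gsmoothX n (D : ndom n) f k : gsmooth D f ->
  gsmooth D (fun e x => f e x ^+ k).
Proof.
move=> sf; elim: k => [|k IH].
  by apply: gsmooth_ext (gsmooth_cst D (mod_cst rho 1)) => e x _ _; rewrite expr0.
by apply: gsmooth_ext (gsmooth_mul sf IH) => e x _ _; rewrite exprS.
Qed.

Lemma gsmooth_coord n (D : ndom n) j : (forall u, npts D u -> vmoderate rho u) ->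
  gsmooth D (fun _ x => x 0 j).
Proof. by move=> h k; exact: gCk_coord. Qed.

Lemma spd_lin n (D : ndom n) f g (c : R -> R) w e x :
  gsmooth D f -> gsmooth D g -> 0 < e <= 1 -> D e x ->
  spd w (fun y => f e y + c e * g e y) x = spd w (f e) x + c e * spd w (g e) x.
Proof.
move=> sf sg e01; elim: w x => [//|i w IH] x Dx /=.
have df : derivable (spd w (f e)) x (delta_mx 0 i).
  apply: diff_derivable; exact: (gsmooth_diff (gsmooth_spd w sf)).
have dg : derivable (spd w (g e)) x (delta_mx 0 i).
  apply: diff_derivable; exact: (gsmooth_diff (gsmooth_spd w sg)).
rewrite (@near_eq_derive _ _ _ _
  (spd w (f e) + (c e \*: spd w (g e)))); last first.
  by apply: filterS (near_dom e01 Dx) => y; exact: IH.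
by rewrite (deriveD df (derivableZ dg)) (deriveZ _ dg).
Qed.

Lemma spd_sum n (D : ndom n) (I : Type) (r : seq I) (P : pred I) f w e x :
  (forall i, gsmooth D (f i)) -> 0 < e <= 1 -> D e x ->
  spd w (fun y => \sum_(i <- r | P i) f i e y) x =
  \sum_(i <- r | P i) spd w (f i e) x.
Proof.
move=> sf e01 Dx.
have E0 (z : 'rV[R]_n) w' : spd w' (fun _ : 'rV[R]_n => (0 : R)) z = 0.
  elim: w' z => [//|i w' IH] z /=; rewrite (_ : spd w' _ = cst 0) ?derive_cst//.
  exact/funext.
elim: r => [|i r IH].
  rewrite big_nil -(E0 x w); congr (spd w _ x); apply/funext => y.
  by rewrite big_nil.
rewrite big_cons; case: ifPn => Pi; last first.
  rewrite -IH; congr (spd w _ x); apply/funext => y.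
  by rewrite big_cons (negbTE Pi).
have ss : gsmooth D (fun e y => \sum_(j <- r | P j) f j e y).
  by apply: gsmooth_sum.
rewrite -IH -[X in _ = _ + X]mul1r.
rewrite -(spd_lin (fun=> 1) w (sf i) ss e01 Dx); congr (spd w _ x).
by apply/funext => y; rewrite big_cons Pi mul1r.
Qed.

End Composition.

Section RiemannParameter.
Context {R : realType}.
Variable rho : gauge R.

Local Notation mod := (moderate_net rho).
Local Notation ndom := (@ndom R).
Local Notation gsmooth := (gsmooth rho).

Variables (a b : R -> R) (M : nat).
Hypotheses (ma : mod a) (mb : mod b).
Hypothesis (ab : \forall e \near 0^'+, a e + rho e ^+ M <= b e).

Definition pair2 (s t : R) : 'rV[R]_2 := \row_(j < 2) if j == 0 then s else t.

Lemma pair2_0 s t : pair2 s t 0 0 = s. Proof. by rewrite mxE eqxx. Qed.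

Lemma pair2_1 s t : pair2 s t 0 1 = t. Proof. by rewrite mxE. Qed.

Local Notation X2 := (@slab R rho a b 2 1).

Lemma pts_pair2 s t : mod s -> (\forall e \near 0^'+, a e <= t e <= b e) ->
  pts X2 (fun e => pair2 (s e) (t e)).
Proof.
move=> ms tI; have mt := gitv_mod ma mb tI; apply: slab_pts => //; last first.
  by apply: filterS tI => e; rewrite pair2_1.
move=> i; have [->|->] : i = 0 \/ i = 1.
  by case: i => -[|[|//]] ilt; [left|right]; exact: val_inj.
- by apply: mod_ev ms; apply: nearW => e; rewrite pair2_0.
- by apply: mod_ev mt; apply: nearW => e; rewrite pair2_1.
Qed.

Lemma derive_pair2 (g : 'rV[R]_2 -> R) (t : R) (x : 'rV[R]_1) :
  differentiable g (pair2 (x 0 0) t) ->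
  differentiable (fun x : 'rV[R]_1 => g (pair2 (x 0 0) t)) x /\
  'D_(delta_mx 0 0) (fun x : 'rV[R]_1 => g (pair2 (x 0 0) t)) x =
  'D_(delta_mx 0 0) g (pair2 (x 0 0) t).
Proof.
move=> dg; split.
  apply: (@differentiable_comp _ _ _ _ (fun x : 'rV[R]_1 => pair2 (x 0 0) t) g) => //.
  apply: differentiable_row => j.
  have [->|jN] := eqVneq j 0.
    rewrite (_ : (fun _ => _) = (fun x : 'rV[R]_1 => x 0 0)).
      exact: differentiable_coord.
    by apply/funext => y; rewrite pair2_0.
  rewrite (_ : (fun _ => _) = cst t); first exact: differentiable_cst.
  by apply/funext => y; rewrite mxE (negbTE jN).
have E : (fun h : R => h^-1 *:
      (((fun x : 'rV[R]_1 => g (pair2 (x 0 0) t)) \o shift x)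
        (h *: delta_mx 0 0) - g (pair2 (x 0 0) t))) =
    (fun h : R => h^-1 *: ((g \o shift (pair2 (x 0 0) t)) (h *: delta_mx 0 0)
      - g (pair2 (x 0 0) t))).
  apply/funext => h /=; congr (_ *: (g _ - _)); apply/rowP => j.
  rewrite !mxE eqxx /=.
  by case: (j == 0); rewrite ?mulr1// mulr0 add0r.
by rewrite /derive E.
Qed.

(** Riemann sums of a net of smooth functions of a parameter and of time are
    a net of smooth functions of the parameter, being finite sums: this
    replaces the differentiation of integrals. *)
Lemma riemann_param (D : ndom 2) (G : R -> 'rV[R]_2 -> R) :
  npts D = pts X2 -> gsmooth D G ->
  let FG w e (x : 'rV[R]_1) :=
    riemann (fun t => spd w (G e) (pair2 (x 0 0) t)) (a e) (b e) (nodes rho e) in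
  exists DF : ndom 1, [/\ npts DF = pts (@line _ rho setT),
    gsmooth DF (FG [::])
    & forall w e x, 0 < e <= 1 -> DF e x ->
      spd w (FG [::] e) x = FG (nseq (size w) 0) e x].
Proof.
move=> DX sG FG.
pose node e (k : nat) : R := a e + k%:R * ((b e - a e) / (nodes rho e)%:R).
pose V e : set 'rV[R]_1 := [set x | forall k : 'I_(nodes rho e),
  D e (pair2 (x 0 0) (node e k))].
have oV (e : R) : 0 < e <= 1 -> open (V e).
  move=> e01; rewrite openE => x Vx.
  have h : nbhs x [set y : 'rV[R]_1 | forall k : 'I_(nodes rho e),
      D e (pair2 (y 0 0) (node e k))].
    have hk (k : 'I_(nodes rho e)) :
        nbhs x [set y : 'rV[R]_1 | D e (pair2 (y 0 0) (node e k))].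
      have c : {for x, continuous (fun x : 'rV[R]_1 => pair2 (x 0 0) (node e k))}.
        apply: differentiable_continuous; apply: differentiable_row => j.
        have [->|jN] := eqVneq j 0.
          rewrite (_ : (fun _ => _) = (fun x : 'rV[R]_1 => x 0 0)).
            exact: differentiable_coord.
          by apply/funext => y; rewrite pair2_0.
        rewrite (_ : (fun _ => _) = cst (node e k)); first exact: differentiable_cst.
        by apply/funext => y; rewrite mxE (negbTE jN).
      exact: c _ (near_dom e01 (Vx k)).
    exact: (filter_forall _ hk).
  exact: h.
have iV u : pts (@line _ rho setT) u -> \forall e \near 0^'+, V e (u e).
  move=> [mu _].
  have h := real_selection_prop (P := fun e t => D e (pair2 (u e 0 0) t)) (slab_le ab).
  apply: filterS2 (h _) (slab_le ab); last first.
    move=> t tI; apply: npts_in; rewrite DX; apply: pts_pair2 => //; exact: mu.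
  move=> e {}h ab' k; apply: h; apply: node_itv => //; exact: ltnW.
pose DF := NDom oV iV.
have dFG w e x : 0 < e <= 1 -> V e x -> differentiable (FG w e) x /\
    'D_(delta_mx 0 0) (FG w e) x = FG (0 :: w) e x.
  move=> e01 Vx; rewrite /FG /riemann.
  set c := (b e - a e) / _.
  have dk (k : 'I_(nodes rho e)) :=
    derive_pair2 (gsmooth_diff (gsmooth_spd w sG) e01 (Vx k)).
  have E : (fun x : 'rV[R]_1 => \sum_(k < nodes rho e)
        c * spd w (G e) (pair2 (x 0 0) (a e + k%:R * c))) =
      \sum_(k < nodes rho e) (c \*: (fun x : 'rV[R]_1 =>
         spd w (G e) (pair2 (x 0 0) (node e k)))).
    by apply/funext => y; rewrite fct_sumE.
  rewrite E; split.
    by apply: differentiable_sum => k; apply: differentiableZ; have [] := dk k.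
  rewrite derive_sum; last first.
    by move=> k; apply: derivableZ; apply: diff_derivable; have [] := dk k.
  apply: eq_bigr => k _; rewrite deriveZ; last first.
    by apply: diff_derivable; have [] := dk k.
  by have [_ ->] := dk k.
have E w e x : 0 < e <= 1 -> V e x -> 
    spd w (FG [::] e) x = FG (nseq (size w) 0) e x.
  move=> e01; elim: w x => [//|i w IH] x Vx /=; rewrite (ord1 i).
  rewrite (@near_eq_derive _ _ _ _ (FG (nseq (size w) 0) e)).
    by have [_ ->] := dFG (nseq (size w) 0) e x e01 Vx.
  by apply: filterS (near_dom (D := DF) e01 Vx) => y; exact: IH.
exists DF; split=> //.
apply: gsmooth_words => [w e x e01 Vx|w u Pu].
  have [d _] := dFG (nseq (size w) 0) e x e01 Vx.
  apply: near_eq_differentiable d.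
  by apply: filterS (near_dom (D := DF) e01 Vx) => y Vy; rewrite E.
have m1 : mod (fun e => FG (nseq (size w) 0) e (u e)).
  apply: (riemann_mod ma mb ab) => t tI.
  apply: (gsmooth_mod (gsmooth_spd _ sG)); rewrite DX; apply: pts_pair2 => //.
  by case: Pu => mu _; exact: mu.
apply: mod_ev m1; apply: filterS2 near_unit (iV u Pu) => e e01 Vu.
by rewrite E.
Qed.

End RiemannParameter.

(** * Integration by parts and the fundamental lemma *)

Section CalculusOfVariations.
Context {R : realType}.
Variable rho : gauge R.

Local Notation mod := (moderate_net rho).
Local Notation ngl := (negligible_net rho).
Local Notation ndom := (@ndom R).
Local Notation gsmooth := (gsmooth rho).

Definition dn (i : nat) (f : 'rV[R]_1 -> R) : 'rV[R]_1 -> R := spd (nseq i 0) f.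

Lemma dnS i f : dn i.+1 f = 'D_(delta_mx 0 0) (dn i f).
Proof. by []. Qed.

Lemma dnSr i f : dn i.+1 f = dn i ('D_(delta_mx 0 0) f).
Proof. by elim: i => [//|i IH]; rewrite dnS IH. Qed.

Lemma gsmooth_dn (D : ndom 1) f i : gsmooth D f -> gsmooth D (fun e => dn i (f e)).
Proof. exact: gsmooth_spd. Qed.

Lemma dn0 i (x : 'rV[R]_1) : dn i (fun=> 0) x = 0.
Proof.
elim: i x => [//|i IH] x; rewrite dnS (_ : dn i _ = cst 0) ?derive_cst//.
exact/funext.
Qed.

Lemma dn_unit d i (j0 j : 'I_d) (f : 'rV[R]_1 -> R) x :
  dn i (fun x => (f x *: delta_mx 0 j0 : 'rV[R]_d) 0 j) x =
  if j == j0 then dn i f x else 0.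
Proof.
case: ifPn => [/eqP ->|jN].
  by congr (dn _ _ _); apply/funext => y; rewrite !mxE !eqxx mulr1.
rewrite -(dn0 i x); congr (dn _ _ _); apply/funext => y.
by rewrite !mxE (negbTE jN) andbF mulr0.
Qed.

Lemma derive_coord_id (x : 'rV[R]_1) c :
  'D_(delta_mx 0 0) (fun x : 'rV[R]_1 => x 0 0 - c) x = 1.
Proof.
have h : is_derive (x 0 0) (1 : R) (fun y : R => y - c) 1.
  have h1 := is_derive_id (x 0 0) (1 : R).
  by have := is_deriveB h1 (is_derive_cst c (x 0 0) (1 : R)); rewrite subr0.
by have [_] := derive_coord1 0 h.
Qed.

(** The derivative of a smooth multiple of the power with exponent [m.+1] is a
    smooth multiple of the power with exponent [m]. *)
Lemma dn_flat (D : ndom 1) g (c : R -> R) m k e :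
  (forall u, npts D u -> vmoderate rho u) -> mod c ->
  gsmooth D g -> (k < m)%N -> 0 < e <= 1 -> D e (const_mx (c e)) ->
  dn k (fun x => (x 0 0 - c e) ^+ m * g e x) (const_mx (c e)) = 0.
Proof.
move=> Dm mc sg km e01 Dc; elim: k m g sg km => [|k IH] [|m] g sg //= km.
  by rewrite /dn/= mxE subrr expr0n mul0r.
have sc : gsmooth D (fun e x => x 0 0 - c e).
  by apply: gsmooth_add; [exact: gsmooth_coord|apply: gsmooth_cst; exact: modN].
rewrite dnSr.
pose g' e x := m.+1%:R * g e x + (x 0 0 - c e) * 'D_(delta_mx 0 0) (g e) x.
have sg' : gsmooth D g'.
  apply: gsmooth_add; first by apply: gsmooth_mul => //; apply: gsmooth_cst; exact: mod_cst.
  by apply: gsmooth_mul => //; exact: gsmoothD.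
rewrite -[RHS](IH m g' sg' km).
suff H : \forall x \near const_mx (c e),
    'D_(delta_mx 0 0) (fun x : 'rV[R]_1 => (x 0 0 - c e) ^+ m.+1 * g e x) x =
    (x 0 0 - c e) ^+ m * g' e x.
  exact: (nbhs_singleton (spd_near _ H)).
apply: filterS (near_dom e01 Dc) => x Dx.
have df : derivable (fun x : 'rV[R]_1 => x 0 0 - c e) x (delta_mx 0 0).
  exact: diff_derivable (gsmooth_diff sc e01 Dx).
have dg : derivable (g e) x (delta_mx 0 0).
  exact: diff_derivable (gsmooth_diff sg e01 Dx).
rewrite (_ : (fun x => _) = (fun x : 'rV[R]_1 => x 0 0 - c e) ^+ m.+1 * g e); last first.
  by apply/funext => y; rewrite exprfctE.
rewrite (deriveM (derivableX df) dg) (deriveX _ df) derive_coord_id.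
rewrite /g' !exprfctE /= -![_ *: _]/(_ * _) exprS.
by move: (m.+1%:R : R) => M; ring.
Qed.

(** The boundary form of repeated integration by parts. *)
Fixpoint bform (i : nat) (p h : 'rV[R]_1 -> R) (x : 'rV[R]_1) : R :=
  if i is j.+1 then p x * dn j h x - bform j ('D_(delta_mx 0 0) p) h x else 0.

Lemma gsmooth_bform (D : ndom 1) i p h : gsmooth D p -> gsmooth D h ->
  gsmooth D (fun e => bform i (p e) (h e)).
Proof.
elim: i p => [|i IH] p sp sh; first by apply: gsmooth_cst; exact: mod_cst.
apply: gsmoothB; first by apply: gsmooth_mul => //; exact: gsmooth_dn.
by apply: IH => //; exact: gsmoothD.
Qed.

Lemma bform0 i p h x : (forall k, (k < i)%N -> dn k h x = 0) -> bform i p h x = 0.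
Proof.
elim: i p => [//|i IH] p h0 /=; rewrite h0// mulr0 IH ?subrr// => k ki.
by apply: h0; rewrite ltnS ltnW.
Qed.

(** All terms of the sum cancel telescopically but the first and the last. *)
Lemma derive_bform (D : ndom 1) i p h e x : gsmooth D p -> gsmooth D h ->
  0 < e <= 1 -> D e x ->
  'D_(delta_mx 0 0) (bform i (p e) (h e)) x =
  p e x * dn i (h e) x - (-1) ^+ i * dn i (p e) x * h e x.
Proof.
move=> + sh e01 Dx; elim: i p => [|i IH] p sp.
  by rewrite (derive_cst 0) expr0 mul1r subrr.
have sp' := gsmoothD 0 sp; have sn := gsmooth_dn i sh.
have d1 : derivable (p e) x (delta_mx 0 0).
  exact: diff_derivable (gsmooth_diff sp e01 Dx).
have d2 : derivable (dn i (h e)) x (delta_mx 0 0).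
  exact: diff_derivable (gsmooth_diff sn e01 Dx).
have d3 : derivable (bform i ('D_(delta_mx 0 0) (p e)) (h e)) x (delta_mx 0 0).
  exact: diff_derivable (gsmooth_diff (gsmooth_bform i sp' sh) e01 Dx).
rewrite (_ : bform i.+1 (p e) (h e) =
  (p e * dn i (h e)) - bform i ('D_(delta_mx 0 0) (p e)) (h e)); last by [].
rewrite (deriveB (derivableM d1 d2) d3) (deriveM d1 d2).
rewrite (IH (fun e => 'D_(delta_mx 0 0) (p e)))// -dnSr !dnS -![_ *: _]/(_ * _) exprS.
by ring.
Qed.

Variables (a b : R -> R) (M : nat).
Hypotheses (ma : mod a) (mb : mod b).
Hypothesis (ab : \forall e \near 0^'+, a e + rho e ^+ M <= b e).

Local Notation slab := (@slab R rho a b 1).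
Local Notation slab_le := (slab_le ab).

(** On one side of [x] the function stays at least [q] along an interval of
    length [l]. *)
Lemma increment_ge (F f : R -> R) (a0 b0 K l q x : R) :
  a0 + 2 * l <= b0 -> 0 < l -> 0 <= q -> K * l <= q -> 0 <= K ->
  (forall t, a0 <= t <= b0 -> is_derive t (1 : R) F (f t)) ->
  (forall t, a0 <= t <= b0 -> 0 <= f t) ->
  (forall s t, a0 <= s <= b0 -> a0 <= t <= b0 -> `|f s - f t| <= K * `|s - t|) ->
  a0 <= x <= b0 -> 2 * q <= f x -> q * l <= F b0 - F a0.
Proof.
move=> lab l0 q0 Kl K0 dF f0 lf /andP[ax xb] fx.
have mv s t : a0 <= s -> s <= t -> t <= b0 ->
    exists2 z, s <= z <= t & F t - F s = f z * (t - s).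
  move=> as' st tb.
  have [z zI E] : exists2 c, c \in `[s, t]%R & F t - F s = f c * (t - s).
    apply: MVT_segment => // [z|].
      rewrite in_itv/= => /andP[sz zt]; apply: dF.
      by rewrite (le_trans as' (ltW sz)) (le_trans (ltW zt) tb).
    apply: continuous_in_subspaceT => z; rewrite inE/= in_itv/= => /andP[sz zt].
    apply: differentiable_continuous; apply/derivable1_diffP.
    have zI : a0 <= z <= b0 by rewrite (le_trans as' sz) (le_trans zt tb).
    by have [] := dF z zI.
  by exists z => //; move: zI; rewrite in_itv.
have mono s t : a0 <= s -> s <= t -> t <= b0 -> F s <= F t.
  move=> as' st tb; have [z /andP[z1 z2] E] := mv s t as' st tb.
  rewrite -subr_ge0 E mulr_ge0 ?subr_ge0//; apply: f0.
  by rewrite (le_trans as' z1) (le_trans z2 tb).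
have [y [ya yb yx]] : exists y, [/\ a0 <= y, y + l <= b0 & y <= x <= y + l].
  have [h|h] := leP (x + l) b0; first by exists x; split=> //; apply/andP; split; lra.
  by exists (x - l); split; lra.
have [z zI E] : exists2 z, y <= z <= y + l & F (y + l) - F y = f z * (y + l - y).
  by apply: mv => //; lra.
have fz : q <= f z.
  have zx : `|z - x| <= l.
    by move: zI yx => /andP[? ?] /andP[? ?]; rewrite ler_norml; lra.
  have zI' : a0 <= z <= b0 by move: zI => /andP[? ?]; lra.
  have xI : a0 <= x <= b0 by lra.
  have := lf z x zI' xI; rewrite ler_norml => /andP[h _].
  have := ler_wpM2l K0 zx; lra.
have := mono a0 y; have := mono (y + l) b0.
have E' : F (y + l) - F y = f z * l by rewrite E; ring.
have := ler_wpM2r (ltW l0) fz.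
move=> h1 h2 h3; have {}h2 := h2 (ltac:(lra)) yb (lexx _).
have {}h3 := h3 (lexx _) ya (ltac:(lra)); lra.
Qed.

(** A nonnegative net that is at least [rho ^+ n] at a point is at least half of it
    at all points at distance at most [rho ^+ S], for [S] large, and its integral
    is not negligible. *)
Lemma ngl_of_riemann (D : ndom 1) g : npts D = pts (slab 0) -> gsmooth D g ->
  (\forall e \near 0^'+, forall t, a e <= t <= b e -> 0 <= g e (const_mx t)) ->
  ngl (fun e => riemann (fun t => g e (const_mx t)) (a e) (b e) (nodes rho e)) ->
  forall n, \forall e \near 0^'+, forall t, a e <= t <= b e ->
    g e (const_mx t) <= rho e ^+ n.
Proof.
move=> DX sg g0 nr n.
have [N hN] := slab_margin ma mb ab DX.
have [K hK] := slab_lipschitz ma mb ab DX sg.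
(* a primitive of the net on the interval, beyond which the net is continued by its
   values at the endpoints *)
have /choice[F FP] e : exists F : R -> R,
    0 < e <= 1 -> a e <= b e -> (forall t, a e <= t <= b e -> D e (const_mx t)) ->
    forall t, a e <= t <= b e -> is_derive t (1 : R) F (g e (const_mx t)).
  have [[e01 [abe Dt]]|nh] := pselect (0 < e <= 1 /\ a e <= b e /\
      (forall t, a e <= t <= b e -> D e (const_mx t))); last first.
    by exists id => e01 abe Dt; case: nh.
  pose f t := g e (const_mx (clamp (a e) (b e) t)).
  have cf : continuous f.
    move=> t; have := @is_derive_const _ (g e) (clamp (a e) (b e) t).
    have Dc := Dt _ (clamp_itv t abe).
    move=> /(_ (gsmooth_diff sg e01 Dc)) [d _].
    have c1 : {for clamp (a e) (b e) t, continuous (fun t : R => g e (const_mx t))}.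
      by apply: differentiable_continuous; exact/derivable1_diffP.
    apply: (@continuous_comp _ _ _ (clamp (a e) (b e)) (fun t : R => g e (const_mx t))) => //.
    rewrite /clamp; apply: (@continuous_min _ _ (fun t => Num.max (a e) t) (fun=> b e)).
      by apply: (@continuous_max _ _ (fun=> a e) id); [exact: cst_continuous|].
    exact: cst_continuous.
  have AB : a e - 1 < b e + 1 by lra.
  have [F [dF _]] := oint_primitive AB cf.
  exists F => _ _ _ t tI; have := dF t; rewrite /f clamp_id//; apply.
  by move: tI => /andP[? ?]; lra.
have Dab : \forall e \near 0^'+, forall t, a e <= t <= b e -> D e (const_mx t).
  apply: filterS2 hN (near_gauge_mono rho) => e {}hN [_ _ rk _] t tI.
  by apply: hN; rewrite mxE; have := rk N; lra.
have dF : \forall e \near 0^'+, forall t, a e <= t <= b e ->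
    is_derive t (1 : R) (F e) (g e (const_mx t)).
  by apply: filterS3 near_unit slab_le Dab => e; exact: FP.
have nF := nglD (riemann_net ma mb ab DX sg dF) nr.
(* two intervals of length [rho ^+ S] fit into the given one, and the net varies
   on each of them by at most half of [rho ^+ n] *)
pose S := (K + (n + (M + 3)))%N.
have SM : (M.+1 <= S)%N by rewrite /S; lia.
have M3 : (1 <= M + 3)%N by lia.
apply: filterS3 (filterI (nF (n + S).+2) dF) (filterI g0 (filterI hK ab))
  (filterI (near_gauge_mono rho) (near_gaugeM rho 4)).
move=> e [{}nF {}dF] [{}g0 [{}hK ab']] [[r0 r1 rk rl] r4] t tI.
rewrite leNgt; apply/negP => gt.
have rS := rk S; have rn := rk n; have rM := rk M.
have e1 : rho e ^+ S <= rho e * rho e ^+ M.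
  by rewrite -exprS; exact: rl.
have e2 : rho e ^- K * rho e ^+ S <= 2^-1 * rho e ^+ n.
  rewrite /S exprD mulKf ?gt_eqF// exprD mulrC ler_wpM2r ?(ltW rn)//.
  by apply: (le_trans (rl _ _ M3)); rewrite expr1; lra.
have := @increment_ge (F e) (fun t => g e (const_mx t)) (a e) (b e) (rho e ^- K)
  (rho e ^+ S) (2^-1 * rho e ^+ n) t.
move=> /(_ _ rS _ e2 _ dF g0 hK tI _) H.
have : 2^-1 * rho e ^+ n * rho e ^+ S <= F e (b e) - F e (a e).
  apply: H.
  - nra.
  - by rewrite mulr_ge0// ltW.
  - by rewrite invr_ge0 ltW.
  - by rewrite mulrA divff// mul1r ltW.
move: nF; rewrite subrK => /(le_trans (ler_norm _)) h1 /le_trans/(_ h1).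
rewrite 2!exprS exprD; move: (mulr_gt0 rn rS); rewrite -[in X in _ -> X]mulrA.
move: (rho e ^+ n * rho e ^+ S) => q q0.
have h4 := ler_wpM2r (ltW q0) r4.
have h5 : rho e * (rho e * q) <= rho e * q.
  by rewrite ler_piMl// mulr_ge0 ?(ltW r0)// ltW.
lra.
Qed.

(** The fundamental lemma, with the weight [((t - a) * (b - t)) ^+ m]: the
    function is first controlled away from the endpoints, then everywhere by
    its Lipschitz constant. *)
Lemma fundamental_lemma (D : ndom 1) g m : npts D = pts (slab 0) -> gsmooth D g ->
  ngl (fun e => riemann (fun t => ((t - a e) * (b e - t)) ^+ m *
     g e (const_mx t) ^+ 2) (a e) (b e) (nodes rho e)) ->
  forall n, \forall e \near 0^'+, forall t, a e <= t <= b e ->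
    `|g e (const_mx t)| <= rho e ^+ n.
Proof.
move=> DX sg nr n.
have Dm u : npts D u -> vmoderate rho u by rewrite DX => -[].
pose w e (x : 'rV[R]_1) := ((x 0 0 - a e) * (b e - x 0 0)) ^+ m * g e x ^+ 2.
have sw : gsmooth D w.
  apply: gsmooth_mul; last exact: gsmoothX.
  apply: gsmoothX; apply: gsmooth_mul.
    by apply: gsmooth_add; [exact: gsmooth_coord|apply: gsmooth_cst; exact: modN].
  apply: gsmoothB; last exact: gsmooth_coord.
  exact: gsmooth_cst.
have nw : ngl (fun e => riemann (fun t => w e (const_mx t)) (a e) (b e) (nodes rho e)).
  apply: ngl_ev nr; apply: filterS slab_le => e ab'; apply: eq_riemann => // t _.
  by rewrite /w mxE.
have w0 : \forall e \near 0^'+, forall t, a e <= t <= b e -> 0 <= w e (const_mx t).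
  apply: nearW => e t /andP[ta tb]; rewrite /w mxE mulr_ge0 ?sqr_ge0//.
  by rewrite exprn_ge0// mulr_ge0 ?subr_ge0.
have h := ngl_of_riemann DX sw w0 nw.
have [K hK] := slab_lipschitz ma mb ab DX sg.
(* margins of width [rho ^+ P] fit into the interval, and the net varies there by
   at most [rho ^+ n.+1] *)
pose P := (K + (n.+1 + M.+1))%N.
have P1 : (M.+1 <= P)%N by rewrite /P; lia.
apply: filterS3 (filterI (h (P * m + (P * m + (n.+1 + n.+1)))%N) hK) ab
  (filterI (near_gauge_mono rho) (near_gaugeM rho 2)).
move=> e [{}h {}hK] ab' [[r0 r1 rk rl] r2] t tI.
have rP := rk P.
have PM : rho e ^+ P <= 2^-1 * rho e ^+ M.
  apply: (@le_trans _ _ (rho e * rho e ^+ M)).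
    by rewrite -exprS; exact: rl.
  by rewrite ler_wpM2r ?(ltW (rk _))//; lra.
have ab2 : a e + rho e ^+ P <= b e - rho e ^+ P by lra.
pose t' := clamp (a e + rho e ^+ P) (b e - rho e ^+ P) t.
have /andP[t1 t2] : a e + rho e ^+ P <= t' <= b e - rho e ^+ P by exact: clamp_itv.
have t'I : a e <= t' <= b e by apply/andP; split; lra.
have tt : `|t - t'| <= rho e ^+ P.
  by move: tI => /andP[? ?]; apply: clamp_dist => //; [exact: ltW|lra|lra].
have g' : `|g e (const_mx t')| <= rho e ^+ n.+1.
  have := h t' t'I; rewrite /w mxE exprD exprD => hw.
  have wl : rho e ^+ (P * m) * rho e ^+ (P * m) <= ((t' - a e) * (b e - t')) ^+ m.
    have p0 : 0 <= rho e ^+ P by exact: ltW.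
    have u1 : rho e ^+ P <= t' - a e by lra.
    have u2 : rho e ^+ P <= b e - t' by lra.
    have u1' : 0 <= t' - a e by lra.
    have u2' : 0 <= b e - t' by lra.
    rewrite exprMn exprM; apply: ler_pM;
      by [apply: exprn_ge0 | apply: lerXn2r].
  have w0' : 0 < rho e ^+ (P * m) * rho e ^+ (P * m) by rewrite mulr_gt0.
  have := le_trans (ler_wpM2r (sqr_ge0 (g e (const_mx t'))) wl) hw.
  rewrite mulrA (ler_pM2l w0') exprD -expr2 => hg.
  rewrite -ler_sqr ?nnegrE ?normr_ge0 ?(ltW (rk _))//.
  by rewrite real_normK ?num_real.
have lt := hK t t' tI t'I.
have l2 : `|g e (const_mx t) - g e (const_mx t')| <= rho e ^+ n.+1.
  apply: le_trans lt _; apply: (@le_trans _ _ (rho e ^- K * rho e ^+ P)).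
    by rewrite ler_wpM2l// invr_ge0 ltW.
  by rewrite /P exprD mulKf ?gt_eqF//; apply: rl; rewrite leq_addr.
have -> : g e (const_mx t) = (g e (const_mx t) - g e (const_mx t')) + g e (const_mx t').
  by rewrite subrK.
apply: le_trans (ler_normD _ _) _.
have rn := rk n; rewrite exprS in g' l2.
have := ler_wpM2r (ltW rn) r2; lra.
Qed.

End CalculusOfVariations.

(** * Jets and the first variation *)

Section Jets.
Context {R : realType}.
Variable rho : gauge R.

Local Notation Rt := (Rt rho).
Local Notation mod := (moderate_net rho).
Local Notation ndom := (@ndom R).
Local Notation gsmooth := (gsmooth rho).

Variables (a b : R -> R) (M : nat).
Hypotheses (ma : mod a) (mb : mod b).
Hypothesis (ab : \forall e \near 0^'+, a e + rho e ^+ M <= b e).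

Local Notation t1 := (cls rho a).
Local Notation t2 := (cls rho b).
Local Notation slab1 := (@slab R rho a b 1 0).

Lemma setT_dense n : interior_dense (setT : set 'rV[Rt]_n).
Proof.
move=> u N [mu _]; exists u; split=> //.
  by exists (cls rho (fun e => rho e ^+ 0)); [exact: glt0_gauge|].
by apply: filterS (near_gauge_mono rho) => e [_ _ rk _]; rewrite subrr normr0 ltW.
Qed.

Lemma const_mx_coord (T : Type) (x : 'rV[T]_1) : const_mx (x 0 0) = x.
Proof. by apply/rowP => j; rewrite mxE (ord1 j). Qed.

(** The derivatives of a curve are computed by those of any net that defines
    it, at the endpoints of the interval as well. *)
Lemma cderivE k (D : ndom 1) (c : Rt -> 'rV[Rt]_k)
    (ce : R -> 'rV[R]_1 -> 'rV[R]_k) i j u :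
  npts D = pts slab1 -> (forall j, gsmooth D (fun e x => ce e x 0 j)) ->
  (forall u, pts slab1 u -> c (vcls rho u 0 0) = vcls rho (fun e => ce e (u e))) ->
  pts slab1 u ->
  cderiv (gitv t1 t2) i c (vcls rho u 0 0) 0 j =
  cls rho (fun e => dn i (fun x => ce e x 0 j) (u e)).
Proof.
move=> DX sc fc Pu.
have cN : gsf_net slab1 (curve c) D ce.
  by apply/gsf_netP; exists D; split=> // v Pv; exact: fc.
rewrite /cderiv const_mx_coord.
rewrite (gpartialE (nseq i 0) (slab_dense ma mb ab (i0 := 0)) cN Pu) mxE.
have Du : \forall e \near 0^'+, D e (u e) by apply: npts_in; rewrite DX.
by apply: cls_ev; apply: filterS2 near_unit Du => e e01 {}Du; exact: (pd_spd _ j sc).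
Qed.

Variables (d m : nat).
Local Notation n := (1 + m.+1 * d)%N.
Local Notation slabL := (@slab R rho a b n (lshift (m.+1 * d) 0)).

Lemma lag_dom_slab : lag_dom t1 t2 d m = slabL.
Proof.
by apply/funext => x; apply/propext; rewrite /lag_dom /slab /= mxE.
Qed.

Definition jet_point p (s : 'rV[R]_p -> R) (c : 'I_m.+1 -> 'I_d -> 'rV[R]_p -> R)
    (x : 'rV[R]_p) : 'rV[R]_n :=
  row_mx (const_mx (s x)) (mxvec (\matrix_(i, j) c i j x)).

Definition jet_idx (i : 'I_m.+1) (j : 'I_d) : 'I_n := rshift 1 (mxvec_index i j).

Lemma jet_pointt p s (c : 'I_m.+1 -> 'I_d -> 'rV[R]_p -> R) x :
  jet_point s c x 0 (lshift (m.+1 * d) 0) = s x.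
Proof. by rewrite /jet_point row_mxEl mxE. Qed.

Lemma jet_pointc p s (c : 'I_m.+1 -> 'I_d -> 'rV[R]_p -> R) x i j :
  jet_point s c x 0 (jet_idx i j) = c i j x.
Proof. by rewrite /jet_point /jet_idx row_mxEr mxvecE mxE. Qed.

Lemma jet_idx_ind (P : 'I_n -> Prop) : P (lshift (m.+1 * d) 0) ->
  (forall i j, P (jet_idx i j)) -> forall k, P k.
Proof.
move=> Pt Pc k; have [j ->|j ->] := split_ordP k; first by rewrite (ord1 j).
by case/mxvec_indexP: j => i j; exact: Pc.
Qed.

Lemma jet_sum (F : 'I_n -> R) :
  \sum_k F k = F (lshift (m.+1 * d) 0) + \sum_i \sum_j F (jet_idx i j).
Proof.
rewrite big_split_ord /= big_ord1; congr (_ + _).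
rewrite (pair_bigA _ (fun i j => F (jet_idx i j))).
by rewrite (reindex _ (curry_mxvec_bij _ _)); apply: eq_bigr => -[].
Qed.

Lemma jet_point_gsmooth p (D : ndom p) s c :
  gsmooth D s -> (forall i j, gsmooth D (fun e => c e i j)) ->
  forall k, gsmooth D (fun e x => jet_point (s e) (c e) x 0 k).
Proof.
move=> ss sc; apply: jet_idx_ind => [|i j].
  by apply: gsmooth_ext ss => e x _ _; rewrite jet_pointt.
by apply: gsmooth_ext (sc i j) => e x _ _; rewrite jet_pointc.
Qed.

Lemma jet_point_pts p (D : ndom p) s c u :
  gsmooth D s -> (forall i j, gsmooth D (fun e => c e i j)) -> npts D u ->
  gitv t1 t2 (cls rho (fun e => s e (u e))) ->
  pts slabL (fun e => jet_point (s e) (c e) (u e)).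
Proof.
move=> ss sc Du sI; split.
  by move=> k; exact: (gsmooth_mod (jet_point_gsmooth ss sc k) Du).
rewrite /slab/= mxE.
rewrite (_ : cls rho (fun e => jet_point (s e) (c e) (u e) 0 (lshift (m.+1 * d) 0)) =
  cls rho (fun e => s e (u e)))//.
by apply: cls_ev; apply: nearW => e; rewrite jet_pointt.
Qed.

Lemma jetE (D : ndom 1) (q : Rt -> 'rV[Rt]_d) (qe : R -> 'rV[R]_1 -> 'rV[R]_d) u :
  npts D = pts slab1 -> (forall j, gsmooth D (fun e x => qe e x 0 j)) ->
  (forall u, pts slab1 u -> q (vcls rho u 0 0) = vcls rho (fun e => qe e (u e))) ->
  pts slab1 u ->
  jet t1 t2 m q (vcls rho u 0 0) = vcls rho (fun e =>
    jet_point (fun x => x 0 0) (fun i j => dn i (fun x => qe e x 0 j)) (u e)).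
Proof.
move=> DX sq fq Pu; apply/rowP; apply: jet_idx_ind => [|i j].
  rewrite /jet row_mxEl !mxE; apply: cls_ev; apply: nearW => e.
  by rewrite jet_pointt.
rewrite /jet /jet_idx row_mxEr mxvecE mxE (cderivE i j DX sq fq Pu) mxE.
by apply: cls_ev; apply: nearW => e; rewrite jet_pointc.
Qed.

Variables (DL : ndom n) (L : 'rV[Rt]_n -> Rt) (l : R -> 'rV[R]_n -> R).
Hypotheses (DLX : npts DL = pts slabL) (sl : gsmooth DL l).
Hypothesis (fL : forall v, pts slabL v -> L (vcls rho v) = cls rho (fun e => l e (v e))).

Lemma grad_lagE i j v : pts slabL v ->
  grad_lag t1 t2 L i (vcls rho v) 0 j =
  cls rho (fun e => 'D_(delta_mx 0 (jet_idx i j)) (l e) (v e)).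
Proof.
move=> Pv; rewrite mxE lag_dom_slab.
pose Le e x : 'rV[R]_1 := const_mx (l e x).
have sL j' : gsmooth DL (fun e x => Le e x 0 j').
  by apply: gsmooth_ext sl => e x _ _; rewrite mxE.
have LN : gsf_net slabL (scalarf L) DL Le.
  apply/gsf_netP; exists DL; split=> // w Pw.
  apply/rowP => j'; rewrite !mxE fL//; apply: cls_ev; apply: nearW => e.
  by rewrite mxE.
rewrite (gpartialE [:: jet_idx i j] (@slab_dense _ _ _ _ _ ma mb ab _ _) LN Pv) mxE.
have Dv : \forall e \near 0^'+, DL e (v e) by apply: npts_in; rewrite DLX.
apply: cls_ev; apply: filterS2 near_unit Dv => e e01 {}Dv.
rewrite (pd_spd [:: jet_idx i j] 0 sL e01 Dv) /=.
by congr ('D_ _ _ _); apply/funext => y; rewrite mxE.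
Qed.

Variables (D : ndom 1) (q h : Rt -> 'rV[Rt]_d).
Variables (qe he : R -> 'rV[R]_1 -> 'rV[R]_d).
Hypothesis (DX : npts D = pts slab1).
Hypothesis (sq : forall j, gsmooth D (fun e x => qe e x 0 j)).
Hypothesis (sh : forall j, gsmooth D (fun e x => he e x 0 j)).
Hypothesis (fq : forall u, pts slab1 u ->
  q (vcls rho u 0 0) = vcls rho (fun e => qe e (u e))).
Hypothesis (fh : forall u, pts slab1 u ->
  h (vcls rho u 0 0) = vcls rho (fun e => he e (u e))).

Definition qjet e : 'rV[R]_1 -> 'rV[R]_n :=
  jet_point (fun x => x 0 0) (fun i j => dn i (fun x => qe e x 0 j)).

(** The jet of [q + s h] at time [t], as a function of [y = (s, t)]. *)
Definition variation_jet e : 'rV[R]_2 -> 'rV[R]_n :=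
  jet_point (fun y => y 0 1) (fun i j y =>
    dn i (fun x => qe e x 0 j) (const_mx (y 0 1)) +
    y 0 0 * dn i (fun x => he e x 0 j) (const_mx (y 0 1))).

Local Notation X2 := (@slab R rho a b 2 1).

(** The jet of [q + s h] depends affinely on [s]. *)
Lemma derive_affine p (f : 'rV[R]_p -> R) x v B :
  (forall s : R, f (s *: v + x) = f x + s * B) -> 'D_v f x = B.
Proof.
move=> fE; apply: cvg_lim => //; apply: cvg_near_cst.
have : \forall s \near (0 : R)^', s != 0 by exact: nbhs_dnbhs_neq.
apply: filterS => s s0 /=; rewrite fE addrC addKr.
by rewrite -[_ *: _]/(_ * _) mulKf.
Qed.

(** The chain rule for the Lagrangian along the variation [q + s h] at
    [s = 0], where the time coordinate does not depend on [s]. *)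
Lemma variation_lagrangian : exists D2 : ndom 2, [/\ npts D2 = pts X2,
  gsmooth D2 (fun e y => l e (variation_jet e y))
  & forall e t, 0 < e <= 1 -> D2 e (pair2 0 t) ->
    'D_(delta_mx 0 0) (fun y => l e (variation_jet e y)) (pair2 0 t) =
    \sum_i \sum_j 'D_(delta_mx 0 (jet_idx i j)) (l e) (qjet e (const_mx t)) *
      dn i (fun x => he e x 0 j) (const_mx t)].
Proof.
have oT (e : R) : 0 < e <= 1 -> open [set: 'rV[R]_2] by move=> _; exact: openT.
have iT u : pts X2 u -> \forall e \near (0 : R)^'+, [set: 'rV[R]_2] (u e).
  by move=> _; exact: nearW.
pose B2 := NDom oT iT.
have mB u : npts B2 u -> vmoderate rho u by case.
have [|u Pu|D0 [D0X D0E D0D D0B]] := @comp_dom _ rho _ _ B2 D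
    (fun e y => const_mx (y 0 1)).
- move=> j; apply: gsmooth_ext (gsmooth_coord 1 mB) => e x _ _.
  by rewrite mxE.
- rewrite DX; case: Pu => mu uI; split.
    by move=> i; apply: mod_ev (mu 1); apply: nearW => e; rewrite mxE.
  move: uI; rewrite /slab/= !mxE => uI.
  rewrite (_ : cls rho (fun e => const_mx (u e 0 1) 0 0) = cls rho (fun e => u e 0 1))//.
  by apply: cls_ev; apply: nearW => e; rewrite mxE.
have c0 : gsmooth D0 (fun _ y => y 0 0) by apply: D0B; exact: gsmooth_coord.
have c1 : gsmooth D0 (fun _ y => y 0 1) by apply: D0B; exact: gsmooth_coord.
pose c e (i : 'I_m.+1) (j : 'I_d) (y : 'rV[R]_2) :=
  dn i (fun x => qe e x 0 j) (const_mx (y 0 1)) +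
    y 0 0 * dn i (fun x => he e x 0 j) (const_mx (y 0 1)).
have sc i j : gsmooth D0 (fun e => c e i j).
  apply: gsmooth_add; first exact: (D0D _ (gsmooth_dn i (sq j))).
  by apply: gsmooth_mul => //; exact: (D0D _ (gsmooth_dn i (sh j))).
have sj := jet_point_gsmooth c1 sc.
have [|u Pu|D2 [D2X D2E D2D _]] := @comp_dom _ rho _ _ D0 DL variation_jet.
- exact: sj.
- rewrite DLX; apply: (jet_point_pts c1 sc Pu).
  by move: Pu; rewrite D0X => -[mu]; rewrite /slab/= mxE.
exists D2; split; [by rewrite D2X D0X|exact: D2D|].
move=> e t e01 D2t; have [D0t DLt] := (D2E _ _).1 D2t.
have dj : differentiable (variation_jet e) (pair2 0 t).
  by apply: differentiable_row => k; exact: (gsmooth_diff (sj k)).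
rewrite (derive_comp_row _ dj (gsmooth_diff sl e01 DLt)) jet_sum.
have E : variation_jet e (pair2 0 t) = qjet e (const_mx t).
  apply/rowP; apply: jet_idx_ind => [|i j].
    by rewrite !jet_pointt !mxE.
  by rewrite !jet_pointc pair2_1 pair2_0 mul0r addr0.
rewrite E (derive_affine (B := 0)) ?mul0r ?add0r; last first.
  by move=> s; rewrite !jet_pointt !mxE /=; ring.
apply: eq_bigr => i _; apply: eq_bigr => j _; rewrite mulrC; congr (_ * _).
apply: derive_affine => s; rewrite !jet_pointc !mxE /=.
by rewrite !mulr0 !add0r mulr1 addr0 mul0r addr0.
Qed.

Lemma actionE s : mod s ->
  action t1 t2 L (fun t => q t + cls rho s *: h t) =
  cls rho (fun e => riemann (fun t => l e (variation_jet e (pair2 (s e) t)))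
    (a e) (b e) (nodes rho e)).
Proof.
move=> ms; have [D2 [D2X sG _]] := variation_lagrangian.
have Dm u : npts D u -> vmoderate rho u by rewrite DX => -[].
pose qse e x := qe e x + s e *: he e x.
have sqs j : gsmooth D (fun e x => qse e x 0 j).
  apply: gsmooth_ext (gsmooth_add (sq j) (gsmooth_mul (gsmooth_cst D ms) (sh j))).
  by move=> e x _ _; rewrite !mxE.
have fqs u : pts slab1 u ->
    q (vcls rho u 0 0) + cls rho s *: h (vcls rho u 0 0) =
    vcls rho (fun e => qse e (u e)).
  move=> Pu; have Du : npts D u by rewrite DX.
  rewrite (fq Pu) (fh Pu); apply/rowP => j; rewrite !mxE.
  have mq := gsmooth_mod (sq j) Du; have mh := gsmooth_mod (sh j) Du.
  rewrite -(clsM ms mh) -(clsD mq (modM ms mh)).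
  by apply: cls_ev; apply: nearW => e; rewrite !mxE.
have [||D1 [D1X D1E D1D D1B]] :=
    @comp_dom _ rho _ _ D D2 (fun e x => pair2 (s e) (x 0 0)).
- move=> j; have [->|jN] := eqVneq j 0.
    by apply: gsmooth_ext (gsmooth_cst D ms) => e x _ _; rewrite pair2_0.
  apply: gsmooth_ext (gsmooth_coord 0 Dm) => e x _ _.
  by rewrite mxE (negbTE jN).
- move=> u Du; rewrite D2X; move: Du; rewrite DX => -[mu]; rewrite /slab/= mxE => uI.
  split; last first.
    rewrite /slab/= mxE.
    rewrite (_ : cls rho (fun e => pair2 (s e) (u e 0 0) 0 1) =
      cls rho (fun e => u e 0 0))//.
    by apply: cls_ev; apply: nearW => e; rewrite pair2_1.
  move=> j; have [->|jN] := eqVneq j 0.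
    by apply: mod_ev ms; apply: nearW => e; rewrite pair2_0.
  by apply: mod_ev (mu 0); apply: nearW => e; rewrite mxE (negbTE jN).
pose g e (x : 'rV[R]_1) : 'rV[R]_1 :=
  const_mx (l e (variation_jet e (pair2 (s e) (x 0 0)))).
have gN : gsf_net slab1
    (curve (scalarc (fun t => L (jet t1 t2 m (fun t => q t + cls rho s *: h t) t))))
    D1 g.
  apply/gsf_netP; exists D1; split=> //.
  - by rewrite D1X.
  - by move=> j; apply: gsmooth_ext (D1D _ sG) => e x _ _; rewrite mxE.
  move=> u Pu; have Du : npts D u by rewrite DX.
  apply/rowP => j; rewrite !mxE.
  have c0 := gsmooth_coord 0 Dm.
  have Pv : pts slabL (fun e => jet_point (fun x => x 0 0)
      (fun i j => dn i (fun x => qse e x 0 j)) (u e)).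
    apply: (jet_point_pts c0 (fun i j => gsmooth_dn i (sqs j)) Du).
    by case: Pu => _; rewrite /slab/= mxE.
  have := jetE (q := fun t => q t + cls rho s *: h t) DX sqs fqs Pu.
  rewrite mxE => ->.
  rewrite (fL Pv); apply: cls_ev; apply: filterS2 near_unit (npts_in Du) => e e01 De.
  rewrite mxE; congr (l e _); apply/rowP; apply: jet_idx_ind => [|i k].
    by rewrite !jet_pointt pair2_1.
  rewrite !jet_pointc pair2_0 pair2_1 const_mx_coord.
  rewrite /dn -(spd_lin s (nseq i 0) (sq k) (sh k) e01 De).
  by congr (spd _ _ _); apply/funext => y; rewrite !mxE.
rewrite /action (gintE ma mb ab gN); apply: cls_ev; apply: nearW => e.
by congr (riemann _ _ _ _); apply/funext => t; rewrite !mxE.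
Qed.

(** By [actionE] the action along the variation is a Riemann sum, whose
    derivative in the parameter is taken term by term. *)
Lemma first_variationE : first_variation t1 t2 L q h =
  cls rho (fun e => riemann (fun t => \sum_i \sum_j
      'D_(delta_mx 0 (jet_idx i j)) (l e) (qjet e (const_mx t)) *
      dn i (fun x => he e x 0 j) (const_mx t)) (a e) (b e) (nodes rho e)).
Proof.
have [D2 [D2X sG dG]] := variation_lagrangian.
have [DF [DFX sF dF]] := riemann_param ma mb ab D2X sG.
pose FG w e (x : 'rV[R]_1) := riemann (fun t => spd w
  (fun y => l e (variation_jet e y)) (pair2 (x 0 0) t)) (a e) (b e) (nodes rho e).
have {}sF : gsmooth DF (FG [::]) := sF.
have {}dF w e x : 0 < e <= 1 -> DF e x ->
    spd w (FG [::] e) x = FG (nseq (size w) 0) e x := dF w e x.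
pose F s := action t1 t2 L (fun t => q t + s *: h t).
pose Fe e x : 'rV[R]_1 := const_mx (FG [::] e x).
have sFe j : gsmooth DF (fun e x => Fe e x 0 j).
  by apply: gsmooth_ext sF => e x _ _; rewrite mxE.
have FN : gsf_net (@line _ rho setT) (curve (scalarc F)) DF Fe.
  apply/gsf_netP; exists DF; split=> // u [mu _]; apply/rowP => j.
  rewrite !mxE /F actionE; last exact: mu.
  by apply: cls_ev; apply: nearW => e; rewrite mxE.
pose z (_ : R) : 'rV[R]_1 := const_mx 0.
have Pz : pts (@line _ rho setT) z.
  split=> // j; apply: mod_ev (mod_cst rho 0); apply: nearW => e.
  by rewrite mxE.
have zE : const_mx 0 = vcls rho z.
  apply/rowP => j; rewrite !mxE -(cls0 rho); apply: cls_ev; apply: nearW => e.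
  by rewrite mxE.
rewrite /first_variation /cderiv zE.
rewrite (gpartialE [:: 0] (@setT_dense 1) FN Pz) mxE.
have Dz : \forall e \near 0^'+, DF e (z e) by apply: npts_in; rewrite DFX.
have D20 : \forall e \near 0^'+, forall t, a e <= t <= b e -> D2 e (pair2 0 t).
  apply: (real_selection_prop (P := fun e t => D2 e (pair2 0 t)) (slab_le ab)).
  move=> t tI; apply: (npts_in (u := fun e => pair2 0 (t e))); rewrite D2X.
  by apply: pts_pair2 => //; exact: mod_cst.
apply: cls_ev; apply: filterS3 (filterI near_unit (slab_le ab)) Dz D20.
move=> e [e01 ab'] {}Dz {}D20.
rewrite (pd_spd [:: 0] 0 sFe e01 Dz).
rewrite (_ : (fun y => Fe e y 0 0) = FG [::] e); last first.
  by apply/funext => y; rewrite mxE.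
rewrite (dF [:: 0] e _ e01 Dz) /FG.
apply: eq_riemann => // t tI; rewrite mxE; exact: (dG e t e01 (D20 t tI)).
Qed.

End Jets.

(** * The Euler-Lagrange equations *)

Section EulerLagrange.
Context {R : realType}.
Variable rho : gauge R.

Local Notation Rt := (Rt rho).
Local Notation mod := (moderate_net rho).
Local Notation ngl := (negligible_net rho).
Local Notation ndom := (@ndom R).
Local Notation gsmooth := (gsmooth rho).

Variables (a b : R -> R) (M : nat).
Hypotheses (ma : mod a) (mb : mod b).
Hypothesis (ab : \forall e \near 0^'+, a e + rho e ^+ M <= b e).

Local Notation t1 := (cls rho a).
Local Notation t2 := (cls rho b).
Local Notation slab1 := (@slab R rho a b 1 0).

Lemma dom_itv (D : ndom 1) : npts D = pts slab1 ->
  \forall e \near 0^'+, forall t, a e <= t <= b e -> D e (const_mx t).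
Proof.
move=> DX; apply: (real_selection_prop (P := fun e t => D e (const_mx t)) (slab_le ab)).
move=> t tI; apply: (npts_in (u := fun e => const_mx (t e))); rewrite DX.
exact: (pts_const ma mb).
Qed.

Section ByParts.
Variables (m : nat) (D : ndom 1).
Hypothesis (DX : npts D = pts slab1).

Definition euler_sum (p : 'I_m.+1 -> 'rV[R]_1 -> R) (x : 'rV[R]_1) : R :=
  \sum_(i < m.+1) (-1) ^+ i * dn i (p i) x.

Lemma gsmooth_euler_sum p : (forall i, gsmooth D (p i)) ->
  gsmooth D (fun e => euler_sum (fun i => p i e)).
Proof.
move=> sp; apply: gsmooth_sum => i _; apply: gsmooth_mul.
  by apply: gsmooth_cst; exact: mod_cst.
exact: gsmooth_dn.
Qed.

(** Integration by parts: the difference of the integrands is the derivative of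
    a sum of boundary forms, which vanishes at both endpoints. *)
Lemma parts_net (p : 'I_m.+1 -> R -> 'rV[R]_1 -> R) f :
  (forall i, gsmooth D (p i)) -> gsmooth D f ->
  (\forall e \near 0^'+, forall k, (k < m)%N ->
     dn k (f e) (const_mx (a e)) = 0 /\ dn k (f e) (const_mx (b e)) = 0) ->
  ngl (fun e => riemann (fun t =>
      \sum_(i < m.+1) p i e (const_mx t) * dn i (f e) (const_mx t)) (a e) (b e) (nodes rho e) -
    riemann (fun t => euler_sum (fun i => p i e) (const_mx t) * f e (const_mx t))
      (a e) (b e) (nodes rho e)).
Proof.
move=> sp sf f0.
pose B e x := \sum_(i < m.+1) bform i (p i e) (f e) x.
pose g e x := \sum_(i < m.+1) p i e x * dn i (f e) x -
  euler_sum (fun i => p i e) x * f e x.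
have sB : gsmooth D B by apply: gsmooth_sum => i _; exact: gsmooth_bform.
have sg : gsmooth D g.
  apply: gsmoothB; last by apply: gsmooth_mul => //; exact: gsmooth_euler_sum.
  by apply: gsmooth_sum => i _; apply: gsmooth_mul => //; exact: gsmooth_dn.
have dB : \forall e \near 0^'+, forall t, a e <= t <= b e ->
    is_derive t (1 : R) (fun t => B e (const_mx t)) (g e (const_mx t)).
  apply: filterS2 near_unit (dom_itv DX) => e e01 De t tI.
  have Dt := De t tI.
  have := is_derive_const (gsmooth_diff sB e01 Dt).
  suff -> : 'D_(delta_mx 0 0) (B e) (const_mx t) = g e (const_mx t) by [].
  rewrite -[LHS]/(spd [:: 0] (B e) (const_mx t)).
  rewrite (spd_sum (index_enum _) xpredT [:: 0]
    (fun i : 'I_m.+1 => gsmooth_bform i (sp i) sf) e01 Dt).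
  rewrite /g /euler_sum mulr_suml -sumrB; apply: eq_bigr => i _ /=.
  exact: (derive_bform i (sp i) sf e01 Dt).
have nB := riemann_net ma mb ab DX sg dB.
apply: ngl_ev (nglN nB); apply: filterS f0 => e f0.
have B0 x : (forall k, (k < m)%N -> dn k (f e) x = 0) -> B e x = 0.
  move=> x0; apply: big1 => i _; apply: bform0 => k ki; apply: x0.
  exact: (leq_trans ki (ltnSE (ltn_ord i))).
rewrite !B0; [|by move=> k /f0[]|by move=> k /f0[]].
by rewrite subr0 sub0r opprK riemannB.
Qed.

End ByParts.

Variables (d m : nat).
Local Notation n := (1 + m.+1 * d)%N.
Local Notation slabL := (@slab R rho a b n (lshift (m.+1 * d) 0)).

(** The weight makes a curve admissible whatever smooth net it multiplies. *)
Lemma test_curve (D : ndom 1) g (j0 : 'I_d) : npts D = pts slab1 -> gsmooth D g ->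
  let f e (x : 'rV[R]_1) := ((x 0 0 - a e) * (b e - x 0 0)) ^+ m * g e x in
  [/\ gsmooth D f,
   \forall e \near 0^'+, forall k, (k < m)%N ->
     dn k (f e) (const_mx (a e)) = 0 /\ dn k (f e) (const_mx (b e)) = 0
   & exists h : Rt -> 'rV[Rt]_d, gsf_curve0 t1 t2 m h /\
     forall u, pts slab1 u -> h (vcls rho u 0 0) =
       vcls rho (fun e => f e (u e) *: delta_mx 0 j0)].
Proof.
move=> DX sg f.
have Dm u : npts D u -> vmoderate rho u by rewrite DX => -[].
have sa : gsmooth D (fun e x => x 0 0 - a e).
  by apply: gsmoothB; [exact: gsmooth_coord|exact: gsmooth_cst].
have sb : gsmooth D (fun e x => b e - x 0 0).
  by apply: gsmoothB; [exact: gsmooth_cst|exact: gsmooth_coord].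
have sf : gsmooth D f.
  by apply: gsmooth_mul => //; apply: gsmoothX; exact: gsmooth_mul.
have Ia : \forall e \near 0^'+, a e <= a e <= b e.
  by apply: filterS (slab_le ab) => e; rewrite lexx.
have Ib : \forall e \near 0^'+, a e <= b e <= b e.
  by apply: filterS (slab_le ab) => e ->; rewrite lexx.
have f0 : \forall e \near 0^'+, forall k, (k < m)%N ->
    dn k (f e) (const_mx (a e)) = 0 /\ dn k (f e) (const_mx (b e)) = 0.
  apply: filterS3 near_unit (dom_itv DX) (slab_le ab) => e e01 De abe k km.
  have Da : D e (const_mx (a e)) by apply: De; rewrite lexx.
  have Db : D e (const_mx (b e)) by apply: De; rewrite lexx abe.
  split.
    have s1 := gsmooth_mul (gsmoothX m sb) sg.
    rewrite -[RHS](dn_flat Dm ma s1 km e01 Da); congr (dn _ _ _).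
    by apply/funext => x; rewrite /f exprMn mulrA.
  have s1 := gsmooth_mul (gsmooth_mul (gsmooth_cst D (mod_cst rho ((-1) ^+ m)))
    (gsmoothX m sa)) sg.
  rewrite -[RHS](dn_flat Dm mb s1 km e01 Db); congr (dn _ _ _).
  apply/funext => x; rewrite /f -(opprB (x 0 0)) mulrN -mulrN1 !exprMn.
  by ring.
pose he e x : 'rV[R]_d := f e x *: delta_mx 0 j0.
have she j : gsmooth D (fun e x => he e x 0 j).
  apply: gsmooth_ext (gsmooth_mul sf (gsmooth_cst D (mod_cst rho
    ((delta_mx 0 j0 : 'rV[R]_d) 0 j)))) => e x _ _; by rewrite !mxE.
split=> //; have [h0 h0N] := gsf_of_net DX she.
have [_ [_ _ _ h0E]] := (gsf_netP _ _ _ _).1 h0N.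
pose h t := h0 (const_mx t).
have hE u : pts slab1 u -> h (vcls rho u 0 0) = vcls rho (fun e => he e (u e)).
  by move=> Pu; rewrite /h const_mx_coord; exact: h0E.
exists h; split=> //; split.
  split=> //; exists D, he; apply/gsf_netP; exists D; split=> //.
have zero c : (\forall e \near 0^'+, a e <= c e <= b e) -> forall i,
    (\forall e \near 0^'+, dn i (f e) (const_mx (c e)) = 0) ->
    cderiv (gitv t1 t2) i h (cls rho c) = 0.
  move=> cI i c0; have Pc := pts_const ma mb cI.
  rewrite (_ : cls rho c = vcls rho (fun e => const_mx (c e) : 'rV[R]_1) 0 0); last first.
    by rewrite mxE; apply: cls_ev; apply: nearW => e; rewrite mxE.
  apply/rowP => j; rewrite (cderivE ma mb ab i j DX she hE Pc) !mxE.
  rewrite -(cls0 rho); apply: cls_ev; apply: filterS c0 => e c0.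
  by rewrite dn_unit c0 if_same.
move=> i im; split; apply: zero => //.
  by apply: filterS f0 => e /(_ i im)[].
by apply: filterS f0 => e /(_ i im)[].
Qed.

Variables (DL : ndom n) (L : 'rV[Rt]_n -> Rt) (l : R -> 'rV[R]_n -> R).
Hypotheses (DLX : npts DL = pts slabL) (sl : gsmooth DL l).
Hypothesis (fL : forall v, pts slabL v -> L (vcls rho v) = cls rho (fun e => l e (v e))).
Variables (D : ndom 1) (q : Rt -> 'rV[Rt]_d) (qe : R -> 'rV[R]_1 -> 'rV[R]_d).
Hypothesis (DX : npts D = pts slab1).
Hypothesis (sq : forall j, gsmooth D (fun e x => qe e x 0 j)).
Hypothesis (fq : forall u, pts slab1 u ->
  q (vcls rho u 0 0) = vcls rho (fun e => qe e (u e))).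

Definition momentum (i : 'I_m.+1) (j : 'I_d) e (x : 'rV[R]_1) : R :=
  'D_(delta_mx 0 (jet_idx i j)) (l e) (qjet m qe e x).

Lemma qjet_pts u : pts slab1 u -> pts slabL (fun e => qjet m qe e (u e)).
Proof.
move=> Pu; have Dm v : npts D v -> vmoderate rho v by rewrite DX => -[].
apply: (jet_point_pts (gsmooth_coord 0 Dm) (fun i j => gsmooth_dn i (sq j))).
  by rewrite DX.
by case: Pu => _; rewrite /slab/= mxE.
Qed.

Lemma momentum_gsmooth : exists D1 : ndom 1, [/\ npts D1 = pts slab1,
  forall f, gsmooth D f -> gsmooth D1 f & forall i j, gsmooth D1 (momentum i j)].
Proof.
have Dm u : npts D u -> vmoderate rho u by rewrite DX => -[].
have sj := jet_point_gsmooth (gsmooth_coord 0 Dm)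
  (fun (i : 'I_m.+1) j => gsmooth_dn i (sq j)).
have [|u Du|D1 [D1X D1E D1D D1B]] := @comp_dom _ rho _ _ D DL (qjet m qe).
- exact: sj.
- by rewrite DLX; apply: qjet_pts; rewrite -DX.
exists D1; split; [by rewrite D1X|exact: D1B|].
by move=> i j; exact: (D1D _ (gsmoothD (jet_idx i j) sl)).
Qed.

Lemma euler_lagrangeE u j : pts slab1 u ->
  (\sum_(i < m.+1) (-1) ^+ i *: cderiv (gitv t1 t2) i
     (fun s => grad_lag t1 t2 L i (jet t1 t2 m q s)) (vcls rho u 0 0)) 0 j =
  cls rho (fun e => euler_sum (fun i => momentum i j e) (u e)).
Proof.
move=> Pu; have [D1 [D1X _ sm]] := momentum_gsmooth.
have Du : npts D1 u by rewrite D1X.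
rewrite summxE cls_sum; last first.
  move=> i _; apply: modM; first exact: mod_cst.
  exact: (gsmooth_mod (gsmooth_dn i (sm i j)) Du).
apply: eq_bigr => i _; rewrite mxE.
pose ce e x : 'rV[R]_d := \row_j momentum i j e x.
have sce k : gsmooth D1 (fun e x => ce e x 0 k).
  by apply: gsmooth_ext (sm i k) => e x _ _; rewrite mxE.
have fce v : pts slab1 v -> grad_lag t1 t2 L i (jet t1 t2 m q (vcls rho v 0 0)) =
    vcls rho (fun e => ce e (v e)).
  move=> Pv; apply/rowP => k; rewrite (jetE ma mb ab m DX sq fq Pv).
  rewrite (grad_lagE ma mb ab DLX sl fL i k (qjet_pts Pv)) mxE.
  by apply: cls_ev; apply: nearW => e; rewrite mxE.
rewrite (cderivE (c := fun s => grad_lag t1 t2 L i (jet t1 t2 m q s))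
  ma mb ab i j D1X sce fce Pu).
have -> : (fun e => dn i (fun x => ce e x 0 j) (u e)) =
    (fun e => dn i (momentum i j e) (u e)).
  by apply/funext => e; congr (dn _ _ _); apply/funext => x; rewrite mxE.
have ms : cls rho (fun=> (-1) ^+ i) = (-1) ^+ i.
  elim: (nat_of_ord i) => [|k IH]; first by rewrite expr0 cls1.
  rewrite [RHS]exprS -IH mulN1r -clsN; congr cls; apply/funext => e.
  by rewrite exprS mulN1r.
rewrite -ms -(clsM (mod_cst rho _)) //.
exact: (gsmooth_mod (gsmooth_dn i (sm i j)) Du).
Qed.

(** The test curve is the weight times the component of the Euler-Lagrange
    expression itself, so that its vanishing first variation is the weighted
    integral of a square. *)
Lemma euler_lagrange_ngl j : weak_extremal t1 t2 L q ->
  forall N, \forall e \near 0^'+, forall t, a e <= t <= b e ->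
    `|euler_sum (fun i => momentum i j e) (const_mx t)| <= rho e ^+ N.
Proof.
move=> ext; have [D1 [D1X D1B sm]] := momentum_gsmooth.
have sE := gsmooth_euler_sum (fun i => sm i j).
have sq1 k : gsmooth D1 (fun e x => qe e x 0 k) by exact: D1B.
have [] := test_curve j D1X sE.
set f := fun e x => _ => sf f0 [h [h0 hE]].
apply: (fundamental_lemma ma mb ab D1X sE (m := m)).
pose he e x : 'rV[R]_d := f e x *: delta_mx 0 j.
have she k : gsmooth D1 (fun e x => he e x 0 k).
  apply: gsmooth_ext (gsmooth_mul sf (gsmooth_cst D1 (mod_cst rho
    ((delta_mx 0 j : 'rV[R]_d) 0 k)))) => e x _ _; by rewrite !mxE.
have := ext h h0.
rewrite (first_variationE ma mb ab DLX sl fL D1X sq1 she fq hE) => J0.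
have inner e t : \sum_(i < m.+1) \sum_k
      'D_(delta_mx 0 (jet_idx i k)) (l e) (qjet m qe e (const_mx t)) *
      dn i (fun x => he e x 0 k) (const_mx t) =
    \sum_(i < m.+1) momentum i j e (const_mx t) * dn i (f e) (const_mx t).
  apply: eq_bigr => i _; rewrite (bigD1 j)//= dn_unit eqxx big1 ?addr0//.
  by move=> k kj; rewrite dn_unit (negbTE kj) mulr0.
have mF : mod (fun e => riemann (fun t => \sum_(i < m.+1) momentum i j e (const_mx t) *
    dn i (f e) (const_mx t)) (a e) (b e) (nodes rho e)).
  apply: (riemann_mod ma mb ab) => t tI; apply: mod_sum => i _.
  have Dt : npts D1 (fun e => const_mx (t e)).
    by rewrite D1X; exact: (pts_const ma mb).
  apply: modM; first exact: (gsmooth_mod (sm i j) Dt).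
  exact: (gsmooth_mod (gsmooth_dn i sf) Dt).
have nF : ngl (fun e => riemann (fun t => \sum_(i < m.+1) momentum i j e (const_mx t) *
    dn i (f e) (const_mx t)) (a e) (b e) (nodes rho e)).
  apply/(cls_eq0 mF); rewrite -J0; apply: cls_ev; apply: nearW => e.
  by congr (riemann _ _ _ _); apply/funext => t; rewrite inner.
have nP := parts_net D1X (fun i => sm i j) sf f0.
apply: ngl_ev (nglB nF nP); apply: nearW => e; rewrite opprB addrC subrK.
congr (riemann _ _ _ _); apply/funext => t.
by rewrite /f mxE mulrCA expr2.
Qed.

End EulerLagrange.

Theorem corollary45 (R : realType) (rho : gauge R) (t1 t2 : Rt rho)
    (d m : nat) (L : 'rV[Rt rho]_(1 + m.+1 * d) -> Rt rho)
    (q : Rt rho -> 'rV[Rt rho]_d) :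
  glt t1 t2 -> (0 < d)%N -> (0 < m)%N ->
  gsf (lag_dom t1 t2 d m) setT (scalarf L) ->
  gsf_curve t1 t2 q ->
  weak_extremal t1 t2 L q ->
  forall t, gitv t1 t2 t ->
    \sum_(i < m.+1) (-1) ^+ i *:
      cderiv (gitv t1 t2) i (fun s => grad_lag t1 t2 L i (jet t1 t2 m q s)) t
    = 0.
Proof.
have [a ma ->] := cls_surj t1; have [b mb ->] := cls_surj t2.
move=> /(glt_cls ma mb)[M ab] _ _ [_ [OmL [Le LN]]] [_ [Omq [qe qN]]] ext t tI.
rewrite lag_dom_slab in LN.
have [DL [_ DLX sLe fLe]] := (gsf_netP _ _ _ _).1 LN.
have [D [_ DX sq fq]] := (gsf_netP _ _ _ _).1 qN.
pose l e x := Le e x 0 0.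
have sl : gsmooth rho DL l by exact: sLe.
have fL v : pts (@slab R rho a b _ (lshift (m.+1 * d) 0)) v ->
    L (vcls rho v) = cls rho (fun e => l e (v e)).
  by move=> /fLe/rowP/(_ 0); rewrite !mxE.
have [s ms tE] := cls_surj t; rewrite {}tE in tI *.
have le_ab := slab_le ab.
pose u e : 'rV[R]_1 := const_mx (clamp (a e) (b e) (s e)).
have uI : \forall e \near 0^'+, a e <= clamp (a e) (b e) (s e) <= b e.
  by apply: filterS le_ab => e; exact: clamp_itv.
have Pu := pts_const ma mb uI.
have -> : cls rho s = vcls rho u 0 0.
  rewrite (cls_eq (gitv_clamp ma mb ms le_ab tI)) mxE.
  by apply: cls_ev; apply: nearW => e; rewrite mxE.
apply/rowP => j; rewrite (euler_lagrangeE ma mb ab DLX sl fL DX sq fq j Pu) mxE.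
rewrite -(cls0 rho); apply: cls_eq => N.
have h := euler_lagrange_ngl ma mb ab DLX sl fL DX sq fq j ext N.
by apply: filterS2 h uI => e h; rewrite subr0 => /h.
Qed.
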